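(* Let $G$ be an undergroup with metric $\rho$ and unity $e$, and let $(\mu_t)_{t\in[0,\infty)}$ be a convolution semigroup in $G$. For each $n=1,2,\dots$ let $\mu^{(n)}\in M(G)$ be such that the convolution $\mu^{(n)}*\mu^{(n)}$ is defined, and put $\mu^{(n)}_{k/2^n}=\underbrace{\mu^{(n)}*\dots*\mu^{(n)}}_{k}$ for $k=1,2,\dots$, and $\mu^{(n)}_0=\delta_e$. Assume that $\rho_{\mathrm{KR}}\bigl(\mu^{(n)}_t,\mu_t\bigr)\to 0$ as $n\to\infty$ for every binary-rational number $t\ge 0$ (i.e. $t=k\cdot 2^{-l}$ with nonnegative integers $k,l$; $\mu^{(n)}_t$ is defined for $n\ge l$). Let $\psi:G\to\mathbb{R}$ be a bounded Borel measurable function, continuous $\mu_1$-almost everywhere, with $\int_G|\psi(f)|^2\,\mu_1(df)=1$. Put $c_n=\int_G|\psi(f)|^2\,\mu^{(n)}_1(df)$ (so that $c_n\to1$; only those $n$ with $c_n>0$ are considered). Let $S_n^{\mathrm{random}}\subset[0,1]$ be a random set distributed according to the spectral measure $\nu_n$ of the random variable $c_n^{-1/2}\psi\bigl(X^{(n)}_{0,1}\bigr)$ (discrete time with pitch $2^{-n}$). Then: (a) The sequence $(S_n^{\mathrm{random}})_n$ converges in distribution, in the space of all closed subsets of $[0,1]$ with the Hausdorff metric, to some random closed set $S^{\mathrm{random}}$. (b) Almost surely, $S^{\mathrm{random}}$ is a closed subset of $[0,1]$ having zero Lebesgue measure. (c) $\mathbb{P}\bigl(t\in S^{\mathrm{random}}\bigr)=0$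 for every $t\in[0,1]$. (d) For every finite union $E\subset[0,1]$ of intervals, $$\mathbb{P}\bigl(S^{\mathrm{random}}\subset E\bigr)=\mathbb{E}\,\bigl|\,\mathbb{E}\bigl(\psi(X_{0,1})\,\big|\,\mathcal{F}_E\bigr)\bigr|^2,$$ where $(X_{s,t})$ is the continuous-time independent process associated with $(\mu_t)$ and $\mathcal{F}_E$ is the corresponding $\sigma$-field.
   Context: **Undergroup.** An undergroup $G$ is a set equipped with a metric $\rho$ and a map $(f,g)\mapsto fg$ from a subset of $G\times G$ to $G$ (''$fg$ is defined'' means that $(f,g)$ lies in this subset) such that: (a) there is $e\in G$ (the unity, unique) such that for every $f\in G$ both $ef$ and $fe$ are defined and $ef=f=fe$; (b) if $f,g,h\in G$ are such that $fg$ and $gh$ are defined, then $(fg)h$ and $f(gh)$ are defined and $(fg)h=f(gh)$; (c) if $fg,f_1g_1,f_2g_2,\dots$ are defined, $\rho(f_n,f)\to0$ and $\rho(g_n,g)\to0$, then $\rho(f_ng_n,fg)\to0$; (d) if $fg$ is defined then $\rho(f,fg)\le\rho(e,g)$ and $\rho(g,fg)\le\rho(e,f)$; (e) $\rho(f,g)\le1$ for all $f,g\in G$. **Measures and convolution.** A measure on $G$ means a Borel probability measure concentrated on a countable union of $\rho$-compact subsets; $M(G)$ is the set of all such measures. For $\mu,\nu\in M(G)$, if $fg$ is defined for $\mu\otimes\nu$-almost all pairs $(f,g)$, the convolution $\mu*\nu$ is the image of $\mu\otimes\nu$ under $(f,g)\mapsto fg$; otherwise $\mu*\nu$ is undefined.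 The unit of $M(G)$ is $\delta_e$, the unit mass at $e$. The transportation (Kantorovich–Rubinstein) metric is $\rho_{\mathrm{KR}}(\mu,\nu)=\sup_\phi\bigl|\int\phi\,d\mu-\int\phi\,d\nu\bigr|$, the supremum being over all $\phi:G\to\mathbb{R}$ with $|\phi(f)-\phi(g)|\le\rho(f,g)$ for all $f,g\in G$. If $\mu*\mu$ is defined, then by property (b) all convolution powers $\mu*\dots*\mu$ are defined. **Convolution semigroup.** A convolution semigroup in $G$ is a family $(\mu_t)_{t\in[0,\infty)}$ in $M(G)$ such that $\mu_0=\delta_e$; $\rho_{\mathrm{KR}}(\mu_t,\mu_0)\to0$ as $t\to0$; and for all $s,t\ge0$ the convolution $\mu_s*\mu_t$ is defined and equals $\mu_{s+t}$. **Continuous-time independent process.** Given a convolution semigroup $(\mu_t)$, there is a family $(X_{s,t})_{0\le s\le t<\infty}$ of $G$-valued random variables on some probability space such that $X_{s,t}$ has distribution $\mu_{t-s}$; $X_{r,s}X_{s,t}=X_{r,t}$ almost surely for $r\le s\le t$ (the exceptional set may depend on $r,s,t$); and $X_{0,t_1},X_{t_1,t_2},\dots,X_{t_{n-1},t_n}$ are independent whenever $0\le t_1\le\dots\le t_n$. For $E\subset[0,1]$ a finite union of intervals, $\mathcal{F}_E$ is the $\sigma$-field generated by all $X_{u,v}$ with $u\le v$, $[u,v]\subset E$. Every $\sigma$-field is assumed to contain all negligible sets. **Discrete time with pitch $2^{-n}$.** For each $n$, let $X^{(n)}_{(k-1)2^{-n},\,k2^{-n}}$, $k\in\mathbb{Z}$,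 be independent $G$-valued random variables with distribution $\mu^{(n)}$ (the underlying probability space may depend on $n$). For $s<t$ in $2^{-n}\mathbb{Z}$, $X^{(n)}_{s,t}$ is the product, in increasing order of time, of the variables $X^{(n)}_{(k-1)2^{-n},k2^{-n}}$ with $[(k-1)2^{-n},k2^{-n}]\subset[s,t]$; it is defined almost surely and has distribution $\mu^{(n)}_{t-s}$. **Spectral measure.** For $A\subset\{1,\dots,2^n\}$ put $E_A=\bigcup_{k\in A}[(k-1)2^{-n},k2^{-n}]\subset[0,1]$ (with $E_\emptyset=\emptyset$) and let $\mathcal{F}^{(n)}_A$ be the $\sigma$-field generated by $X^{(n)}_{(k-1)2^{-n},k2^{-n}}$, $k\in A$. For a function $\chi:G\to\mathbb{R}$ with $\mathbb{E}|\chi(X^{(n)}_{0,1})|^2=1$, the spectral measure of $\chi(X^{(n)}_{0,1})$ is the distribution of the random set $S^{\mathrm{random}}$, with values in $\{E_A: A\subset\{1,\dots,2^n\}\}$, determined by $$\mathbb{P}\bigl(S^{\mathrm{random}}\subset E_A\bigr)=\mathbb{E}\,\bigl|\mathbb{E}\bigl(\chi(X^{(n)}_{0,1})\,\big|\,\mathcal{F}^{(n)}_A\bigr)\bigr|^2\quad\text{for all }A,$$ equivalently, by inclusion–exclusion, $\mathbb{P}(S^{\mathrm{random}}=E_A)=\sum_{B\subset A}(-1)^{|A|-|B|}\,\mathbb{E}\,\bigl|\mathbb{E}\bigl(\chi(X^{(n)}_{0,1})\,\big|\,\mathcal{F}^{(n)}_B\bigr)\bigr|^2$. **Hausdorff metric.**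 For closed $S_1,S_2\subset[0,1]$, $\rho_{\mathrm H}(S_1,S_2)=\inf\{\varepsilon>0: S_1\subset(S_2)_{+\varepsilon},\ S_2\subset(S_1)_{+\varepsilon}\}$, where $(S)_{+\varepsilon}$ is the $\varepsilon$-neighborhood of $S$. The empty set is included as a closed subset and is an isolated point of this space (its distance to any nonempty set is $\inf\emptyset=+\infty$, which may be replaced by a constant such as $2$). Convergence in distribution means weak convergence of laws on this compact space. *)

(* Defs.v *)
From HB Require Import structures.
From mathcomp Require Import all_boot all_order all_algebra.
From mathcomp Require Import all_classical all_reals all_analysis.
From mathcomp Require Import lra.

Set Implicit Arguments.
Unset Strict Implicit.
Unset Printing Implicit Defensive.

Import Order.TTheory GRing.Theory Num.Theory.
Import numFieldNormedType.Exports.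

Local Open Scope classical_set_scope.
Local Open Scope ring_scope.

(* Borel sets of a topological space, as a measurableType.  [borel T] is
   convertible to [T] but carries no topology. *)
Notation borel T := (g_sigma_algebraType (@open T)).

(* The partial product is [umul]: [fg] is defined iff [umul f g <> None].
   The unity is the distinguished point. *)
HB.mixin Record isUndergroup (R : realType) G & Metric R G & Pointed G := {
  umul : G -> G -> option G ;
  umul1g : forall f : G, umul point f = Some f ;
  umulg1 : forall f : G, umul f point = Some f ;
  umulA : forall f g h fg gh : G, umul f g = Some fg -> umul g h = Some gh ->
    exists2 fgh, umul fg h = Some fgh & umul f gh = Some fgh ;
  umul_cvg : forall (f_ g_ p_ : nat -> G) (f g p : G),
    umul f g = Some p -> (forall n, umul (f_ n) (g_ n) = Some (p_ n)) ->
    mdist (f_ n) f @[n --> \oo] --> (0 : R) ->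
    mdist (g_ n) g @[n --> \oo] --> (0 : R) ->
    mdist (p_ n) p @[n --> \oo] --> (0 : R) ;
  mdist_umull : forall f g p : G, umul f g = Some p ->
    mdist f p <= mdist (point : G) g :> R ;
  mdist_umulr : forall f g p : G, umul f g = Some p ->
    mdist g p <= mdist (point : G) f :> R ;
  mdist_le1 : forall f g : G, mdist f g <= 1 :> R
}.

#[short(type="undergroupType")]
HB.structure Definition Undergroup (R : realType) :=
  { G of Metric R G & Pointed G & isUndergroup R G }.

Section measures.
Context (R : realType) (G : undergroupType R).
Implicit Types mu nu lam : probability (borel G) R.

(* membership in M(G) *)
Definition sigma_compact_supported mu : Prop :=
  exists2 K : nat -> set G, forall i, compact (K i) &
    mu (\bigcup_i K i) = 1%E.

Definition conv_defined mu nu : Prop :=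
  {ae (mu \x nu)%E, forall p, umul (p.1 : G) (p.2 : G)}.

(* The product map is only defined almost everywhere, so its image measure is
   taken through an everywhere defined measurable function that agrees with it
   almost everywhere. *)
Definition is_conv mu nu lam : Prop :=
  exists2 m : {mfun (borel G * borel G)%type >-> borel G},
    {ae (mu \x nu)%E, forall p, umul (p.1 : G) (p.2 : G) = Some (m p : G)} &
    forall B : set (borel G), measurable B ->
      lam B = pushforward (mu \x nu)%E m B.

Definition unit_mass : probability (borel G) R := \d_(point : borel G).

(* junk value [unit_mass] when the convolution is undefined *)
Definition conv mu nu : probability (borel G) R :=
  xget unit_mass [set lam | is_conv mu nu lam].

Fixpoint conv_pow mu (k : nat) : probability (borel G) R :=
  if k is k'.+1 then conv (conv_pow mu k') mu else unit_mass.

(* All test functions have oscillation at most 1 because the metric does, so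
   this is a real supremum of a nonempty bounded set. *)
Definition KR mu nu : R :=
  sup [set `| \int[mu]_f phi f - \int[nu]_f phi f | | phi in
        [set phi : G -> R | forall f g, `|phi f - phi g| <= mdist f g]].

(* The times are the nonnegative reals; [mu t] is unconstrained for t < 0.
   Equality of measures means equality on Borel sets. *)
Record conv_semigroup (mu : R -> probability (borel G) R) : Prop := {
  conv_semigroup_M : forall t, 0 <= t -> sigma_compact_supported (mu t) ;
  conv_semigroup0 : forall B : set (borel G), measurable B ->
    mu 0 B = unit_mass B ;
  conv_semigroup_cvg : KR (mu t) (mu 0) @[t --> 0^'+] --> (0 : R) ;
  conv_semigroupD : forall s t, 0 <= s -> 0 <= t ->
    is_conv (mu s) (mu t) (mu (s + t))
}.

End measures.

Section probability.
Context d (Omega : measurableType d) (R : realType) (P : probability Omega R).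

Definition mutually_independent d' (T : measurableType d') (I : eqType)
    (Y : I -> Omega -> T) : Prop :=
  forall (s : seq I) (B : I -> set T), uniq s ->
    (forall i, measurable (B i)) ->
    P (\bigcap_(i in [set` s]) (Y i @^-1` B i)) =
    (\prod_(i <- s) P (Y i @^-1` B i))%E.

(* A sub-sigma-algebra of [measurable] only when [P] is complete, since
   negligible sets need not be measurable. *)
Definition sigma_field d' (T : measurableType d') (I : Type)
    (Y : I -> Omega -> T) (D : set I) : set (set Omega) :=
  <<s (\bigcup_(i in D) preimage_set_system setT (Y i) measurable) `|`
      [set N | P.-negligible N] >>.

Definition is_cond_exp (F : set (set Omega)) (Y Z : Omega -> R) : Prop :=
  [/\ preimage_set_system setT Z measurable `<=` F,
      P.-integrable setT (EFin \o Z) &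
      forall A, F A ->
        (\int[P]_(w in A) (Z w)%:E = \int[P]_(w in A) (Y w)%:E)%E].

(* Some version of E(Y | F); versions agree almost surely. *)
Definition cond_exp (F : set (set Omega)) (Y : Omega -> R) : Omega -> R :=
  xget (cst 0) [set Z | is_cond_exp F Y Z].

Definition cond_energy (F : set (set Omega)) (Y : Omega -> R) : \bar R :=
  ('E_P[fun w => (`|cond_exp F Y w| ^+ 2)%R])%E.

End probability.

Section processes.
Context (R : realType) (G : undergroupType R).
Context d (Omega : measurableType d) (P : probability Omega R).

(* [X k] stands for X_{(k-1)h, kh}, where h is the pitch. *)
Record discrete_process (mu : probability (borel G) R)
    (X : int -> {RV P >-> borel G}) : Prop := {
  discrete_process_law : forall k (B : set (borel G)), measurable B ->
    distribution P (X k) B = mu B ;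
  discrete_process_indep : mutually_independent P (fun k => X k : _ -> _)
}.

(* By associativity the bracketing is irrelevant as soon as the products of
   neighbours are defined. *)
Definition uprod (s : seq G) : option G :=
  foldl (fun o g => obind (fun f => umul f g) o) (Some point) s.

(* X_{0,1} for the pitch 2^-n.  For a discrete process whose law has a defined
   convolution square the product is defined almost surely; elsewhere the value
   is junk. *)
Definition discrete_X01 (n : nat) (X : int -> {RV P >-> borel G}) (w : Omega)
  : G := odflt point (uprod [seq X k%:Z w : G | k <- iota 1 (2 ^ n)]).

Record indep_process (mu : R -> probability (borel G) R)
    (X : R -> R -> {RV P >-> borel G}) : Prop := {
  indep_process_law : forall s t (B : set (borel G)), 0 <= s -> s <= t ->
    measurable B -> distribution P (X s t) B = mu (t - s) B ;
  indep_process_mul : forall r s t, 0 <= r -> r <= s -> s <= t ->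
    {ae P, forall w, umul (X r s w : G) (X s t w : G) = Some (X r t w : G)} ;
  indep_process_indep : forall (n : nat) (t : nat -> R), t 0%N = 0 ->
    (forall i, (i < n)%N -> t i <= t i.+1) ->
    mutually_independent P (fun i : 'I_n => X (t i) (t i.+1) : _ -> _)
}.

Definition process_field (X : R -> R -> {RV P >-> borel G}) (E : set R)
  : set (set Omega) :=
  sigma_field P (fun uv : R * R => X uv.1 uv.2 : _ -> _)
    [set uv | uv.1 <= uv.2 /\ `[uv.1, uv.2] `<=` E].

End processes.

Definition finite_union_of_intervals (R : realType) (E : set R) : Prop :=
  exists s : seq (interval R), E = \bigcup_(i in [set` s]) [set` i].

Record closed01 (R : realType) := Closed01 {
  closed01_set :> set R ;
  closed01_closed : closed closed01_set ;
  closed01_sub : closed01_set `<=` `[0, 1] }.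

HB.instance Definition _ (R : realType) := gen_eqMixin (closed01 R).
HB.instance Definition _ (R : realType) := gen_choiceMixin (closed01 R).

Section hausdorff.
Context (R : realType).
Implicit Types (S : closed01 R) (e : R).

Lemma closed01_inj S1 S2 : S1 = S2 :> set R -> S1 = S2.
Proof.
case: S1 S2 => [A cA sA] [B cB sB] /= AB; subst B.
by congr Closed01; exact: Prop_irrelevance.
Qed.

Definition enlarge (A : set R) e : set R := \bigcup_(x in A) ball x e.

Definition hausdorff_radii S1 S2 : set R :=
  [set e | [/\ 0 < e, S1 `<=` enlarge S2 e & S2 `<=` enlarge S1 e]].

(* The infimum of the empty set (the distance from the empty set to a nonempty
   set) is replaced by 2. *)
Definition hausdorff_dist S1 S2 : R :=
  if `[< hausdorff_radii S1 S2 !=set0 >] then inf (hausdorff_radii S1 S2)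
  else 2.

Lemma hausdorff_radii_sym S1 S2 : hausdorff_radii S1 S2 = hausdorff_radii S2 S1.
Proof. by apply/seteqP; split=> e [? ? ?]; split. Qed.

Lemma hausdorff_radii_lb S1 S2 : has_lbound (hausdorff_radii S1 S2).
Proof. by exists 0 => e [/ltW]. Qed.

Lemma hausdorff_radii_up S1 S2 e e' :
  hausdorff_radii S1 S2 e -> e <= e' -> hausdorff_radii S1 S2 e'.
Proof.
move=> [e0 s12 s21] ee'; split; first exact: lt_le_trans ee'.
- by move=> x /s12[y Sy yx]; exists y => //; exact: le_ball yx.
- by move=> x /s21[y Sy yx]; exists y => //; exact: le_ball yx.
Qed.

Lemma hausdorff_radii_add S2 S1 S3 e e' : hausdorff_radii S1 S2 e ->
  hausdorff_radii S2 S3 e' -> hausdorff_radii S1 S3 (e + e').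
Proof.
move=> [e0 s12 s21] [e'0 s23 s32]; split; first exact: addr_gt0.
- move=> x /s12[y /s23[z Sz zy] yx]; exists z => //.
  by rewrite addrC; exact: ball_triangle zy yx.
- by move=> x /s32[y /s21[z Sz zy] yx]; exists z => //; exact: ball_triangle zy yx.
Qed.

Lemma hausdorff_radii_diam S1 S2 : S1 !=set0 -> S2 !=set0 ->
  hausdorff_radii S1 S2 2.
Proof.
move=> [x S1x] [y S2y].
suff H (a b : R) : a \in `[0, 1] -> b \in `[0, 1] -> ball a 2 b.
  split=> // [u S1u|u S2u]; [exists y|exists x] => //; apply: H;
  solve [exact: (closed01_sub S1y)|exact: (closed01_sub S2y)
        |exact: (closed01_sub S1u)|exact: (closed01_sub S2u)
        |exact: (closed01_sub S1x)].
rewrite !in_itv/= => /andP[a0 a1] /andP[b0 b1].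
by rewrite /ball/= ltr_norml; apply/andP; split; lra.
Qed.

Lemma hausdorff_radii_ex S1 S2 :
  (hausdorff_radii S1 S2 !=set0) = (S1 !=set0 <-> S2 !=set0).
Proof.
apply/propext; split.
  by move=> [e [_ s12 s21]]; split=> [[x /s12[y ? _]]|[x /s21[y ? _]]]; exists y.
move=> S12; have [S10|/nonemptyPn S10] := pselect (S1 !=set0).
  by exists 2; apply: hausdorff_radii_diam => //; apply/S12.
have /nonemptyPn S20 : ~ (S2 !=set0) by move=> /S12; rewrite S10 => -[].
by exists 1; split=> //; rewrite ?S10 ?S20.
Qed.

Lemma hausdorff_dist_ge0 S1 S2 : 0 <= hausdorff_dist S1 S2.
Proof.
rewrite /hausdorff_dist; case: asboolP => // ne.
by apply: lb_le_inf => // e [/ltW].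
Qed.

Lemma hausdorff_dist_le2 S1 S2 : hausdorff_dist S1 S2 <= 2.
Proof.
rewrite /hausdorff_dist; case: asboolP => //; rewrite hausdorff_radii_ex => ne.
apply: (inf_lbound (hausdorff_radii_lb _ _)).
have [S10|/nonemptyPn S10] := pselect (S1 !=set0).
  by apply: hausdorff_radii_diam => //; apply/ne.
have /nonemptyPn S20 : ~ (S2 !=set0) by move=> /ne; rewrite S10 => -[].
by split=> //; rewrite ?S10 ?S20.
Qed.

Lemma hausdorff_dist_lt S1 S2 e : hausdorff_radii S1 S2 !=set0 ->
  hausdorff_dist S1 S2 < e -> hausdorff_radii S1 S2 e.
Proof.
rewrite /hausdorff_dist => ne; case: asboolP => // _.
move=> /(inf_lt ne)[e' re' /ltW].
exact: hausdorff_radii_up.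
Qed.

Lemma hausdorff_distxx S : hausdorff_dist S S = 0.
Proof.
apply/eqP; rewrite eq_le hausdorff_dist_ge0 andbT.
have SS e : 0 < e -> hausdorff_radii S S e.
  by move=> e0; split=> // x Sx; exists x => //; exact: ballxx.
rewrite /hausdorff_dist; case: asboolP => [_|[]]; last by exists 1; exact: SS.
apply/ler_addgt0Pl => e e0; rewrite addr0.
exact: (inf_lbound (hausdorff_radii_lb _ _)) (SS _ e0).
Qed.

Lemma hausdorff_dist_sym S1 S2 : hausdorff_dist S1 S2 = hausdorff_dist S2 S1.
Proof. by rewrite /hausdorff_dist hausdorff_radii_sym. Qed.

Lemma hausdorff_dist_eq0 S1 S2 : hausdorff_dist S1 S2 = 0 -> S1 = S2.
Proof.
move=> S120.
have ne : hausdorff_radii S1 S2 !=set0.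
  move: S120; rewrite /hausdorff_dist; case: asboolP => // _ /eqP.
  by rewrite pnatr_eq0.
have r e : 0 < e -> hausdorff_radii S1 S2 e.
  by move=> e0; apply: hausdorff_dist_lt => //; rewrite S120.
apply: closed01_inj; apply/seteqP; split=> x Sx.
- apply: (closed01_closed (c := S2)) => B /nbhs_ballP[e /= e0 xeB].
  have [_ /(_ _ Sx)[y S2y yx] _] := r _ e0.
  by exists y; split=> //; apply: xeB; exact: ball_sym.
- apply: (closed01_closed (c := S1)) => B /nbhs_ballP[e /= e0 xeB].
  have [_ _ /(_ _ Sx)[y S2y yx]] := r _ e0.
  by exists y; split=> //; apply: xeB; exact: ball_sym.
Qed.

Lemma hausdorff_dist_triangle S2 S1 S3 :
  hausdorff_dist S1 S3 <= hausdorff_dist S1 S2 + hausdorff_dist S2 S3.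
Proof.
have [n12|n12] := pselect (hausdorff_radii S1 S2 !=set0); last first.
  rewrite (le_trans (hausdorff_dist_le2 _ _))//.
  rewrite {1}/hausdorff_dist (asboolF n12).
  by rewrite lerDl hausdorff_dist_ge0.
have [n23|n23] := pselect (hausdorff_radii S2 S3 !=set0); last first.
  rewrite (le_trans (hausdorff_dist_le2 _ _))//.
  rewrite {2}/hausdorff_dist (asboolF n23).
  by rewrite lerDr hausdorff_dist_ge0.
apply/ler_addgt0Pl => e e0.
have r12 : hausdorff_radii S1 S2 (hausdorff_dist S1 S2 + e / 2).
  by apply: hausdorff_dist_lt => //; rewrite ltrDl divr_gt0.
have r23 : hausdorff_radii S2 S3 (hausdorff_dist S2 S3 + e / 2).
  by apply: hausdorff_dist_lt => //; rewrite ltrDl divr_gt0.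
have := hausdorff_radii_add r12 r23; rewrite addrACA -splitr addrC => r13.
rewrite {1}/hausdorff_dist asboolT; last by eexists; exact: r13.
exact: (inf_lbound (hausdorff_radii_lb _ _)) r13.
Qed.

End hausdorff.

HB.instance Definition _ (R : realType) := @isMetric.Build R (closed01 R)
  (@hausdorff_dist R) (@hausdorff_distxx R) (@hausdorff_dist_eq0 R)
  (@hausdorff_dist_sym R) (@hausdorff_dist_triangle R).
HB.instance Definition _ (R : realType) := isPointed.Build (closed01 R)
  (Closed01 (@closed0 R) (@sub0set R _)).

Definition weak_cvg (R : realType) (T : ptopologicalType)
    (nu_ : nat -> probability (borel T) R) (nu : probability (borel T) R) :=
  forall phi : T -> R, continuous phi ->
    (exists M, forall x, `|phi x| <= M) ->
    \int[nu_ n]_x phi x @[n --> \oo] --> \int[nu]_x phi x.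

(* E_A; the element k of 'I_(2^n) stands for the index k.+1 in {1, ..., 2^n} *)
Definition dyadic_union (R : realType) (n : nat) (A : {set 'I_(2 ^ n)})
  : set R :=
  \bigcup_(k in [set` A]) [set` `[k%:R / 2 ^+ n, k.+1%:R / 2 ^+ n]].

Arguments dyadic_union R {n} A.

Section spectral_measure.
Context (R : realType) (G : undergroupType R).
Context d (Omega : measurableType d) (P : probability Omega R).

Definition discrete_field (n : nat) (X : int -> {RV P >-> borel G})
    (A : {set 'I_(2 ^ n)}) : set (set Omega) :=
  sigma_field P (fun k : 'I_(2 ^ n) => X k.+1%:Z : _ -> _) [set` A].

(* These conditions determine [nu].  They can only be met when the second
   moment of [chi X_{0,1}] is 1, as the case of the full set [A] shows. *)
Definition is_spectral_measure (n : nat) (X : int -> {RV P >-> borel G})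
    (chi : G -> R) (nu : probability (borel (closed01 R)) R) : Prop :=
  nu [set S : closed01 R | exists A : {set 'I_(2 ^ n)},
        S = dyadic_union R A :> set R] = 1%E /\
  forall A : {set 'I_(2 ^ n)},
    nu [set S : closed01 R | S `<=` dyadic_union R A] =
    cond_energy P (discrete_field X A) (fun w => chi (discrete_X01 n X w)).

End spectral_measure.

(* Main.v *)
Require Import Defs.
From HB Require Import structures.
From mathcomp Require Import all_boot all_order all_algebra.
From mathcomp Require Import all_classical all_reals all_analysis.
From mathcomp Require Import measurable_realfun lra ring zify.

Set Implicit Arguments.
Unset Strict Implicit.
Unset Printing Implicit Defensive.

Import Order.TTheory GRing.Theory Num.Theory.
Import numFieldNormedType.Exports.

Local Open Scope classical_set_scope.
Local Open Scope ring_scope.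

(* Take two independent copies of the increments; let one path use the first copy throughout,
   and let the other use the first copy on the blocks of a mask B and the second copy elsewhere.
   The energy E|E(psi(X_{0,1}) | F_B)|^2 is the integral of psi(x) psi(y) over the joint law of the
   two end points, and this law arises by multiplying independent block laws one after another:
   the image of mu_t on the diagonal for a block in B, mu_t (x) mu_t for a block outside B.
   KR-convergence of a block law is uniform over Lipschitz functions, so weak convergence survives
   each multiplication although the product is only partially defined, and the energies of dyadic
   unions converge to those of the limit semigroup.
   The limit energies are the probabilities P(S <= E_B) of a consistent family, realized by a random
   set on [0,1) through successive subdivision; a set is within Hausdorff distance 2^(1-l) of the
   union of the blocks of level l that it meets, so weak convergence is about finitely many events.
   As mu_s -> delta_e when s -> 0, removing the blocks near t costs little energy.  Hence t is almost
   surely not in S; (b) follows by Fubini, and (d) by squeezing E between dyadic unions. *)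

(** * Bounded measurable functions and laws *)

(** [G] need not be separable, so the product sigma-field on [G * G] may be smaller than the Borel
    one, and neither the partial product nor a Lipschitz function of two variables need be
    measurable for it. Tightness repairs this: the product is continuous on its domain, hence
    measurable on compact pieces of it. In each limit argument the laws, being countably many, are
    carried by one closed separable set [cl q], and integrands are composed with the retraction
    [cutq q] onto it. As continuity holds only on the domain, the portmanteau lemma is stated
    relative to a set [D] carrying all the laws. Convergence passes through a chain only if the
    number of blocks stays fixed while the pitch shrinks; for sets avoiding a time [t] three runs
    suffice: before, around and after [t]. The same mask may be cut into blocks in several ways;
    that the resulting integrals agree is never checked on the chains: each of them equals the limit
    of the discrete spectral probabilities. *)

Section bounded_measurable.
Context d (T : measurableType d) (R : realType).
Implicit Types f g : T -> R.

Definition bmeas f := measurable_fun setT f /\ exists M, forall x, `|f x| <= M.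

Lemma bmeas_cst (r : R) : bmeas (fun=> r).
Proof. by split; [exact: measurable_cst|exists `|r|]. Qed.

Lemma bmeasD f g : bmeas f -> bmeas g -> bmeas (fun x => f x + g x).
Proof.
move=> [mf [M fM]] [mg [N gN]]; split; first exact: measurable_funD.
by exists (M + N) => x; rewrite (le_trans (ler_normD _ _))// lerD.
Qed.

Lemma bmeasM f g : bmeas f -> bmeas g -> bmeas (fun x => f x * g x).
Proof.
move=> [mf [M fM]] [mg [N gN]]; split; first exact: measurable_funM.
by exists (M * N) => x; rewrite normrM ler_pM.
Qed.

Lemma bmeasZ (r : R) f : bmeas f -> bmeas (fun x => r * f x).
Proof. by apply: bmeasM; exact: bmeas_cst. Qed.

Lemma bmeasN f : bmeas f -> bmeas (fun x => - f x).
Proof.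
move=> [mf [M fM]]; split; first exact: measurableT_comp.
by exists M => x; rewrite normrN.
Qed.

Lemma bmeasB f g : bmeas f -> bmeas g -> bmeas (fun x => f x - g x).
Proof. by move=> bf bg; apply: bmeasD => //; exact: bmeasN. Qed.

Lemma bmeas_indic (A : set T) : measurable A -> bmeas (\1_A : T -> R).
Proof.
move=> mA; split; first exact: measurable_indic.
by exists 1 => x; rewrite indicE; case: (_ \in _); rewrite ?normr1 ?normr0.
Qed.

End bounded_measurable.

Lemma bmeas_comp d (T : measurableType d) d' (T' : measurableType d')
    (R : realType) (f : T' -> R) (g : T -> T') :
  bmeas f -> measurable_fun setT g -> bmeas (f \o g).
Proof.
move=> [mf [M fM]] mg; split; first exact: measurableT_comp.
by exists M => x /=.
Qed.

Section integrals.
Context d (T : measurableType d) (R : realType) (P : probability T R).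
Implicit Types f g : T -> R.

Lemma probT : P setT = 1%E.
Proof. exact: probability_setT. Qed.

Lemma aeS (Q Q' : T -> Prop) : (forall x, Q x -> Q' x) -> {ae P, forall x, Q x} -> {ae P, forall x, Q' x}.
Proof. by move=> QQ' h; apply: filterS h. Qed.

Lemma aeS2 (Q1 Q2 Q' : T -> Prop) : (forall x, Q1 x -> Q2 x -> Q' x) ->
  {ae P, forall x, Q1 x} -> {ae P, forall x, Q2 x} -> {ae P, forall x, Q' x}.
Proof. by move=> QQ' h h'; apply: filterS2 h h'. Qed.

Lemma bmeas_int f : bmeas f -> P.-integrable setT (EFin \o f).
Proof.
move=> [mf [M fM]]; apply: measurable_bounded_integrable => //.
  by apply: (le_lt_trans (probability_le1 P measurableT)); rewrite ltry.
by exists M; split; [exact: num_real|move=> x Mx y _; exact: le_trans (ltW Mx)].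
Qed.

Lemma intE f : bmeas f -> (\int[P]_x (f x)%:E = (\int[P]_x f x)%:E)%E.
Proof. by move=> /bmeas_int ?; rewrite /Rintegral fineK//; exact: integrable_fin_num. Qed.

Lemma intD f g : bmeas f -> bmeas g ->
  \int[P]_x (f x + g x) = \int[P]_x f x + \int[P]_x g x.
Proof. by move=> bf bg; rewrite RintegralD//; exact: bmeas_int. Qed.

Lemma intB f g : bmeas f -> bmeas g ->
  \int[P]_x (f x - g x) = \int[P]_x f x - \int[P]_x g x.
Proof. by move=> bf bg; rewrite RintegralB//; exact: bmeas_int. Qed.

Lemma intZ r f : bmeas f -> \int[P]_x (r * f x) = r * \int[P]_x f x.
Proof. by move=> bf; rewrite RintegralZl//; exact: bmeas_int. Qed.

Lemma intN f : bmeas f -> \int[P]_x (- f x) = - \int[P]_x f x.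
Proof.
move=> bf; rewrite -mulN1r -intZ//.
by apply: eq_Rintegral => x _; rewrite mulN1r.
Qed.

Lemma int_cst (r : R) : \int[P]_x r = r.
Proof.
rewrite Rintegral_cst// [X in fine X](_ : _ = 1%E) ?mulr1//.
exact: probT.
Qed.

Lemma int_le f g : bmeas f -> bmeas g -> (forall x, f x <= g x) ->
  \int[P]_x f x <= \int[P]_x g x.
Proof. by move=> bf bg fg; apply: le_Rintegral => //; exact: bmeas_int. Qed.

Lemma int_norm f M : bmeas f -> (forall x, `|f x| <= M) -> `|\int[P]_x f x| <= M.
Proof.
move=> bf fM; rewrite ler_norml; apply/andP; split.
  rewrite -(int_cst (- M)); apply: int_le => //; first exact: bmeas_cst.
  by move=> x; have := fM x; rewrite ler_norml => /andP[].
rewrite -[leRHS]int_cst; apply: int_le => //; first exact: bmeas_cst.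
by move=> x; have := fM x; rewrite ler_norml => /andP[].
Qed.

Lemma int_ge0 f : (forall x, 0 <= f x) -> 0 <= \int[P]_x f x.
Proof. by move=> f0; apply: Rintegral_ge0. Qed.

Lemma int_dist f g e : bmeas f -> bmeas g -> (forall x, `|f x - g x| <= e) ->
  `|\int[P]_x f x - \int[P]_x g x| <= e.
Proof. by move=> bf bg fg; rewrite -intB//; apply: int_norm => //; exact: bmeasB. Qed.

Lemma int_ae f g : bmeas f -> bmeas g -> {ae P, forall x, f x = g x} ->
  \int[P]_x f x = \int[P]_x g x.
Proof.
move=> [mf _] [mg _] fg; rewrite /Rintegral; congr fine.
apply: ae_eq_integral => //; try exact/measurable_EFinP.
by apply: filterS fg => x /= -> _.
Qed.

Lemma int_le_ae f g : bmeas f -> bmeas g -> {ae P, forall x, f x <= g x} ->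
  \int[P]_x f x <= \int[P]_x g x.
Proof.
move=> bf bg fg.
(* Truncating [f] at [g] changes it only on a null set and makes the inequality hold everywhere. *)
pose h x := Num.min (f x) (g x).
have bh : bmeas h.
  case: bf bg => mf [M fM] [mg [N gN]]; split; first exact: measurable_minr.
  exists (M + N) => x; rewrite /h.
  have M0 : 0 <= M := le_trans (normr_ge0 _) (fM x).
  have N0 : 0 <= N := le_trans (normr_ge0 _) (gN x).
  rewrite minEle; case: ifP => _.
    by rewrite (le_trans (fM x))// lerDl.
  by rewrite (le_trans (gN x))// lerDr.
rewrite (@int_ae f h)//.
  by apply: int_le => // x; rewrite /h ge_min lexx orbT.
by apply: filterS fg => x fgx; rewrite /h minEle fgx.
Qed.

Lemma int_indic (A : set T) : measurable A -> \int[P]_x \1_A x = fine (P A).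
Proof. by move=> mA; rewrite /Rintegral integral_indic// setIT. Qed.

Lemma int_dominated (f_ : nat -> T -> R) f M :
  (forall n, bmeas (f_ n)) -> bmeas f -> (forall n x, `|f_ n x| <= M) ->
  {ae P, forall x, f_ n x @[n --> \oo] --> f x} ->
  \int[P]_x f_ n x @[n --> \oo] --> \int[P]_x f x.
Proof.
move=> bf_ bf fM cf.
have [|_ _ h] := @dominated_convergence _ T R P setT measurableT
  (fun n => EFin \o f_ n) (EFin \o f) (cst M%:E)
  (fun n => (measurable_EFinP _ _).2 (bf_ n).1) ((measurable_EFinP _ _).2 bf.1)
  _ (bmeas_int (bmeas_cst _ M)) (aeW _ (fun x n _ => fM n x)).
  by apply: filterS cf => x fx _; apply: cvg_EFin => //; exact: nearW.
rewrite /Rintegral; apply: fine_cvg; rewrite fineK//.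
exact: (integrable_fin_num _ (bmeas_int bf)).
Qed.

End integrals.

(** * Laws of random elements and Fubini for bounded functions *)

Section laws.
Context (R : realType).

Definition eqm d (T : measurableType d) (P Q : probability T R) :=
  forall A, measurable A -> P A = Q A.

(** The law is any probability that agrees with the image of [P] on measurable sets, not the
    pushforward itself: the laws of the semigroup and the convolution powers are given only through
    such equalities. *)
Definition hasLaw d (T : measurableType d) (P : probability T R)
  d' (T' : measurableType d') (X : T -> T') (al : probability T' R) :=
  measurable_fun setT X /\ forall B, measurable B -> P (X @^-1` B) = al B.

Section fixed.
Context d (T : measurableType d) (P : probability T R).

Lemma hasLaw_ex d' (T' : measurableType d') (X : T -> T') :
  measurable_fun setT X -> exists al, hasLaw P X al.
Proof.
move=> mX; pose X' : {mfun T >-> T'} := mfun_Sub (mem_set mX).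
by exists (distribution P X'); split.
Qed.

Lemma hasLaw_id : hasLaw P id P.
Proof. by split; first exact: measurable_id. Qed.

Lemma hasLaw_comp d' (T' : measurableType d') d'' (T'' : measurableType d'')
    (X : T -> T') (Y : T' -> T'') al be :
  hasLaw P X al -> hasLaw al Y be -> hasLaw P (Y \o X) be.
Proof.
move=> [mX lX] [mY lY]; split; first exact: measurableT_comp.
move=> B mB; rewrite comp_preimage lX ?lY//.
by rewrite -[X in measurable X]setTI; exact: mY.
Qed.

Lemma hasLaw_factor d' (T' : measurableType d') d'' (T'' : measurableType d'')
    (X : T -> T') (Y : T' -> T'') al be :
  hasLaw P X al -> measurable_fun setT Y -> hasLaw P (Y \o X) be -> hasLaw al Y be.
Proof.
move=> [mX lX] mY [_ lYX]; split => // B mB.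
rewrite -lX; first by rewrite -lYX.
by rewrite -[X in measurable X]setTI; exact: mY.
Qed.

Lemma hasLaw_eqm d' (T' : measurableType d') (X : T -> T') al be :
  hasLaw P X al -> eqm al be -> hasLaw P X be.
Proof. by move=> [mX lX] ab; split => // B mB; rewrite lX ?ab. Qed.

Lemma hasLaw_uniq d' (T' : measurableType d') (X : T -> T') al be :
  hasLaw P X al -> hasLaw P X be -> eqm al be.
Proof. by move=> [_ h] [_ h'] A mA; rewrite -h ?h'. Qed.

Lemma hasLaw_ae d' (T' : measurableType d') (X : T -> T') al (Q : T' -> Prop) :
  hasLaw P X al -> {ae al, forall x, Q x} -> {ae P, forall w, Q (X w)}.
Proof.
move=> [mX lX] [N [mN N0 QN]]; exists (X @^-1` N); split => //.
- by rewrite -[X in measurable X]setTI; exact: mX.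
- by rewrite lX.
- by move=> w /= nQ; apply: QN.
Qed.

Lemma hasLaw_int d' (T' : measurableType d') (X : T -> T') al (f : T' -> R) :
  hasLaw P X al -> bmeas f -> \int[al]_x f x = \int[P]_w f (X w).
Proof.
move=> [mX lX] bf; pose X' : {mfun T >-> T'} := mfun_Sub (mem_set mX).
rewrite /Rintegral; congr fine.
transitivity (\int[pushforward P X']_x (f x)%:E)%E.
  by apply: eq_measure_integral => A mA _; exact/esym/lX.
rewrite integral_pushforward//; first exact/measurable_EFinP/bf.1.
by apply: bmeas_int; exact: bmeas_comp.
Qed.

Lemma hasLaw_aeE d' (T' : measurableType d') (X Y : T -> T') al :
  hasLaw P X al -> measurable_fun setT Y -> {ae P, forall w, X w = Y w} ->
  hasLaw P Y al.
Proof.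
move=> [mX lX] mY XY; split => // B mB; rewrite -lX//.
have mXB : measurable (X @^-1` B) by rewrite -[X in measurable X]setTI; exact: mX.
have mYB : measurable (Y @^-1` B) by rewrite -[X in measurable X]setTI; exact: mY.
have : fine (P (Y @^-1` B)) = fine (P (X @^-1` B)).
  rewrite -!int_indic//; apply: int_ae; try exact: bmeas_indic.
  by apply: filterS XY => w XYw; rewrite !indicE /in_mem/= /in_set /= XYw.
by move=> h; rewrite -[LHS]fineK ?fin_num_measure// h fineK ?fin_num_measure.
Qed.

End fixed.

Lemma eqm_ae d (T : measurableType d) (P P' : probability T R) (Q : T -> Prop) :
  eqm P P' -> {ae P', forall x, Q x} -> {ae P, forall x, Q x}.
Proof. by move=> PP' [N [mN N0 QN]]; exists N; split => //; rewrite PP'. Qed.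

Lemma eqm_int d (T : measurableType d) (P P' : probability T R) (f : T -> R) :
  eqm P P' -> \int[P]_x f x = \int[P']_x f x.
Proof. by move=> PP'; congr fine; apply: eq_measure_integral => A mA _; exact: PP'. Qed.

Section products.
Context d1 (T1 : measurableType d1) d2 (T2 : measurableType d2).
Variables (P1 : probability T1 R) (P2 : probability T2 R).

Lemma fubini_int (f : T1 * T2 -> R) : bmeas f ->
  \int[(P1 \x P2)%E]_z f z = \int[P1]_x \int[P2]_y f (x, y).
Proof.
move=> bf; rewrite {1}/Rintegral -integral12_prod_meas1; last exact: bmeas_int.
congr fine; apply: eq_integral => x _ /=.
by rewrite -intE//; exact: (bmeas_comp bf (pair1_measurable x)).
Qed.

Lemma fubini_bmeas (f : T1 * T2 -> R) : bmeas f ->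
  bmeas (fun x => \int[P2]_y f (x, y)).
Proof.
move=> bf; split.
  apply: (measurableT_comp (f := fine)) => //.
  by apply: (measurable_fubini_F (m2 := P2) (f := EFin \o f)); exact: (bmeas_int (P1 \x P2)%E).
have [M fM] := bf.2; exists M => x.
by apply: int_norm => //; exact: (bmeas_comp bf (pair1_measurable x)).
Qed.

Lemma hasLaw_fst : hasLaw (P1 \x P2)%E fst P1.
Proof.
split=> // B mB; rewrite (_ : _ @^-1` _ = B `*` setT); last first.
  by apply/seteqP; split=> [x|x []].
rewrite [LHS]product_measure1E// [X in (_ * X)%E](_ : _ = 1%E) ?mule1//.
exact: probT.
Qed.

Lemma hasLaw_snd : hasLaw (P1 \x P2)%E snd P2.
Proof.
split=> // B mB; rewrite (_ : _ @^-1` _ = setT `*` B); last first.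
  by apply/seteqP; split=> [x|x []].
rewrite [LHS]product_measure1E// [X in (X * _)%E](_ : _ = 1%E) ?mul1e//.
exact: probT.
Qed.

Lemma hasLaw_pair d (T : measurableType d) (P : probability T R)
    (X : T -> T1) (Y : T -> T2) :
  measurable_fun setT X -> measurable_fun setT Y ->
  (forall A B, measurable A -> measurable B ->
    P (X @^-1` A `&` Y @^-1` B) = (P1 A * P2 B)%E) ->
  hasLaw P (fun w => (X w, Y w)) (P1 \x P2)%E.
Proof.
move=> mX mY XY; have mXY := measurable_fun_pair mX mY; split => // C mC.
pose Z : {mfun T >-> (T1 * T2)%type} := mfun_Sub (mem_set mXY).
apply/esym; apply: (@product_measure_unique _ _ _ _ _ P1 P2 (distribution P Z)) => //.
Qed.

End products.

End laws.

(** * A portmanteau lemma *)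

Definition lip (R : realType) (T : Type) (dl : T -> T -> R) (L : R) (phi : T -> R) :=
  forall x y, `|phi x - phi y| <= L * dl x y.

Section inf_convolution.
Context (R : realType) (T : Type) (dl : T -> T -> R) (b : R).
Hypothesis dl0 : forall z, dl z z = 0.
Hypothesis dl_ge0 : forall x y, 0 <= dl x y.
Hypothesis dl_sym : forall x y, dl x y = dl y x.
Hypothesis dl_tri : forall x y z, dl x z <= dl x y + dl y z.
Variables (D : set T) (g : T -> R) (M : R) (y0 : T).
Hypothesis Dy0 : D y0.
Hypothesis gM : forall y, `|g y| <= M.

(** This is the Lipschitz regularization (inf-convolution) of [g], with the infimum over [D] only,
    so that no value of [g] off [D] enters. The cap [M] keeps it bounded far from [D]. *)
Definition infconv (k : R) (z : T) : R :=
  Num.min M (inf [set g y + k * dl z y | y in D]).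

Let S k z := [set g y + k * dl z y | y in D].

Let S_lb k z : 0 <= k -> lbound (S k z) (- M).
Proof.
move=> k0 _ [y _ <-]; have := gM y; rewrite ler_norml => /andP[h _].
by rewrite (le_trans h)// lerDl mulr_ge0.
Qed.

Let S_le k z y : 0 <= k -> D y -> inf (S k z) <= g y + k * dl z y.
Proof. by move=> k0 Dy; apply: ge_inf; [exists (- M); exact: S_lb|exists y]. Qed.

Let S_ge k z x : (forall y, D y -> x <= g y + k * dl z y) -> x <= inf (S k z).
Proof.
move=> h; apply: lb_le_inf; first by exists (g y0 + k * dl z y0), y0.
by move=> _ [y Dy <-]; exact: h.
Qed.

Lemma infconv_le k z : 0 <= k -> D z -> infconv k z <= g z.
Proof.
by move=> k0 Dz; rewrite ge_min; apply/orP; right;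
  rewrite (le_trans (S_le z k0 Dz))// dl0 mulr0 addr0.
Qed.

Lemma infconv_norm k z : 0 <= k -> `|infconv k z| <= M.
Proof.
move=> k0; have M0 : 0 <= M := le_trans (normr_ge0 _) (gM y0).
rewrite ler_norml /infconv ge_min lexx/= andbT le_min.
by rewrite (le_trans _ M0) ?oppr_le0//=; apply: S_ge => y Dy; apply: (S_lb k0); exists y.
Qed.

Lemma infconv_lip k : 0 <= k -> lip dl k (infconv k).
Proof.
move=> k0.
suff h x y : infconv k x <= infconv k y + k * dl x y.
  move=> x y; have := h x y; have := h y x; rewrite (dl_sym y x) ler_norml.
  by move=> h1 h2; apply/andP; split; lra.
have : inf (S k x) - k * dl x y <= inf (S k y).
  apply: S_ge => y' Dy'; rewrite lerBlDr (le_trans (S_le x k0 Dy'))//.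
  by rewrite -addrA lerD2l -mulrDr ler_wpM2l// addrC dl_tri.
rewrite lerBlDr => h; rewrite /infconv addr_minl le_min !ge_min h orbT andbT.
by rewrite lerDl mulr_ge0.
Qed.

Lemma infconv_cvg z : D z ->
  (forall e, 0 < e -> exists2 eta, 0 < eta &
     forall y, D y -> dl z y < eta -> `|g y - g z| <= e) ->
  infconv n%:R z @[n --> \oo] --> g z.
Proof.
move=> Dz cg; apply/cvgrPdist_le => e e0.
have [eta eta0 geta] := cg e e0.
(* Past this [N] a competitor [y] at distance at least [eta] from [z] pays a penalty of at least
   [2 * M], which outweighs the whole oscillation of [g]. *)
have [N NE] : exists N : nat, 2 * M / eta <= N%:R.
  exists (Num.trunc `|2 * M / eta|).+1.
  by rewrite (le_trans (ler_norm _))// ltW// truncnS_gt.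
exists N => // n /= Nn.
have n0 : 0 <= n%:R :> R by [].
rewrite ger0_norm ?subr_ge0 ?infconv_le// lerBlDr -lerBlDl.
have [/andP[gl gu]] : - M <= g z <= M by rewrite -ler_norml.
rewrite le_min (le_trans _ gu) ?gerBl ?(ltW e0)//=.
apply: S_ge => y Dy; have [lt|ge] := ltP (dl z y) eta.
  have := geta _ Dy lt; rewrite ler_norml lerBrDr lerBlDr => /andP[h _].
  by rewrite addrC (le_trans h)// lerDl mulr_ge0.
have := gM y; rewrite ler_norml => /andP[yl _].
have : 2 * M <= n%:R * dl z y.
  rewrite (@le_trans _ _ (N%:R * eta))//; first by rewrite -ler_pdivrMr.
  by apply: ler_pM => //; [exact: ltW|rewrite ler_nat].
by move: (n%:R * dl z y) => t ht; lra.
Qed.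

End inf_convolution.

Section portmanteau.
Context (R : realType) (T : Type) (dl : T -> T -> R).
Hypothesis dl0 : forall z, dl z z = 0.
Hypothesis dl_ge0 : forall x y, 0 <= dl x y.
Hypothesis dl_sym : forall x y, dl x y = dl y x.
Hypothesis dl_tri : forall x y z, dl x z <= dl x y + dl y z.
Variable D : set T.
Context (d_ : nat -> measure_display) (O_ : forall n, measurableType (d_ n))
  (P_ : forall n, probability (O_ n) R) (z_ : forall n, O_ n -> T)
  (d : measure_display) (O : measurableType d) (P : probability O R) (z : O -> T).
Arguments z_ : clear implicits.
Hypothesis lip_cvg : forall L phi, 0 <= L -> (exists M, forall x, `|phi x| <= M) ->
  lip dl L phi ->
  [/\ forall n, bmeas (phi \o z_ n), bmeas (phi \o z) &
    \int[P_ n]_w phi (z_ n w) @[n --> \oo] --> \int[P]_w phi (z w)].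

(** The functions [infconv k] are Lipschitz, lie below [g] on [D] and converge to [g] at almost
    every point of the limit law; the integral of one of them with large [k] gives the bound. [T]
    carries no sigma-field: only compositions of test functions with [z_ n] and [z] are measurable,
    and [h_ n], [h] are measurable versions of [g] along these maps. *)
Lemma portmanteau_liminf (g : T -> R) (M : R) (h_ : forall n, O_ n -> R) (h : O -> R) :
  (forall y, `|g y| <= M) -> (forall n, bmeas (h_ n)) -> bmeas h ->
  (forall n, {ae P_ n, forall w, D (z_ n w) /\ h_ n w = g (z_ n w)}) ->
  {ae P, forall w, [/\ D (z w), h w = g (z w) & forall e, 0 < e ->
    exists2 eta, 0 < eta & forall y, D y -> dl (z w) y < eta ->
      `|g y - g (z w)| <= e]} ->
  forall e, 0 < e -> \forall n \near \oo,
    \int[P]_w h w - e <= \int[P_ n]_w h_ n w.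
Proof.
move=> gM bh_ bh Dh_ Dh e e0.
(* [infconv] needs a point of [D]; were [D] empty, the whole space [O] would be negligible. *)
have [y0 Dy0] : D !=set0.
  apply/set0P/negP => /eqP D0; move: Dh; rewrite D0 => -[N [mN N0 /= sN]].
  have NT : N = setT by apply/seteqP; split=> // w _; apply: sN => -[].
  by move: N0; rewrite NT (probT P) => /eqP; rewrite onee_eq0.
pose f k := infconv dl D g M k.
have k0 (k : nat) : 0 <= k%:R :> R by [].
have fb k x : `|f k%:R x| <= M by exact: (infconv_norm dl_ge0 Dy0 gM).
have fl k := lip_cvg (k0 k) (ex_intro _ M (fb k))
  (infconv_lip dl_ge0 dl_sym dl_tri Dy0 gM (k0 k)).
have fk : \int[P]_w f k%:R (z w) @[k --> \oo] --> \int[P]_w h w.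
  apply: (int_dominated (M := M)) => //.
  - by move=> k; have [_] := fl k.
  - apply: filterS Dh => w [Dz hz cz]; rewrite hz.
    exact: (infconv_cvg dl0 dl_ge0 Dy0 gM).
have e20 : 0 < e / 2 by rewrite divr_gt0.
have [k _ /(_ _ (leqnn k)) hk] := (cvgrPdist_le _ _).1 fk _ e20.
have [bk_ bk ck] := fl k.
apply: filterS ((cvgrPdist_le _ _).1 ck _ e20) => n hn.
have le : \int[P_ n]_w f k%:R (z_ n w) <= \int[P_ n]_w h_ n w.
  apply: int_le_ae => //.
  apply: filterS (Dh_ n) => w [Dz ->].
  exact: (infconv_le dl0 dl_ge0 gM).
move: hk hn; rewrite !ler_norml => /andP[_ h1] /andP[_ h2].
rewrite -/(f k%:R) in h2.
move: h1 h2 le; move: (\int[P]_w h w) (\int[P]_w f k%:R (z w))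
  (\int[P_ n]_w h_ n w) (\int[P_ n]_w f k%:R (z_ n w)) => A B C E h1 h2 h3.
lra.
Qed.

(** The lower bound is applied to [g] and to its opposite. *)
Lemma portmanteau (g : T -> R) (M : R) (h_ : forall n, O_ n -> R) (h : O -> R) :
  (forall y, `|g y| <= M) -> (forall n, bmeas (h_ n)) -> bmeas h ->
  (forall n, {ae P_ n, forall w, D (z_ n w) /\ h_ n w = g (z_ n w)}) ->
  {ae P, forall w, [/\ D (z w), h w = g (z w) & forall e, 0 < e ->
    exists2 eta, 0 < eta & forall y, D y -> dl (z w) y < eta ->
      `|g y - g (z w)| <= e]} ->
  \int[P_ n]_w h_ n w @[n --> \oo] --> \int[P]_w h w.
Proof.
move=> gM bh_ bh Dh_ Dh; apply/cvgrPdist_le => e e0.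
have up : \forall n \near \oo,
    \int[P]_w (- h w) - e <= \int[P_ n]_w (- h_ n w).
  apply: (@portmanteau_liminf (fun y => - g y) M) => //.
  - by move=> y; rewrite normrN.
  - by move=> n; exact: bmeasN.
  - exact: bmeasN.
  - by move=> n; apply: filterS (Dh_ n) => w [? ->].
  - apply: filterS Dh => w [? -> c]; split => // e' /c[eta eta0 H].
    by exists eta => // y Dy /(H _ Dy); rewrite -opprD normrN.
apply: filterS2 up (portmanteau_liminf gM bh_ bh Dh_ Dh e0) => n.
rewrite !intN// ler_norml.
by move: (\int[P]_w h w) (\int[P_ n]_w h_ n w) => A B h1 h2; lra.
Qed.

End portmanteau.

(** * Separably supported measures *)

Section separable_support.
Context (R : realType) (G : undergroupType R).
Implicit Types (q : nat -> G) (x y : G).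
Local Notation dist := (@mdist R G).

Lemma borel_open (U : set G) : open U -> measurable (U : set (borel G)).
Proof. exact: sub_sigma_algebra. Qed.

Lemma mdist_lip x y a : `|dist x a - dist y a| <= dist x y.
Proof.
rewrite ler_norml; have := metric_triangle x y a; have := metric_triangle y x a.
by rewrite (metric_sym y x) => h1 h2; apply/andP; split; lra.
Qed.

Lemma open_mball x e : open [set y | dist x y < e].
Proof.
rewrite openE => y /= xy; apply/nbhs_ballP; exists (e - dist x y) => /=.
  by rewrite subr_gt0.
rewrite ballEmdist => z /= yz; rewrite (le_lt_trans (metric_triangle _ y _))//.
by rewrite -ltrBrDl.
Qed.

Lemma open_mdistP (U : set G) : open U <->
  forall x, U x -> exists2 e, 0 < e & forall y, dist x y < e -> U y.
Proof.
rewrite openE; split=> [oU x /oU/nbhs_ballP[e /= e0 eU]|h x /h[e e0 eU]].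
  by exists e => // y xy; apply: eU; rewrite ballEmdist.
by apply/nbhs_ballP; exists e => //= y; rewrite ballEmdist; exact: eU.
Qed.

Lemma for_continuous_mdist (psi : G -> R) x : {for x, continuous psi} <->
  forall e, 0 < e -> exists2 eta, 0 < eta &
    forall y, dist x y < eta -> `|psi y - psi x| <= e.
Proof.
split=> [c e e0|h].
  have : \forall y \near x, `|psi x - psi y| <= e by exact: (cvgrPdist_le _ _).1.
  move=> /nbhs_ballP[eta /= eta0 h].
  by exists eta => // y xy; rewrite distrC; apply: h; rewrite ballEmdist.
apply/cvgrPdist_le => e /h[eta eta0 {}h]; apply/nbhs_ballP; exists eta => //= y.
by rewrite ballEmdist /= distrC; exact: h.
Qed.

Lemma lip_measurable (L : R) (phi : G -> R) : lip dist L phi ->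
  measurable_fun setT (phi : borel G -> R).
Proof.
move=> pl; apply: (measurability _ (RGenOInfty.measurableE R)) => //.
move=> _ [_ [a ->] <-]; rewrite setTI; apply: borel_open; apply/open_mdistP => x /=.
rewrite in_itv/= andbT => ax.
exists ((phi x - a) / (`|L| + 1)) => [|y].
  by rewrite divr_gt0 ?subr_gt0// ltr_wpDl.
have L1 : 0 < `|L| + 1 by rewrite ltr_wpDl.
rewrite ltr_pdivlMr// => h; rewrite /= in_itv/= andbT.
have := pl x y; rewrite ler_norml => /andP[_].
have : L * dist x y <= dist x y * (`|L| + 1).
  rewrite mulrC ler_wpM2l ?mdist_ge0// (le_trans (ler_norm _))//.
  by rewrite lerDl.
move: h; move: (dist x y * _) (L * _) => A B h1 h2 h3; lra.
Qed.

(** The closure of the range of [q]: the general form of a nonempty closed separable subset of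
    [G]. *)
Definition cl q : set G := [set x | forall e, 0 < e -> exists i, dist x (q i) < e].

Lemma cl_measurable q : measurable (cl q : set (borel G)).
Proof.
rewrite (_ : cl q = \bigcap_k \bigcup_i [set x | dist (q i) x < k.+1%:R^-1]).
  apply: bigcapT_measurable => k; apply: bigcupT_measurable => i.
  by apply: borel_open; exact: open_mball.
apply/seteqP; split=> [x clx k _|x clx e e0].
  by have [|i xi] := clx k.+1%:R^-1; [rewrite invr_gt0|exists i => //=; rewrite metric_sym].
have [k ke] : exists k : nat, k.+1%:R^-1 < e.
  by exists (Num.trunc e^-1); rewrite invf_plt ?posrE// truncnS_gt.
have [i _ /= xi] := clx k I.
by exists i; rewrite metric_sym (lt_trans xi).
Qed.

Lemma cl_self q i : cl q (q i).
Proof. by move=> e e0; exists i; rewrite mdistxx. Qed.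

Lemma cl_trans q q' : (forall i, cl q' (q i)) -> cl q `<=` cl q'.
Proof.
move=> qq' x clx e e0; have e20 : 0 < e / 2 by rewrite divr_gt0.
have [i xi] := clx _ e20; have [j ij] := qq' i _ e20.
by exists j; rewrite (le_lt_trans (metric_triangle _ (q i) _))// (splitr e) ltrD.
Qed.

(** Through [pickle], one sequence serves for countably many laws at once. *)
Lemma cl_merge (q_ : nat -> nat -> G) : exists q, forall n, cl (q_ n) `<=` cl q.
Proof.
exists (fun m => if unpickle m is Some (n, i) then q_ n i else point) => n.
by apply: cl_trans => i e e0; exists (pickle (n, i)); rewrite pickleK mdistxx.
Qed.

Lemma compact_cl (K : set G) : compact K -> exists q, K `<=` cl q.
Proof.
rewrite compact_cover => cK.
have /(_ _)/cid-/all_sig[s sK] (k : nat) : exists s : seq G,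
    forall x, K x -> exists2 y, y \in s & dist x y < k.+1%:R^-1.
  have [|x Kx|D _ KD] := cK G K (fun x => [set y | dist x y < k.+1%:R^-1]).
  - by move=> x _; exact: open_mball.
  - by exists x => //=; rewrite mdistxx.
  exists (finmap.enum_fset D) => x /KD[y yD /= yx]; exists y => //.
  by rewrite metric_sym.
exists (fun m => if unpickle m is Some (k, j) then nth point (s k) j else point).
move=> x Kx e e0.
have [k ke] : exists k : nat, k.+1%:R^-1 < e.
  by exists (Num.trunc e^-1); rewrite invf_plt ?posrE// truncnS_gt.
have [y ys xy] := sK k x Kx.
by exists (pickle (k, index y (s k))); rewrite pickleK nth_index// (lt_trans xy).
Qed.

Lemma sigma_compact_cl (mu : probability (borel G) R) :
  sigma_compact_supported mu -> exists q, {ae mu, forall x, cl q x}.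
Proof.
move=> [K cK mK].
have /(_ _)/cid-/all_sig[q_ Kq] i := compact_cl (cK i).
have [q qq] := cl_merge q_; exists q.
exists (~` cl q); split=> //; first by apply: measurableC; exact: cl_measurable.
rewrite probability_setC; last exact: cl_measurable.
have mKi i : measurable (K i : set (borel G)).
  rewrite -(setCK (K i)); apply: measurableC; apply: borel_open.
  by rewrite openC; apply: compact_closed; [exact: (@metric_hausdorff R)|].
suff -> : mu (cl q) = 1%E by rewrite subee.
apply/eqP; rewrite eq_le; apply/andP; split.
  by apply: probability_le1; exact: cl_measurable.
apply: (@le_trans _ _ (mu (\bigcup_i K i))); first by rewrite mK.
apply: le_measure.
- by apply/mem_set; exact: bigcupT_measurable.
- by apply/mem_set; exact: cl_measurable.
- by move=> x [i _ /Kq]; exact: qq.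
Qed.

(** A measurable retraction onto [cl q], in general not continuous. The value [q 0] off [cl q] is
    arbitrary, since the laws in use are carried by [cl q]. *)
Definition cutq q x : G := if `[< cl q x >] then x else q 0%N.

Lemma cut_cl q x : cl q (cutq q x).
Proof. by rewrite /cutq; case: asboolP => // _; exact: cl_self. Qed.

Lemma cut_id q x : cl q x -> cutq q x = x.
Proof. by rewrite /cutq => h; rewrite asboolT. Qed.

Lemma cut_measurable q : measurable_fun setT (cutq q : borel G -> borel G).
Proof.
move=> _ B mB; rewrite setTI.
rewrite (_ : _ @^-1` _ = (cl q `&` B) `|` (~` cl q `&` [set x | B (q 0%N)])).
  apply: measurableU; apply: measurableI => //.
  - exact: cl_measurable.
  - by apply: measurableC; exact: cl_measurable.
  - by have [h|h] := pselect (B (q 0%N));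
      [rewrite (_ : [set _ | _] = setT)|rewrite (_ : [set _ | _] = set0)] => //;
      apply/seteqP; split.
apply/seteqP; split=> x; rewrite /cutq/=.
  by case: asboolP => clx Bx; [left|right].
by move=> [[clx Bx]|[clx Bx]]; [rewrite asboolT|rewrite asboolF].
Qed.

(* On [cl q] a Lipschitz [F w] is the infimum of [F w (q i) + L d(-, q i)]; this is
   what makes up for the Borel sets of [G * G] being possibly too many. *)
Lemma lip_measurable_comp d (O : measurableType d) q (h : O -> G) (F : O -> G -> R) L M :
  0 <= L -> measurable_fun setT (h : O -> borel G) -> (forall w, cl q (h w)) ->
  (forall x, measurable_fun setT (F ^~ x)) ->
  (forall w x, `|F w x| <= M) ->
  (forall w, lip dist L (F w)) ->
  measurable_fun setT (fun w => F w (h w)).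
Proof.
move=> L0 mh hq mF FM Fl.
pose u i w := F w (q i) + L * dist (h w) (q i).
rewrite (_ : (fun _ => _) = (fun w => infs (u ^~ w) 0%N)).
  apply: measurable_fun_infs.
    move=> w _; exists (- M) => _ [i _ <-].
    have := FM w (q i); rewrite ler_norml => /andP[h1 _].
    by rewrite (le_trans h1)// lerDl mulr_ge0// mdist_ge0.
  move=> i; apply: measurable_funD => //; apply: measurable_funM => //.
  apply: (measurableT_comp (f := fun x : borel G => dist x (q i))) => //.
  by apply: (@lip_measurable 1) => x y; rewrite mul1r; exact: mdist_lip.
apply/funext => w; apply/eqP; rewrite eq_le; apply/andP; split.
  apply: lb_le_inf; first by exists (u 0%N w), 0%N.
  move=> _ [i _ <-]; have := Fl w (h w) (q i); rewrite /u ler_norml => /andP[_].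
  by rewrite lerBlDl.
apply/ler_addgt0Pr => e e0.
have L1 : 0 < L + 1 by rewrite ltr_wpDl.
have [|i hi] := hq w (e / (2 * (L + 1))); first by rewrite divr_gt0// mulr_gt0.
have {}hi : L * dist (h w) (q i) <= e / 2.
  rewrite (@le_trans _ _ ((L + 1) * (e / (2 * (L + 1)))))//.
    by rewrite ler_pM ?mdist_ge0 ?lerDl// ltW.
  by rewrite le_eqVlt; apply/orP; left; apply/eqP; field; rewrite gt_eqF.
apply: (@le_trans _ _ (u i w)).
  apply: ge_inf; last by exists i.
  exists (- M) => _ [j _ <-].
  have := FM w (q j); rewrite ler_norml => /andP[h1 _].
  by rewrite (le_trans h1)// lerDl mulr_ge0// mdist_ge0.
have := Fl w (q i) (h w); rewrite /u ler_norml (metric_sym (q i)) => /andP[_].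
by move: hi; move: (L * _) => A; lra.
Qed.

End separable_support.

(** * Sequential compactness and tightness *)

(** The distance is an explicit function on a bare type, so that [G], [G * G] and
    [(G * G) * (G * G)], with the sum metrics [sumd], are handled alike. *)
Record dmetric (R : realType) (T : Type) (dl : T -> T -> R) : Prop := {
  dm0 : forall x, dl x x = 0 ;
  dm_ge0 : forall x y, 0 <= dl x y ;
  dm_sym : forall x y, dl x y = dl y x ;
  dm_tri : forall x y z, dl x z <= dl x y + dl y z ;
  dm_eq : forall x y, dl x y = 0 -> x = y }.

Definition sumd (R : realType) (T1 T2 : Type) (d1 : T1 -> T1 -> R) (d2 : T2 -> T2 -> R)
  (x y : T1 * T2) : R := d1 x.1 y.1 + d2 x.2 y.2.

Lemma sumd_dmetric (R : realType) T1 T2 (d1 : T1 -> T1 -> R) (d2 : T2 -> T2 -> R) :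
  dmetric d1 -> dmetric d2 -> dmetric (sumd d1 d2).
Proof.
move=> m1 m2; split.
- by move=> x; rewrite /sumd (dm0 m1) (dm0 m2) addr0.
- by move=> x y; rewrite addr_ge0 ?(dm_ge0 m1) ?(dm_ge0 m2).
- by move=> x y; rewrite /sumd (dm_sym m1) (dm_sym m2).
- by move=> x y z; rewrite /sumd addrACA lerD ?(dm_tri m1) ?(dm_tri m2).
- move=> [x1 x2] [y1 y2]; rewrite /sumd/= => /eqP.
  rewrite paddr_eq0 ?(dm_ge0 m1) ?(dm_ge0 m2)// => /andP[/eqP h1 /eqP h2].
  by rewrite (dm_eq m1 h1) (dm_eq m2 h2).
Qed.

Lemma mdist_dmetric (R : realType) (G : undergroupType R) : dmetric (@mdist R G).
Proof.
split; [exact: mdistxx|exact: mdist_ge0|exact: metric_sym|exact: metric_triangle|].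
exact: mdist_positivity.
Qed.

Lemma invS_lt (R : realType) (e : R) : 0 < e -> exists k : nat, k.+1%:R^-1 < e.
Proof. by move=> e0; exists (Num.trunc e^-1); rewrite invf_plt ?posrE// truncnS_gt. Qed.

Section sequential_topology.
Context (R : realType) (T : Type) (dl : T -> T -> R).
Hypothesis dm : dmetric dl.

Definition seqcv (x : nat -> T) (p : T) :=
  forall e, 0 < e -> \forall n \near \oo, dl p (x n) < e.

(** [s] need not be increasing: [k <= s k] is enough for [x \o s] to inherit the limits of [x], by
    [seqcv_sub]. *)
Definition seqcpt (K : set T) := forall x : nat -> T, (forall n, K (x n)) ->
  exists2 p, K p & exists2 s : nat -> nat, forall k, (k <= s k)%N & seqcv (x \o s) p.

Definition dclosed (F : set T) :=
  forall p, (forall e, 0 < e -> exists2 x, F x & dl p x < e) -> F p.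

Definition dsep (S : set T) :=
  exists q : nat -> T, forall x, S x -> forall e, 0 < e -> exists i, dl x (q i) < e.

Lemma seqcv_sub x p (s : nat -> nat) : (forall k, (k <= s k)%N) -> seqcv x p ->
  seqcv (x \o s) p.
Proof.
move=> sk xp e e0; have [N _ h] := xp e e0.
by exists N => // n /= Nn; apply: h => /=; exact: leq_trans (sk n).
Qed.

Lemma seqcv_uniq x p p' : seqcv x p -> seqcv x p' -> p = p'.
Proof.
move=> xp xp'; apply: (dm_eq dm); apply/eqP; rewrite eq_le (dm_ge0 dm) andbT.
apply/ler_addgt0Pr => e e0; rewrite add0r.
have e20 : 0 < e / 2 by rewrite divr_gt0.
have [n [h1 h2]] := @filter_ex _ _ _ _ (filterI (xp _ e20) (xp' _ e20)).
rewrite (le_trans (dm_tri dm p (x n) p'))// (dm_sym dm (x n)).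
by rewrite (splitr e) lerD// ltW.
Qed.

Lemma approx_seq F p : (forall e, 0 < e -> exists2 x, F x & dl p x < e) ->
  exists2 x : nat -> T, forall n, F (x n) & seqcv x p.
Proof.
move=> h.
have /(_ _)/cid-/all_sig[x hx] (n : nat) : exists x, F x /\ dl p x < n.+1%:R^-1.
  by have [|x Fx px] := h n.+1%:R^-1; [rewrite invr_gt0|exists x].
exists x => [n|e e0]; first by have [] := hx n.
have [k ke] := invS_lt e0; exists k => // n /= kn.
have [_ h1] := hx n; rewrite (lt_trans h1)// (le_lt_trans _ ke)//.
by rewrite lef_pV2 ?posrE// ler_nat ltnS.
Qed.

Lemma seqcpt_dclosed K : seqcpt K -> dclosed K.
Proof.
move=> cK p /approx_seq[x Kx xp]; have [p' Kp' [s sk xp']] := cK x Kx.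
by rewrite (seqcv_uniq (seqcv_sub sk xp) xp').
Qed.

Lemma seqcpt_closed K F : seqcpt K -> dclosed F -> seqcpt (K `&` F).
Proof.
move=> cK cF x KFx; have [p Kp [s sk xp]] := cK x (fun n => (KFx n).1).
exists p; last by exists s.
split=> //; apply: cF => e e0.
have [n h] := @filter_ex _ _ _ _ (xp e e0).
by exists (x (s n)) => //; have [] := KFx (s n).
Qed.

Lemma dclosedU F F' : dclosed F -> dclosed F' -> dclosed (F `|` F').
Proof.
move=> cF cF' p h; apply: contrapT => /not_orP[nF nF'].
have /existsNP[e /not_implyP[e0 he]] : ~ (forall e, 0 < e -> exists2 x, F x & dl p x < e) by move=> /cF.
have /existsNP[e' /not_implyP[e'0 he']] : ~ (forall e, 0 < e -> exists2 x, F' x & dl p x < e) by move=> /cF'.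
have [|x [Fx|Fx]] := h (Num.min e e'); rewrite lt_min ?e0// => /andP[h1 h2].
  by apply: he; exists x.
by apply: he'; exists x.
Qed.

Lemma dclosed_bigcap I (D : set I) (F : I -> set T) : (forall i, D i -> dclosed (F i)) ->
  dclosed (\bigcap_(i in D) F i).
Proof.
by move=> cF p h i Di; apply: cF => // e /h[x Fx xp]; exists x => //; exact: Fx.
Qed.

Lemma dclosed0 : dclosed set0.
Proof. by move=> p /(_ 1 ltr01)[]. Qed.

Lemma dsep_sub S : dsep S -> S !=set0 ->
  exists2 q : nat -> T, forall i, S (q i) &
    forall x, S x -> forall e, 0 < e -> exists i, dl x (q i) < e.
Proof.
move=> [q hq] [s0 Ss0].
(* For each pair [(i, k)] a point of [S] within [1/(k+1)] of [q i] is chosen when there is one;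
   these points are dense in [S], while [q] itself may lie outside [S]. *)
pose good m x := if unpickle m is Some (i, k) then S x /\ dl x (q i) < (k : nat).+1%:R^-1
  else False.
have /(_ _)/cid-/all_sig[u hu] (m : nat) : exists x, S x /\ ((exists y, good m y) -> good m x).
  have [[y gy]|n] := pselect (exists y, good m y); last by exists s0.
  by exists y; split=> //; move: gy; rewrite /good; case: unpickle => [[i k] []|].
exists u => [i|x Sx e e0]; first by have [] := hu i.
have e20 : 0 < e / 2 by rewrite divr_gt0.
have [k ke] := invS_lt e20.
have [|i xi] := hq x Sx k.+1%:R^-1; first by rewrite invr_gt0.
exists (pickle (i, k)); have [_ hg] := hu (pickle (i, k)).
have : good (pickle (i, k)) (u (pickle (i, k))) by apply: hg; exists x; rewrite /good pickleK.
rewrite /good pickleK => -[_ h].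
rewrite (le_lt_trans (dm_tri dm x (q i) _))// (dm_sym dm (q i)).
by rewrite (splitr e) ltrD// (lt_trans _ ke).
Qed.

Lemma dsepS S S' : S `<=` S' -> dsep S' -> dsep S.
Proof. by move=> SS [q hq]; exists q => x /SS; exact: hq. Qed.

Lemma dsep_bigcup (t0 : T) (S : nat -> set T) : (forall i, dsep (S i)) -> dsep (\bigcup_i S i).
Proof.
move=> /(_ _)/cid-/all_sig[q hq].
exists (fun m => if unpickle m is Some (n, i) then q n i else t0).
move=> x [n _ /hq h] e /h[i xi]; by exists (pickle (n, i)); rewrite pickleK.
Qed.

End sequential_topology.

Lemma seqcv_pair (R : realType) T1 T2 (d1 : T1 -> T1 -> R) (d2 : T2 -> T2 -> R) x p :
  dmetric d1 -> dmetric d2 ->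
  seqcv (sumd d1 d2) x p <-> seqcv d1 (fst \o x) p.1 /\ seqcv d2 (snd \o x) p.2.
Proof.
move=> m1 m2; split=> [h|[h1 h2] e e0].
  split=> e e0; apply: filterS (h e e0) => n; rewrite /sumd => hn /=.
    by rewrite (le_lt_trans _ hn)// lerDl (dm_ge0 m2).
  by rewrite (le_lt_trans _ hn)// lerDr (dm_ge0 m1).
have e20 : 0 < e / 2 by rewrite divr_gt0.
apply: filterS2 (h1 _ e20) (h2 _ e20) => n /= h h'.
by rewrite /sumd (splitr e) ltrD.
Qed.

Lemma seqcptX (R : realType) T1 T2 (d1 : T1 -> T1 -> R) (d2 : T2 -> T2 -> R) K1 K2 :
  dmetric d1 -> dmetric d2 -> seqcpt d1 K1 -> seqcpt d2 K2 ->
  seqcpt (sumd d1 d2) (K1 `*` K2).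
Proof.
move=> m1 m2 c1 c2 x Kx.
have [p1 Kp1 [s1 sk1 x1]] := c1 (fst \o x) (fun n => (Kx n).1).
have [p2 Kp2 [s2 sk2 x2]] := c2 (snd \o x \o s1) (fun n => (Kx (s1 n)).2).
exists (p1, p2); first by split.
exists (s1 \o s2); first by move=> k /=; rewrite (leq_trans (sk2 k)).
apply/seqcv_pair => //; split => //=.
exact: (seqcv_sub (x := fst \o x \o s1) sk2 x1).
Qed.

Lemma dsepX (R : realType) T1 T2 (d1 : T1 -> T1 -> R) (d2 : T2 -> T2 -> R) S1 S2 (t1 : T1) (t2 : T2) :
  dsep d1 S1 -> dsep d2 S2 -> dsep (sumd d1 d2) (S1 `*` S2).
Proof.
move=> [q1 h1] [q2 h2].
exists (fun m => if unpickle m is Some (i, j) then (q1 i, q2 j) else (t1, t2)).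
move=> x [/= x1 x2] e e0; have e20 : 0 < e / 2 by rewrite divr_gt0.
have [i hi] := h1 _ x1 _ e20; have [j hj] := h2 _ x2 _ e20.
by exists (pickle (i, j)); rewrite pickleK /sumd (splitr e) ltrD.
Qed.

Section sequential_image.
Context (R : realType) (T T' : Type) (dl : T -> T -> R) (dl' : T' -> T' -> R).
Hypotheses (dm : dmetric dl) (dm' : dmetric dl').

Definition seqcont (K : set T) (f : T -> T') := forall x p, (forall n, K (x n)) -> K p ->
  seqcv dl x p -> seqcv dl' (f \o x) (f p).

Lemma seqcpt_image K f : seqcont K f -> seqcpt dl K -> seqcpt dl' (f @` K).
Proof.
move=> cf cK y Ky.
have /(_ _)/cid2-/all_sig2[x Kx xy] n := Ky n.
have [p Kp [s sk xp]] := cK x Kx.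
exists (f p); first by exists p.
exists s => //; rewrite (_ : y \o s = f \o (x \o s)).
  by apply: cf => // n; exact: Kx.
by apply/funext => n /=; rewrite xy.
Qed.

Lemma seqcpt_preimage K f F : seqcont K f -> seqcpt dl K -> dclosed dl' F ->
  seqcpt dl (K `&` f @^-1` F).
Proof.
move=> cf cK cF x Kx; have [p Kp [s sk xp]] := cK x (fun n => (Kx n).1).
exists p; last by exists s.
split=> //; apply: cF => e e0.
have /filter_ex[n h] := cf _ _ (fun n => (Kx (s n)).1) Kp xp e e0.
by exists (f (x (s n))) => //; have [] := Kx (s n).
Qed.

Lemma dsep_image (t' : T') K f : seqcont K f -> dsep dl K -> dsep dl' (f @` K).
Proof.
move=> cf sK; have [K0|/nonemptyPn K0] := pselect (K !=set0); last first.
  by exists (fun=> t') ; rewrite K0 image_set0.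
have [q Kq hq] := dsep_sub dm sK K0.
exists (f \o q) => _ [x Kx <-] e e0.
have [|y Ky yx] := @approx_seq _ _ dl (range q) x.
  by move=> e' /(hq _ Kx)[i xi]; exists (q i) => //; exists i.
have Ky' n : K (y n) by have [i _ <-] := Ky n.
have /filter_ex[n h] := cf _ _ Ky' Kx yx e e0.
by have [i _ iy] := Ky n; exists i; rewrite /= iy.
Qed.

End sequential_image.

Lemma compact_seqcpt (R : realType) (G : undergroupType R) (K : set G) :
  compact K -> seqcpt (@mdist R G) K.
Proof.
move=> cK x Kx.
have [|p [Kp clp]] := cK (x @ \oo) _; first by exists 0%N => // n _; exact: Kx.
exists p => //.
have /(_ _)/cid-/all_sig[s hs] (k : nat) : exists n : nat, (k <= n)%N /\ mdist p (x n) < k.+1%:R^-1.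
  have [] := clp (x @` [set n | (k <= n)%N]) (ball p k.+1%:R^-1).
  - by exists k => // n kn; exists n.
  - by apply: nbhsx_ballx; rewrite invr_gt0.
  by move=> _ [[n kn <-]]; rewrite ballEmdist/= => h; exists n.
exists s => [k|e e0]; first by have [] := hs k.
have [k ke] := invS_lt e0; exists k => // n /= kn.
have [_ h] := hs n; rewrite (lt_trans h)// (le_lt_trans _ ke)//.
by rewrite lef_pV2 ?posrE// ler_nat ltnS.
Qed.

(** * Inner regularity by closed sets *)

Section inner_regularity.
Context (R : realType) d (T : measurableType d) (dl : T -> T -> R).
Hypothesis dm : dmetric dl.

(** Inner regularity without an epsilon: closed subsets exhaust [A] up to a null set.
    [inner_app_eps] recovers a single closed subset of nearly full measure. *)
Definition inner_app (P : probability T R) (A : set T) := exists F : nat -> set T,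
  (forall k, [/\ measurable (F k), dclosed dl (F k) & F k `<=` A]) /\
  P.-negligible (A `\` \bigcup_k F k).

Definition regular := forall P A, measurable A -> inner_app P A.

Variable P : probability T R.

Lemma inner_app_eps A e : measurable A -> inner_app P A -> 0 < e ->
  exists F, [/\ measurable F, dclosed dl F, F `<=` A & (P (A `\` F) <= e%:E)%E].
Proof.
move=> mA [F [/all_and3[mF cF FA] N]] e0.
pose H n := \big[setU/set0]_(k < n) F k.
have mH n : measurable (H n) by apply: bigsetU_measurable.
pose B n := A `\` H n.
have mB n : measurable (B n) by apply: measurableD.
have HE : \bigcup_n H n = \bigcup_k F k.
  apply/seteqP; split=> x [n _]; rewrite /H.
    by rewrite -bigcup_mkord => -[k _ Fx]; exists k.
  by move=> Fx; exists n.+1 => //; rewrite -bigcup_mkord; exists n => /=.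
have BE : \bigcap_n B n = A `\` \bigcup_k F k.
  rewrite -HE; apply/seteqP; split=> [x Bx|x [Ax nH] n _].
    by split=> [|[n _ Hx]]; [have [] := Bx 0%N I|have [_] := Bx n I].
  by split=> // Hx; apply: nH; exists n.
have cv : P (B n) @[n --> \oo] --> 0%E.
  have -> : 0%E = P (\bigcap_n B n).
    by rewrite BE; apply/esym/measure_negligible => //; apply: measurableD => //; exact: bigcupT_measurable.
  apply: nonincreasing_cvg_mu => //.
  - by apply: le_lt_trans (probability_le1 P (mB 0%N)) _; rewrite ltry.
  - exact: bigcapT_measurable.
  - move=> n m nm; apply/subsetPset => x [Ax nH]; split=> // Hx; apply: nH.
    move: Hx; rewrite /H -!bigcup_mkord => -[k /= kn Fx]; exists k => //=.
    exact: leq_trans nm.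
have cv' : fine (P (B n)) @[n --> \oo] --> (0 : R) by exact: fine_cvg.
have [n _ /(_ _ (leqnn n)) /= hn] := (cvgrPdist_le _ _).1 cv' _ e0.
exists (H n); split => //.
- rewrite /H; elim/big_ind: _ => //; [exact: dclosed0|exact: dclosedU].
- by move=> x; rewrite /H -bigcup_mkord => -[k _]; exact: FA.
- move: hn; rewrite sub0r normrN => /(le_trans (ler_norm _)).
  by rewrite -lee_fin fineK// fin_num_measure.
Qed.

Lemma inner_app_bigcup (A : nat -> set T) : (forall i, inner_app P (A i)) ->
  inner_app P (\bigcup_i A i).
Proof.
move=> /(_ _)/cid-/all_sig[F hF].
exists (fun m => if unpickle m is Some (i, k) then F i k else set0); split.
  move=> m; case: unpickle => [[i k]|]; last by split=> //; exact: dclosed0.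
  by have [/(_ k)[h1 h2 h3] _] := hF i; split=> // x /h3; exists i.
apply: (negligibleS _ (negligible_bigcup (fun i => (hF i).2))).
move=> x [[i _ Ax] nF]; exists i => //; split=> // -[k _ Fx]; apply: nF.
by exists (pickle (i, k)) => //; rewrite pickleK.
Qed.

Lemma inner_app_bigcap (A : nat -> set T) : (forall i, measurable (A i)) ->
  (forall i, inner_app P (A i)) -> inner_app P (\bigcap_i A i).
Proof.
move=> mA iA.
have mI : measurable (\bigcap_i A i) by exact: bigcapT_measurable.
suff /(_ _)/cid-/all_sig[F hF] (m : nat) : exists F, [/\ measurable F, dclosed dl F,
    F `<=` \bigcap_i A i & (P ((\bigcap_i A i) `\` F) <= m.+1%:R^-1%:E)%E].
  exists F; split=> [m|]; first by have [] := hF m.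
  have mF : measurable (\bigcup_m F m).
    by apply: bigcupT_measurable => m; have [] := hF m.
  apply/negligibleP; first exact: measurableD.
  apply/eqP; rewrite eq_le measure_ge0 andbT; apply/lee_addgt0Pr => e e0.
  rewrite add0e; have [m me] := invS_lt e0; have [h1 _ _ h] := hF m.
  rewrite (@le_trans _ _ (m.+1%:R^-1%:E))// ?lee_fin ?(ltW me)//.
  apply: (le_trans _ h); apply: le_measure; rewrite ?inE.
  - exact: measurableD.
  - exact: measurableD.
  - by move=> x [Ax nF]; split=> // Fx; apply: nF; exists m.
(* [A i] is approximated within [e / 2 ^ i.+1], so that the intersection of the closed sets loses at
   most [e] in total. *)
set e := m.+1%:R^-1; have e0 : 0 < e by rewrite invr_gt0.
have /(_ _)/cid-/all_sig[F hF] (i : nat) : exists F, [/\ measurable F, dclosed dl F,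
    F `<=` A i & (P (A i `\` F) <= (e / (2 ^ i.+1)%:R)%:E)%E].
  by apply: inner_app_eps => //; rewrite divr_gt0// ltr0n expn_gt0.
have mF i : measurable (F i) by have [] := hF i.
have mIF : measurable (\bigcap_i F i) by exact: bigcapT_measurable.
exists (\bigcap_i F i); split => //.
- by apply: dclosed_bigcap => i _; have [] := hF i.
- by move=> x Fx i _; have [_ _ h _] := hF i; apply: h; exact: Fx.
apply: (@le_trans _ _ (\sum_(i <oo) P (A i `\` F i))%E).
  apply: measure_sigma_subadditive.
  - by move=> i; exact: measurableD.
  - exact: measurableD.
  - move=> x [Ax nF]; apply: contrapT => nx; apply: nF => i _.
    by apply: contrapT => nFx; apply: nx; exists i => //; split=> //; exact: Ax.
have := epsilon_trick0 xpredT (ltW e0); apply: le_trans.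
by apply: lee_nneseries => // i _; have [] := hF i.
Qed.

(** The usual device for regularity of finite measures on metric spaces: sets approximable from
    inside together with their complements form a sigma-algebra, so only generators have to be
    treated. *)
Definition bi_inner : set (set T) :=
  [set A | [/\ measurable A, inner_app P A & inner_app P (~` A)]].

Lemma bi_inner_sigma_algebra : sigma_algebra setT bi_inner.
Proof.
split.
- split=> //; rewrite ?setC0.
    exists (fun=> set0); split; first by move=> k; split=> //; exact: dclosed0.
    by rewrite set0D; exact: negligible_set0.
  exists (fun=> setT); split; first by [].
  rewrite (_ : _ `\` _ = set0); first exact: negligible_set0.
  by apply/seteqP; split=> // x [_]; apply; exists 0%N.
- by move=> A [mA iA icA]; rewrite setTD; split; rewrite ?setCK//; exact: measurableC.
- move=> A hA; split.
  + by apply: bigcupT_measurable => i; have [] := hA i.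
  + by apply: inner_app_bigcup => i; have [] := hA i.
  + rewrite setC_bigcup; apply: inner_app_bigcap => i; have [h1 _ h3] := hA i => //.
    exact: measurableC.
Qed.

End inner_regularity.

Section regular_spaces.
Context (R : realType).

Lemma regular_borel (G : undergroupType R) : regular (T := borel G) (@mdist R G).
Proof.
move=> P A mA; suff [] : bi_inner (T := borel G) (@mdist R G) P A by [].
have sub : (@open G : set (set (borel G))) `<=` bi_inner (T := borel G) (@mdist R G) P.
  move=> U oU; have /open_mdistP oU' := oU; split.
  - exact: borel_open.
  (* The points whose ball of radius [1/(k+1)] stays in [U] form a closed set, and [U] is the union
     of these sets over [k]. *)
  - exists (fun k => [set x | forall y, mdist x y < k.+1%:R^-1 -> U y]).
    have cl k : dclosed (@mdist R G) [set x | forall y, mdist x y < k.+1%:R^-1 -> U y].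
      move=> p hp y py.
      have [|x hx px] := hp (k.+1%:R^-1 - mdist p y); first by rewrite subr_gt0.
      apply: hx; rewrite (le_lt_trans (metric_triangle _ p _))// metric_sym.
      by rewrite -ltrBrDr.
    split=> [k|].
      split=> //; last by move=> x; apply; rewrite mdistxx invr_gt0.
      rewrite -(setCK [set _ | _]); apply: measurableC; apply: borel_open.
      apply/open_mdistP => x /= nx; apply: contrapT => h; apply: nx.
      apply: cl => e e0; apply: contrapT => h'; apply: h; exists e => // y xy Fy.
      by apply: h'; exists y.
    rewrite (_ : _ `\` _ = set0); first exact: negligible_set0.
    apply/seteqP; split=> // x [/oU'[e e0 eU] h]; apply: h.
    have [k ke] := invS_lt e0; exists k => // y /= xy; apply: eU.
    exact: lt_trans ke.
  - exists (fun=> ~` U); split=> [_|]; last first.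
      rewrite (_ : _ `\` _ = set0); first exact: negligible_set0.
      by apply/seteqP; split=> // x [Ux]; apply; exists 0%N.
    split => //; first by apply: measurableC; exact: borel_open.
    move=> p hp Up; have [e e0 eU] := oU' p Up.
    by have [y nUy py] := hp e e0; apply: nUy; exact: eU.
have := smallest_sub (bi_inner_sigma_algebra (T := borel G) (@mdist R G) P) sub.
exact.
Qed.

(** The product sigma-field is generated by cylinders, and a cylinder over a closed set is closed
    for [sumd]. Open sets of the product, which may fail to be measurable, do not enter. *)
Lemma regular_prod dd1 dd2 (T1 : measurableType dd1) (T2 : measurableType dd2)
    (d1 : T1 -> T1 -> R) (d2 : T2 -> T2 -> R) :
  dmetric d1 -> dmetric d2 ->
  regular d1 -> regular d2 -> regular (T := (T1 * T2)%type) (sumd d1 d2).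
Proof.
move=> m1 m2 r1 r2 P A mA; have mm := sumd_dmetric m1 m2.
suff [] : bi_inner (sumd d1 d2) P A by [].
have [P1 h1] := hasLaw_ex P (@measurable_fst _ _ T1 T2).
have [P2 h2] := hasLaw_ex P (@measurable_snd _ _ T1 T2).
have i1 (B : set T1) : measurable B -> inner_app (sumd d1 d2) P (fst @^-1` B).
  move=> mB; have [F [hF [N [mN N0 sN]]]] := r1 P1 B mB.
  exists (fun k => fst @^-1` F k); split=> [k|].
    have [mF cF FB] := hF k; split.
    - by rewrite -[X in measurable X]setTI; exact: measurable_fst.
    - move=> p hp; apply: cF => e /hp[x Fx xp]; exists x.1 => //.
      by rewrite (le_lt_trans _ xp)// /sumd lerDl (dm_ge0 m2).
    - by move=> x; exact: FB.
  exists (fst @^-1` N); split.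
  - by rewrite -[X in measurable X]setTI; exact: measurable_fst.
  - by rewrite h1.2.
  - by move=> x [Bx nF]; apply: sN; split=> // -[k _ Fx]; apply: nF; exists k.
have i2 (B : set T2) : measurable B -> inner_app (sumd d1 d2) P (snd @^-1` B).
  move=> mB; have [F [hF [N [mN N0 sN]]]] := r2 P2 B mB.
  exists (fun k => snd @^-1` F k); split=> [k|].
    have [mF cF FB] := hF k; split.
    - by rewrite -[X in measurable X]setTI; exact: measurable_snd.
    - move=> p hp; apply: cF => e /hp[x Fx xp]; exists x.2 => //.
      by rewrite (le_lt_trans _ xp)// /sumd lerDr (dm_ge0 m1).
    - by move=> x; exact: FB.
  exists (snd @^-1` N); split.
  - by rewrite -[X in measurable X]setTI; exact: measurable_snd.
  - by rewrite h2.2.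
  - by move=> x [Bx nF]; apply: sN; split=> // -[k _ Fx]; apply: nF; exists k.
have := smallest_sub (bi_inner_sigma_algebra (sumd d1 d2) P) _ mA; apply.
move=> _ [[B mB <-]|[B mB <-]]; rewrite setTI; split.
- by rewrite -[X in measurable X]setTI; exact: measurable_fst.
- exact: i1.
- by rewrite preimage_setC; apply: i1; exact: measurableC.
- by rewrite -[X in measurable X]setTI; exact: measurable_snd.
- exact: i2.
- by rewrite preimage_setC; apply: i2; exact: measurableC.
Qed.

End regular_spaces.

(** * Tight laws and measurability of partially continuous maps *)

Section tightness.
Context (R : realType).

(** The compact pieces lie inside [A], which need not be measurable; the typical [A] is the domain
    of the product. Separability is recorded because [dsep_closed_measurable] relies on it. *)
Definition tight_on d (T : measurableType d) (dl : T -> T -> R) (P : probability T R) (A : set T) :=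
  exists K : nat -> set T,
  [/\ forall j, [/\ measurable (K j), seqcpt dl (K j) & K j `<=` A],
      dsep dl (\bigcup_j K j) & {ae P, forall x, (\bigcup_j K j) x}].

(** [A] contains the complement of a measurable null set [N]; regularity exhausts this complement by
    closed sets, and intersecting them with the compact pieces keeps compactness. *)
Lemma tight_sub d (T : measurableType d) (dl : T -> T -> R) (P : probability T R) A :
  dmetric dl -> regular dl -> tight_on dl P setT -> {ae P, forall x, A x} -> tight_on dl P A.
Proof.
move=> dm reg [K [hK sK aK]] [N [mN N0 sN]].
have [F [hF nF]] := reg P (~` N) (measurableC mN).
exists (fun m => if unpickle m is Some (j, k) then K j `&` F k else set0); split.
- move=> m; case: unpickle => [[j k]|].
    have [mKj cKj _] := hK j; have [mF cF FN] := hF k; split.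
    + exact: measurableI.
    + exact: seqcpt_closed.
    + by move=> x [_ /FN nNx]; apply: contrapT => nA; apply/nNx/sN.
  by split => // x /(_ 0%N).
- apply: dsepS sK => x [m _]; case: unpickle => [[j k] [Kx _]|//].
  by exists j.
- have nN : P.-negligible N by apply/negligibleP.
  have : {ae P, forall x, ~ N x /\ ~ (~` N `\` \bigcup_k F k) x}.
    apply: (negligibleS _ (negligibleU nN nF)) => x /= /not_andP[/contrapT|/contrapT]; by [left|right].
  move=> h; apply: filterS2 aK h => x [j _ Kx] [nNx nFx].
  have [k _ Fx] : (\bigcup_k F k) x by apply: contrapT => nF'; apply: nFx; split.
  by exists (pickle (j, k)) => //; rewrite pickleK.
Qed.

Lemma tight_prod dd1 dd2 (T1 : measurableType dd1) (T2 : measurableType dd2)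
    (d1 : T1 -> T1 -> R) (d2 : T2 -> T2 -> R) (P1 : probability T1 R) (P2 : probability T2 R)
    (t1 : T1) (t2 : T2) :
  dmetric d1 -> dmetric d2 -> tight_on d1 P1 setT -> tight_on d2 P2 setT ->
  tight_on (sumd d1 d2) (P1 \x P2)%E setT.
Proof.
move=> m1 m2 [K1 [h1 s1 a1]] [K2 [h2 s2 a2]].
exists (fun m => if unpickle m is Some (i, j) then K1 i `*` K2 j else set0); split.
- move=> m; case: unpickle => [[i j]|]; last by split => // x /(_ 0%N).
  have [? ? _] := h1 i; have [? ? _] := h2 j; split => //; first exact: measurableX.
  exact: seqcptX.
- apply: dsepS (dsepX t1 t2 s1 s2) => x [m _]; case: unpickle => [[i j] [? ?]|//].
  by split; [exists i|exists j].
- have l1 := hasLaw_ae (hasLaw_fst P1 P2) a1.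
  have l2 := hasLaw_ae (hasLaw_snd P1 P2) a2.
  apply: filterS2 l1 l2 => x [i _ Ki] [j _ Kj].
  by exists (pickle (i, j)) => //; rewrite pickleK.
Qed.

(** A closed separable set is a countable intersection of countable unions of balls, so it is enough
    that balls be measurable. In products this replaces the measurability of all closed sets. *)
Lemma dsep_closed_measurable d (T : measurableType d) (dl : T -> T -> R) (C : set T) :
  dmetric dl -> (forall a e, measurable [set z | dl z a < e]) ->
  dsep dl C -> dclosed dl C -> measurable C.
Proof.
move=> dm mB sC cC.
have [C0|/nonemptyPn ->] := pselect (C !=set0); last exact: measurable0.
have [q Cq hq] := dsep_sub dm sC C0.
rewrite (_ : C = \bigcap_k \bigcup_i [set z | dl z (q i) < k.+1%:R^-1]).
  by apply: bigcapT_measurable => k; apply: bigcupT_measurable => i.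
apply/seteqP; split=> [x Cx k _|x h].
  by have [|i xi] := hq x Cx k.+1%:R^-1; [rewrite invr_gt0|exists i].
apply: cC => e e0; have [k ke] := invS_lt e0.
have [i _ /= xi] := h k I; exists (q i) => //; exact: lt_trans ke.
Qed.

(** Compact pieces have compact images, hence measurable ones; so the law of [X] is carried by
    compact subsets of the image of [A], although that image need not be measurable. *)
Lemma tight_image d (T : measurableType d) (dl : T -> T -> R) (P : probability T R)
    d' (T' : measurableType d') (dl' : T' -> T' -> R) (P' : probability T' R)
    (X : T -> T') (A : set T) (t' : T') :
  dmetric dl -> dmetric dl' -> (forall a e, measurable [set z | dl' z a < e]) ->
  tight_on dl P A -> seqcont dl dl' A X -> hasLaw P X P' ->
  tight_on dl' P' (X @` A).
Proof.
move=> dm dm' mB [K [hK sK aK]] cX lX.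
have cXK j : seqcont dl dl' (K j) X.
  have [_ _ KA] := hK j.
  by move=> x p Kx Kp; apply: cX => [n|]; exact: KA.
have sKj j : dsep dl (K j) by apply: dsepS sK => x Kx; exists j.
exists (fun j => X @` K j); split.
- move=> j; have [mK cK KA] := hK j.
  have cI : seqcpt dl' (X @` K j) by apply: seqcpt_image cK.
  split => //.
    apply: (dsep_closed_measurable dm' mB); last exact: seqcpt_dclosed.
    exact: (dsep_image dm t' (cXK j)).
  by move=> _ [x /KA Ax <-]; exists x.
- by apply: dsep_bigcup => // j; exact: (dsep_image dm t' (cXK j)).
- have mI : measurable (\bigcup_j (X @` K j)).
    apply: bigcupT_measurable => j; have [mK cK KA] := hK j.
    apply: (dsep_closed_measurable dm' mB).
      exact: (dsep_image dm t' (cXK j)).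
    by apply: seqcpt_dclosed => //; apply: seqcpt_image cK.
  exists (~` \bigcup_j (X @` K j)); split => //; first exact: measurableC.
  have [mX XP'] := lX; rewrite -XP'; last exact: measurableC.
  have [N [mN N0 sN]] := aK.
  apply: measure_negligible.
    by rewrite -[X in measurable X]setTI; apply: mX => //; exact: measurableC.
  exists N; split => // x nx; apply: sN => -[j _ Kx]; apply: nx.
  by exists j => //; exists x.
Qed.

(* The preimage of a closed set meets each compact piece in a compact, hence measurable, set. *)
Lemma tight_measurable d (T : measurableType d) (dl : T -> T -> R) (P : probability T R)
    (G : undergroupType R) (f : T -> G) (A : set T) :
  dmetric dl -> (forall a e, measurable [set z | dl z a < e]) ->
  tight_on dl P A -> seqcont dl (@mdist R G) A f ->
  exists m : T -> G, measurable_fun setT (m : T -> borel G) /\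
    {ae P, forall x, A x /\ m x = f x}.
Proof.
move=> dm mB [K [hK sK aK]] cf.
have sKj j : dsep dl (K j) by apply: dsepS sK => x Kx; exists j.
pose m x := if `[< (\bigcup_j K j) x >] then f x else point.
exists m; split; last first.
  apply: filterS aK => x Kx; rewrite /m asboolT//; split=> //.
  by have [j _ Kjx] := Kx; have [_ _ KA] := hK j; exact: KA.
have mK : measurable (\bigcup_j K j) by apply: bigcupT_measurable => j; have [] := hK j.
suff h F : dclosed (@mdist R G) F -> measurable (m @^-1` F).
  apply: measurability => // _ [U oU <-]; rewrite setTI -(setCK (m @^-1` U)).
  apply: measurableC; rewrite preimage_setC; apply: h => p hp Up.
  have [e e0 eU] := (open_mdistP U).1 oU p Up.
  by have [y nUy py] := hp e e0; apply: nUy; exact: eU.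
move=> cF.
have mKf j : measurable (K j `&` f @^-1` F).
  have [mKj cK KA] := hK j.
  apply: (dsep_closed_measurable dm mB); first by apply: dsepS (sKj j) => x [].
  apply: seqcpt_dclosed => //; apply: (seqcpt_preimage (dl' := @mdist R G)) => //.
  by move=> x p Kx Kp; apply: cf => [n|]; exact: KA.
rewrite (_ : m @^-1` F = \bigcup_j (K j `&` f @^-1` F) `|` (~` (\bigcup_j K j) `&` [set _ | F point])).
  apply: measurableU; first exact: bigcupT_measurable.
  apply: measurableI; first exact: measurableC.
  by have [Fp|Fp] := pselect (F point);
    [rewrite (_ : [set _ | _] = setT)|rewrite (_ : [set _ | _] = set0)] => //;
    apply/seteqP; split.
apply/seteqP; split=> x; rewrite /m/=.
  case: asboolP => [[j _ Kx] Fx|nK Fx]; [left|right] => //.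
  by exists j.
move=> [[j _ [Kx Fx]]|[nK Fp]].
  by rewrite asboolT//; exists j.
by rewrite asboolF.
Qed.

End tightness.

(** * Convolution powers *)

Lemma hasLaw_prod_map (R : realType) d1 (T1 : measurableType d1) d2 (T2 : measurableType d2)
    d1' (T1' : measurableType d1') d2' (T2' : measurableType d2')
    (P1 : probability T1 R) (P2 : probability T2 R)
    (Q1 : probability T1' R) (Q2 : probability T2' R) (f : T1 -> T1') (g : T2 -> T2') :
  hasLaw P1 f Q1 -> hasLaw P2 g Q2 ->
  hasLaw (P1 \x P2)%E (fun z => (f z.1, g z.2)) (Q1 \x Q2)%E.
Proof.
move=> [mf lf] [mg lg]; apply: hasLaw_pair.
- exact: measurableT_comp.
- exact: measurableT_comp.
- move=> A B mA mB.
  have mfA : measurable (f @^-1` A) by rewrite -[X in measurable X]setTI; exact: mf.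
  have mgB : measurable (g @^-1` B) by rewrite -[X in measurable X]setTI; exact: mg.
  rewrite -lf// -lg//.
  by have := product_measure1E P1 P2 mfA mgB.
Qed.

Lemma measurable_preim d (T : measurableType d) d' (T' : measurableType d') (f : T -> T') B :
  measurable_fun setT f -> measurable B -> measurable (f @^-1` B).
Proof. by move=> mf mB; rewrite -[X in measurable X]setTI; exact: mf. Qed.

Section convolution.
Context (R : realType) (G : undergroupType R).
Implicit Types a b c lam : probability (borel G) R.
Local Notation dist := (@mdist R G).
Local Notation dist2 := (sumd (@mdist R G) (@mdist R G)).

Let dm := @mdist_dmetric R G.
Let dm2 := sumd_dmetric dm dm.

Lemma mdist_measurable x : measurable_fun setT ((fun z => dist z x) : borel G -> R).
Proof. by apply: (@lip_measurable _ _ 1) => y z; rewrite mul1r; exact: mdist_lip. Qed.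

Lemma dist_ball_measurable x e : measurable ([set z | dist z x < e] : set (borel G)).
Proof.
apply: borel_open; rewrite (_ : [set _ | _] = [set z | dist x z < e]).
  exact: open_mball.
by apply/seteqP; split=> z /=; rewrite metric_sym.
Qed.

Lemma dist2_ball_measurable x e :
  measurable ([set z | dist2 z x < e] : set (borel G * borel G)).
Proof.
have mf : measurable_fun setT ((fun z => dist2 z x) : borel G * borel G -> R).
  apply: measurable_funD.
    by apply: (measurableT_comp (@mdist_measurable x.1)); exact: measurable_fst.
  by apply: (measurableT_comp (@mdist_measurable x.2)); exact: measurable_snd.
rewrite (_ : [set _ | _] = (fun z => dist2 z x) @^-1` `]-oo, e[).
  exact: (measurable_preim mf).
by apply/seteqP; split=> z /=; rewrite in_itv.
Qed.

Definition tight a := tight_on (T := borel G) dist a setT.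

Lemma sigma_compact_tight a : sigma_compact_supported a -> tight a.
Proof.
move=> sa; have [q aq] := sigma_compact_cl sa; have [K cK aK] := sa.
have mK j : measurable (K j : set (borel G)).
  rewrite -(setCK (K j)); apply: measurableC; apply: borel_open.
  by rewrite openC; apply: compact_closed; [exact: (@metric_hausdorff R)|].
have cv (j : nat) : exists q, K j `<=` cl q by exact: compact_cl.
exists K; split.
- by move=> j; split=> //; exact: compact_seqcpt.
- apply: dsep_bigcup; first exact: point.
  by move=> j; have [q' h] := cv j; exists q' => x /h.
- exists (~` \bigcup_j K j); split => //.
    by apply: measurableC; exact: bigcupT_measurable.
  rewrite probability_setC; last exact: bigcupT_measurable.
  have -> : a (\bigcup_j K j) = 1%E by exact: aK.
  by rewrite subee.
Qed.

Lemma tight_cl a : tight a -> exists q, {ae a, forall x, cl q x}.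
Proof. by move=> [K [_ [q hq] aK]]; exists q; apply: aeS aK => x Kx; exact: hq. Qed.

Definition gmul (z : G * G) : G := odflt point (umul z.1 z.2).

Lemma seqcv_mdist (x : nat -> G) p : seqcv dist x p <-> mdist (x n) p @[n --> \oo] --> (0 : R).
Proof.
split=> [h|h e e0].
  apply/cvgrPdist_lt => e e0; apply: filterS (h e e0) => n.
  by rewrite sub0r normrN ger0_norm ?mdist_ge0// metric_sym.
apply: filterS ((cvgrPdist_lt _ _).1 h e e0) => n.
by rewrite sub0r normrN ger0_norm ?mdist_ge0// metric_sym.
Qed.

Lemma seqcont_gmul : seqcont dist2 dist [set z | umul z.1 z.2] gmul.
Proof.
move=> x p Dx Dp /(seqcv_pair _ _ dm dm)[/seqcv_mdist c1 /seqcv_mdist c2].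
apply/seqcv_mdist; have e z : umul z.1 z.2 -> umul z.1 z.2 = Some (gmul z).
  by rewrite /gmul; case: umul.
by apply: umul_cvg c1 c2; [exact: e|move=> n; apply: e; exact: Dx].
Qed.

Lemma is_convP a b lam : is_conv a b lam <-> exists m : G * G -> G,
  hasLaw (a \x b)%E (m : borel G * borel G -> borel G) lam /\
  {ae (a \x b)%E, forall z, umul z.1 z.2 = Some (m z)}.
Proof.
split=> [[m h l]|[m [[mm l] h]]].
  by exists m; split=> //; split => // B mB; rewrite l.
exists (mfun_Sub (mem_set mm)) => //.
by move=> B mB; rewrite -l.
Qed.

Let tight2_sub a b (A : set (G * G)) : tight a -> tight b -> {ae (a \x b)%E, forall z, A z} ->
  tight_on (T := (borel G * borel G)%type) dist2 (a \x b)%E A.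
Proof.
move=> ta tb; apply: (@tight_sub R _ (borel G * borel G)%type) => //.
- apply: (@regular_prod R _ _ (borel G) (borel G) dist dist) => //; exact: regular_borel.
- exact: (@tight_prod R _ _ (borel G) (borel G) dist dist a b point point).
Qed.

(** [gmul] is continuous on the domain of the product, which carries the product law; hence it
    agrees almost everywhere with a measurable map, and the image measure exists. *)
Lemma conv_exists a b : tight a -> tight b -> conv_defined a b -> is_conv a b (Defs.conv a b).
Proof.
move=> ta tb dab; rewrite /Defs.conv; apply: xgetPex.
have tab := tight2_sub ta tb dab.
have [m [mm hm]] := @tight_measurable R _ (borel G * borel G)%type _ _ G _ _
  dm2 dist2_ball_measurable tab seqcont_gmul.
have [lam l] := hasLaw_ex (a \x b)%E mm.
exists lam; apply/is_convP; exists m; split => //.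
by apply: aeS hm => z [D ->]; move: D; rewrite /gmul /=; case: umul.
Qed.

Let seqcont_m (m : G * G -> G) :
  seqcont dist2 dist [set z | umul z.1 z.2 = Some (m z)] m.
Proof.
move=> x p Dx Dp xp.
have e z : umul z.1 z.2 = Some (m z) -> m z = gmul z by rewrite /gmul => ->.
have -> : m \o x = gmul \o x by apply/funext => n; apply: e; exact: Dx.
rewrite (e _ Dp).
apply: seqcont_gmul => //=; first by move=> n; rewrite Dx.
by rewrite Dp.
Qed.

Lemma is_conv_tight a b lam : tight a -> tight b -> is_conv a b lam -> tight lam.
Proof.
move=> ta tb /is_convP[m [l h]].
have tab := tight2_sub ta tb h.
have [K [hK sK aK]] := @tight_image R _ (borel G * borel G)%type _ _ _ (borel G) _ _ _ _
  point dm2 dm dist_ball_measurable tab (@seqcont_m m) l.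
by exists K; split => // j; have [? ? _] := hK j.
Qed.

(** Axiom [umulA] is applied to three independent factors. The domain of the product need not be
    measurable, so almost sure definedness on the triple product does not transfer directly to the
    law of the pair [(fg, h)]; the compact pieces from [tight_image] carry it over. *)
Lemma conv_definedM a b c ab : tight a -> tight b -> tight c ->
  is_conv a b ab -> conv_defined b c -> conv_defined ab c.
Proof.
move=> ta tb tc /is_convP[m [l h]] dbc.
pose P3 : probability ((borel G * borel G) * borel G)%type R := ((a \x b) \x c)%E.
pose A3 := [set x : (G * G) * G | umul x.1.1 x.1.2 = Some (m x.1) /\ umul x.1.2 x.2].
have aA : {ae P3, forall x, A3 x}.
  have h1 := hasLaw_ae (hasLaw_fst (a \x b)%E c) h.
  have h2 := hasLaw_ae (hasLaw_prod_map (hasLaw_snd a b) (hasLaw_id c)) dbc.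
  by apply: aeS2 h1 h2.
have t3 : tight_on (T := ((borel G * borel G) * borel G)%type) (sumd dist2 dist) P3 A3.
  apply: (@tight_sub R _ ((borel G * borel G) * borel G)%type) => //.
  - exact: (@sumd_dmetric R (G * G) G dist2 dist dm2 dm).
  - apply: (@regular_prod R _ _ (borel G * borel G)%type (borel G) dist2 dist) => //; last exact: regular_borel.
    by apply: (@regular_prod R _ _ (borel G) (borel G) dist dist) => //; exact: regular_borel.
  - apply: (@tight_prod R _ _ (borel G * borel G)%type (borel G) dist2 dist _ c (point, point) point) => //.
    exact: (@tight_prod R _ _ (borel G) (borel G) dist dist a b point point).
pose Phi (x : (G * G) * G) := (m x.1, x.2).
have lPhi : hasLaw P3 (Phi : (borel G * borel G) * borel G -> borel G * borel G) (ab \x c)%E.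
  exact: hasLaw_prod_map l (hasLaw_id c).
have cPhi : seqcont (sumd dist2 dist) dist2 A3 Phi.
  move=> x p Ax Ap /(seqcv_pair _ _ dm2 dm)[c1 c2].
  apply/(seqcv_pair _ _ dm dm); split=> //=.
  exact: (seqcont_m (x := fst \o x) (fun n => (Ax n).1) Ap.1 c1).
have [K [hK _ aK]] := @tight_image R _ ((borel G * borel G) * borel G)%type _ _ _
  (borel G * borel G)%type _ _ _ _ (point, point)
  (@sumd_dmetric R (G * G) G dist2 dist dm2 dm) dm2 dist2_ball_measurable t3 cPhi lPhi.
apply: aeS aK => z [j _ Kz]; have [_ _ /(_ _ Kz)[x [e1 e2] <-]] := hK j.
move: e2; case E : (umul x.1.2 x.2) => [gh|//] _.
by have [fgh /= -> _] := umulA _ _ _ _ _ e1 E.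
Qed.

Lemma unit_mass_ae : {ae @unit_mass R G, forall x, x = point :> G}.
Proof.
have mp : measurable ([set point] : set (borel G)).
  rewrite (_ : [set point] = \bigcap_k [set z : G | dist z point < k.+1%:R^-1]).
    by apply: bigcapT_measurable => k; exact: dist_ball_measurable.
  apply/seteqP; split=> [x -> k _ /=|x h]; first by rewrite mdistxx invr_gt0.
  apply: (mdist_positivity (s := G)); apply/eqP; rewrite eq_le mdist_ge0 andbT.
  apply/ler_addgt0Pr => e e0; rewrite add0r; have [k ke] := invS_lt e0.
  by rewrite ltW// (lt_trans _ ke)//; exact: h.
exists (~` [set point]); split => //; first exact: measurableC.
by rewrite /unit_mass/= /dirac indicE memNset//= => /(_ erefl).
Qed.

Lemma unit_mass_tight : tight (@unit_mass R G).
Proof.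
apply: sigma_compact_tight; exists (fun=> [set point]); first by move=> _; exact: compact_set1.
by rewrite /unit_mass/= /dirac indicE mem_set//; exists 0%N.
Qed.

Section powers.
Variable mu : probability (borel G) R.
Hypotheses (tmu : tight mu) (dmu : conv_defined mu mu).

Lemma conv_powP k : [/\ tight (conv_pow mu k), conv_defined (conv_pow mu k) mu &
  is_conv (conv_pow mu k) mu (conv_pow mu k.+1)].
Proof.
elim: k => [|k [tk dk ik]].
  have d0 : conv_defined (@unit_mass R G) mu.
    apply: aeS (hasLaw_ae (hasLaw_fst _ mu) unit_mass_ae) => z /= ->.
    by rewrite umul1g.
  split => //; first exact: unit_mass_tight.
  by apply: conv_exists => //; exact: unit_mass_tight.
have tk1 : tight (conv_pow mu k.+1) by exact: is_conv_tight ik.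
have dk1 : conv_defined (conv_pow mu k.+1) mu by exact: conv_definedM ik dmu.
by split => //; exact: conv_exists.
Qed.

End powers.

End convolution.

(** * Chains of block laws *)

Section weak_convergence.
Context (R : realType) (G : undergroupType R).
Local Notation dist := (@mdist R G).
Local Notation dist2 := (sumd (@mdist R G) (@mdist R G)).
Local Notation B2 := (borel G * borel G)%type.
Implicit Types (K be : probability B2 R) (q : nat -> G).

Let dm := @mdist_dmetric R G.
Let dm2 := sumd_dmetric dm dm.

Definition cut2 q (z : G * G) := (cutq q z.1, cutq q z.2).

Lemma dist_bounded_lip (T : Type) (dl : T -> T -> R) b L (phi : T -> R) (t : T) :
  (forall x y, dl x y <= b) -> 0 <= L -> lip dl L phi -> exists M, forall x, `|phi x| <= M.
Proof.
move=> dlb L0 pl; exists (`|phi t| + L * b) => x.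
rewrite -[phi x](subrK (phi t)) addrC (le_trans (ler_normD _ _))// lerD2l.
by rewrite (le_trans (pl _ _))// ler_wpM2l.
Qed.

Lemma dist2_le x y : dist2 x y <= 2.
Proof. by rewrite /sumd (_ : 2 = 1 + 1 :> R) ?lerD ?mdist_le1. Qed.

Lemma dist4_le x y : sumd dist2 dist2 x y <= 4.
Proof.
by have := dist2_le x.1 y.1; have := dist2_le x.2 y.2; rewrite {3}/sumd; lra.
Qed.

(** Measurability for the product sigma-field comes one coordinate at a time, from
    [lip_measurable_comp]. *)
Lemma cut2_bmeas q L (phi : G * G -> R) : 0 <= L -> lip dist2 L phi ->
  bmeas ((fun z => phi (cut2 q z)) : B2 -> R).
Proof.
move=> L0 pl; have [M pM] := dist_bounded_lip (point, point) dist2_le L0 pl.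
split; last by exists M => z.
pose F (z : B2) (y : G) := phi (cutq q z.1, y).
apply: (@lip_measurable_comp R G _ _ q (fun z : B2 => cutq q z.2) F L M) => //.
- by apply: measurableT_comp; [exact: cut_measurable|exact: measurable_snd].
- by move=> w; exact: cut_cl.
- move=> y; pose F' (z : B2) (x : G) := phi (x, y).
  apply: (@lip_measurable_comp R G _ _ q (fun z : B2 => cutq q z.1) F' L M) => //.
  + by apply: measurableT_comp; [exact: cut_measurable|exact: measurable_fst].
  + by move=> w; exact: cut_cl.
  + by move=> w x; exact: pM.
  + by move=> w x x'; rewrite (le_trans (pl _ _))// /sumd/= mdistxx addr0.
- by move=> w x; exact: pM.
- by move=> w x x'; rewrite (le_trans (pl _ _))// /sumd/= mdistxx add0r.
Qed.

Lemma cut4_bmeas q L (phi : (G * G) * (G * G) -> R) : 0 <= L -> lip (sumd dist2 dist2) L phi ->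
  bmeas ((fun w => phi (cut2 q w.1, cut2 q w.2)) : B2 * B2 -> R).
Proof.
move=> L0 pl; have [M pM] := dist_bounded_lip ((point, point), (point, point)) dist4_le L0 pl.
split; last by exists M => z.
pose F (w : B2 * B2) (y : G) := phi (cut2 q w.1, (cutq q w.2.1, y)).
apply: (@lip_measurable_comp R G _ _ q (fun w : B2 * B2 => cutq q w.2.2) F L M) => //.
- apply: measurableT_comp; first exact: cut_measurable.
  by apply: measurableT_comp; [exact: measurable_snd|exact: measurable_snd].
- by move=> w; exact: cut_cl.
- move=> y; pose F' (w : B2 * B2) (x : G) := phi (cut2 q w.1, (x, y)).
  apply: (@lip_measurable_comp R G _ _ q (fun w : B2 * B2 => cutq q w.2.1) F' L M) => //.
  + apply: measurableT_comp; first exact: cut_measurable.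
    by apply: measurableT_comp; [exact: measurable_fst|exact: measurable_snd].
  + by move=> w; exact: cut_cl.
  + move=> x; apply: (measurableT_comp (f := fun z : B2 => phi (cut2 q z, (x, y)))); last exact: measurable_fst.
    apply: (@cut2_bmeas q L (fun z => phi (z, (x, y))) L0 _).1 => z z'.
    by rewrite (le_trans (pl _ _))// {1}/sumd/= (dm0 dm2) addr0.
  + by move=> w x; exact: pM.
  + by move=> w x x'; rewrite (le_trans (pl _ _))// {1}/sumd (dm0 dm2) add0r /sumd/= mdistxx addr0.
- by move=> w x; exact: pM.
- by move=> w x x'; rewrite (le_trans (pl _ _))// {1}/sumd (dm0 dm2) add0r /sumd/= mdistxx add0r.
Qed.

Definition wcv q (Ks : nat -> probability B2 R) K := forall L phi, 0 <= L -> lip dist2 L phi ->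
  \int[Ks n]_z phi (cut2 q z) @[n --> \oo] --> \int[K]_z phi (cut2 q z).

(** Unlike in [wcv], the convergence is uniform in [phi]: in [prod_wcv] the test function of the new
    factor depends on the point of the old one. *)
Definition krc q (bes : nat -> probability B2 R) be := forall e, 0 < e ->
  \forall n \near \oo, forall phi, lip dist2 1 phi ->
    `|\int[bes n]_z phi (cut2 q z) - \int[be]_z phi (cut2 q z)| <= e.

Lemma prod_wcv q Ks K bes be : wcv q Ks K -> krc q bes be ->
  forall L phi, 0 <= L -> lip (sumd dist2 dist2) L phi ->
  \int[(Ks n \x bes n)%E]_w phi (cut2 q w.1, cut2 q w.2) @[n --> \oo] -->
  \int[(K \x be)%E]_w phi (cut2 q w.1, cut2 q w.2).
Proof.
move=> wK kb L phi L0 pl.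
have bphi := cut4_bmeas q L0 pl.
have bphi1 z : bmeas ((fun s => phi (z, cut2 q s)) : B2 -> R).
  apply: (@cut2_bmeas q L (fun s => phi (z, s)) L0) => s s'.
  by rewrite (le_trans (pl _ _))// {1}/sumd/= (dm0 dm2) add0r.
(* Integrating out the limit block leaves a function that is again [L]-Lipschitz, so its integrals
   under [Ks n] converge; the error of putting [be] for [bes n] is uniform in [z]. Dividing by
   [L + 1] makes the test functions 1-Lipschitz, also when [L = 0]. *)
pose F (z : G * G) := \int[be]_s phi (z, cut2 q s).
have Fl : lip dist2 L F.
  move=> z z'; apply: int_dist; [exact: bphi1|exact: bphi1|move=> s].
  by rewrite (le_trans (pl _ _))// {1}/sumd/= (dm0 dm2) addr0.
have cF := wK L F L0 Fl.
rewrite fubini_int//=; apply/cvgrPdist_le => e e0.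
have e20 : 0 < e / 2 by rewrite divr_gt0.
have L1 : 0 < L + 1 by rewrite ltr_wpDl.
have eL : 0 < e / 2 / (L + 1) by rewrite divr_gt0.
apply: filterS2 ((cvgrPdist_le _ _).1 cF _ e20) (kb _ eL) => n h1 h2.
rewrite fubini_int//= -/(F _) distrC.
rewrite -[X in X - _](subrK (\int[Ks n]_z F (cut2 q z))) -addrA.
rewrite (le_trans (ler_normD _ _))// (splitr e) lerD//; last by rewrite distrC.
apply: int_dist.
- exact: (fubini_bmeas (Ks n) (bes n) bphi).
- exact: (cut2_bmeas q L0 Fl).
- move=> z; have := h2 (fun s => (L + 1)^-1 * phi (cut2 q z, s)).
  rewrite !intZ//; try exact: bphi1.
  rewrite -mulrBr normrM gtr0_norm ?invr_gt0// [_^-1 * `|_|]mulrC ler_pM2r ?invr_gt0//; apply.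
  move=> s s'; rewrite -mulrBr normrM gtr0_norm ?invr_gt0// ler_pdivrMl// mul1r.
  rewrite (le_trans (pl _ _))// {1}/sumd/= (dm0 dm2) add0r.
  by rewrite ler_wpM2r ?(dm_ge0 dm2)// lerDl.
Qed.

(** [K'] is the law of a product of independent elements with laws [K] and [be], witnessed on some
    probability space. The space is left open since [conv_chain], [diag_chain] and [block_chain]
    realize their steps on different ones. *)
Record stepping K be K' := Stepping {
  st_d : measure_display ; st_O : measurableType st_d ; st_P : probability st_O R ;
  st_z : st_O -> B2 ; st_s : st_O -> B2 ; st_z' : st_O -> B2 ;
  st_joint : hasLaw st_P (fun w => (st_z w, st_s w)) (K \x be)%E ;
  st_out : hasLaw st_P st_z' K' ;
  st_mul : {ae st_P, forall w,
    umul ((st_z w).1 : G) ((st_s w).1 : G) = Some ((st_z' w).1 : G) /\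
    umul ((st_z w).2 : G) ((st_s w).2 : G) = Some ((st_z' w).2 : G)} }.

Arguments st_z {K be K'} _ _.
Arguments st_s {K be K'} _ _.
Arguments st_z' {K be K'} _ _.

Definition step K be K' := exists _ : stepping K be K', True.

Definition carried q K := {ae K, forall z, cl q z.1 /\ cl q z.2}.

Lemma cut2_id q z : cl q z.1 -> cl q z.2 -> cut2 q z = z.
Proof. by case: z => x y /= cx cy; rewrite /cut2 !cut_id. Qed.

Definition dom4 := [set p : (G * G) * (G * G) | umul p.1.1 p.2.1 /\ umul p.1.2 p.2.2].
Definition gmul2 (p : (G * G) * (G * G)) := (gmul (p.1.1, p.2.1), gmul (p.1.2, p.2.2)).

(** The epsilon-eta form, relative to [dom4], of the sequential axiom [umul_cvg]; a sequence
    violating it is extracted by [approx_seq]. *)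
Lemma gmul2_cont p e : dom4 p -> 0 < e -> exists2 eta, 0 < eta & forall p', dom4 p' ->
  sumd dist2 dist2 p p' < eta -> dist2 (gmul2 p) (gmul2 p') < e.
Proof.
move=> Dp e0; apply: contrapT => nh.
have [|x hx xp] := @approx_seq R _ (sumd dist2 dist2)
    [set p' | dom4 p' /\ ~ dist2 (gmul2 p) (gmul2 p') < e] p.
  move=> eta eta0; apply: contrapT => h; apply: nh; exists eta => // p' Dp' pp'.
  by apply: contrapT => h'; apply: h; exists p'.
have [x1 x2] := (seqcv_pair _ _ dm2 dm2).1 xp.
have [x11 x12] := (seqcv_pair _ _ dm dm).1 x1.
have [x21 x22] := (seqcv_pair _ _ dm dm).1 x2.
have c1 : seqcv dist (fun n => gmul ((x n).1.1, (x n).2.1)) (gmul (p.1.1, p.2.1)).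
  apply: (@seqcont_gmul R G (fun n => ((x n).1.1, (x n).2.1)) (p.1.1, p.2.1)).
  - by move=> n; have [[]] := hx n.
  - by case: Dp.
  - by apply/seqcv_pair.
have c2 : seqcv dist (fun n => gmul ((x n).1.2, (x n).2.2)) (gmul (p.1.2, p.2.2)).
  apply: (@seqcont_gmul R G (fun n => ((x n).1.2, (x n).2.2)) (p.1.2, p.2.2)).
  - by move=> n; have [[]] := hx n.
  - by case: Dp.
  - by apply/seqcv_pair.
have c : seqcv dist2 (gmul2 \o x) (gmul2 p) by apply/seqcv_pair.
have /filter_ex[n h] := c _ e0.
by have [_] := hx n.
Qed.

(** The portmanteau lemma with [dom4] for [D] and [phi \o gmul2] for [g]; convergence for Lipschitz
    test functions of the two factors is [prod_wcv]. *)
Lemma step_wcv q Ks K bes be Ks' K' :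
  wcv q Ks K -> krc q bes be ->
  (forall n, step (Ks n) (bes n) (Ks' n)) -> step K be K' ->
  (forall n, carried q (Ks n)) -> (forall n, carried q (bes n)) -> (forall n, carried q (Ks' n)) ->
  carried q K -> carried q be -> carried q K' -> wcv q Ks' K'.
Proof.
move=> wK kb /(_ _)/cid-/all_sig[s_ _] [s _] cK_ cb_ cK'_ cK cb cK' L phi L0 pl.
have [M pM] := dist_bounded_lip (point, point) dist2_le L0 pl.
have e_ : (fun n => \int[Ks' n]_z phi (cut2 q z)) =
    (fun n => \int[st_P (s_ n)]_w phi (cut2 q (st_z' (s_ n) w))).
  by apply/funext => n; exact: (hasLaw_int (st_out (s_ n)) (cut2_bmeas q L0 pl)).
rewrite (hasLaw_int (st_out s) (cut2_bmeas q L0 pl)).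
rewrite e_.
have ae_step (k be0 k' : probability B2 R) (t : stepping k be0 k') :
    carried q k -> carried q be0 -> carried q k' -> {ae st_P t, forall w,
    [/\ dom4 (cut2 q (st_z t w), cut2 q (st_s t w)) ,
    cut2 q (st_z' t w) = gmul2 (cut2 q (st_z t w), cut2 q (st_s t w)) & True]}.
  move=> c1 c2 c3.
  have h1 := hasLaw_ae (st_joint t) (hasLaw_ae (hasLaw_fst k be0) c1).
  have h2 := hasLaw_ae (st_joint t) (hasLaw_ae (hasLaw_snd k be0) c2).
  have h3 := hasLaw_ae (st_out t) c3.
  apply: aeS2 (aeS2 (fun w a b => conj a b) h1 h2) (aeS2 (fun w a b => conj a b) h3 (st_mul t)).
  move=> w [/= [a1 a2] [b1 b2]] [[d1 d2] [m1 m2]].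
  rewrite !cut2_id//; split => //.
    by rewrite /dom4/= m1 m2.
  rewrite /gmul2/= /gmul/= m1 m2 /=.
  by case: (st_z' t w).
apply: (@portmanteau R _ (sumd dist2 dist2) _ _ _ _ dom4 _ _ (fun n => st_P (s_ n))
   (fun n w => (cut2 q (st_z (s_ n) w), cut2 q (st_s (s_ n) w))) _ _ (st_P s)
   (fun w => (cut2 q (st_z s w), cut2 q (st_s s w))) _ (phi \o gmul2) M).
- by move=> z; exact: (dm0 (sumd_dmetric dm2 dm2)).
- by move=> z; exact: (dm_ge0 (sumd_dmetric dm2 dm2)).
- by move=> z; exact: (dm_sym (sumd_dmetric dm2 dm2)).
- by move=> z; exact: (dm_tri (sumd_dmetric dm2 dm2)).
- move=> L' f L'0 _ fl; have bf := cut4_bmeas q L'0 fl; split.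
  + by move=> n; exact: (bmeas_comp bf (st_joint (s_ n)).1).
  + exact: (bmeas_comp bf (st_joint s).1).
  + have := prod_wcv wK kb L'0 fl.
    rewrite (hasLaw_int (st_joint s) bf)/=.
    rewrite (_ : (fun n => \int[(Ks n \x bes n)%E]_w f (cut2 q w.1, cut2 q w.2)) =
      (fun n => \int[st_P (s_ n)]_w f (cut2 q (st_z (s_ n) w), cut2 q (st_s (s_ n) w)))) //.
    by apply/funext => n; rewrite (hasLaw_int (st_joint (s_ n)) bf).
- by move=> p /=.
- by move=> n; exact: (bmeas_comp (cut2_bmeas q L0 pl) (st_out (s_ n)).1).
- exact: (bmeas_comp (cut2_bmeas q L0 pl) (st_out s).1).
- move=> n; apply: aeS (ae_step _ _ _ (s_ n) (cK_ n) (cb_ n) (cK'_ n)) => w [h1 h2 _].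
  by split => //=; rewrite h2.
- apply: aeS (ae_step _ _ _ s cK cb cK') => w [h1 h2 _].
  split => //=; first by rewrite h2.
  move=> e e0; have L1 : 0 < L + 1 by rewrite ltr_wpDl.
  have [eta eta0 h] := gmul2_cont h1 (divr_gt0 e0 L1).
  exists eta => // y Dy /(h _ Dy) hy.
  rewrite distrC (le_trans (pl _ _))//.
  move: hy; rewrite ltr_pdivlMr// => /ltW; apply: le_trans.
  by rewrite mulrC ler_wpM2l ?(dm_ge0 dm2)// lerDl.
Qed.

Record chain q N (K be : nat -> probability B2 R) : Prop := {
  chain0 : {ae K 0, forall z, z = (point, point) :> G * G} ;
  chainS : forall j, (j < N)%N -> step (K j) (be j) (K j.+1) ;
  chain_K : forall j, (j <= N)%N -> carried q (K j) ;
  chain_be : forall j, (j < N)%N -> carried q (be j) }.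

(** Induction along the chains, whose length [N] is common to all [n]. Both paths start at the
    unity, so at [j = 0] the integrals are constant. *)
Lemma chain_wcv q N Ks bes (K be : nat -> probability B2 R) : (forall n, chain q N (Ks n) (bes n)) -> chain q N K be ->
  (forall j, (j < N)%N -> krc q (fun n => bes n j) (be j)) ->
  wcv q (fun n => Ks n N) (K N).
Proof.
move=> c_ c kb; suff h j : (j <= N)%N -> wcv q (fun n => Ks n j) (K j) by exact: h.
elim: j => [_|j IH jN].
  move=> L phi L0 pl.
  have h (k be0 : nat -> probability B2 R) : chain q N k be0 -> \int[k 0%N]_z phi (cut2 q z) = phi (cut2 q (point, point)).
    move=> c0; rewrite -[RHS](int_cst (k 0%N)); apply: int_ae.
    - exact: cut2_bmeas L0 pl.
    - exact: bmeas_cst.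
    - by apply: aeS (chain0 c0) => z ->.
  rewrite (h _ _ c) (_ : (fun n => \int[Ks n 0%N]_z phi (cut2 q z)) = (fun=> phi (cut2 q (point, point)))).
    exact: cvg_cst.
  by apply/funext => n; exact: (h _ _ (c_ n)).
apply: (step_wcv (IH (ltnW jN)) (kb j jN)).
- by move=> n; exact: chainS.
- exact: (chainS c).
- by move=> n; exact: (chain_K (c_ n) (ltnW jN)).
- by move=> n; exact: (chain_be (c_ n)).
- by move=> n; exact: (chain_K (c_ n)).
- exact: (chain_K c (ltnW jN)).
- exact: (chain_be c).
- exact: (chain_K c).
Qed.

Lemma bmeas_psi2 (psi : G -> R) : bmeas (psi : borel G -> R) ->
  bmeas ((fun z => psi z.1 * psi z.2) : B2 -> R).
Proof.
move=> bp; apply: bmeasM.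
  exact: (bmeas_comp bp (@measurable_fst _ _ _ _)).
exact: (bmeas_comp bp (@measurable_snd _ _ _ _)).
Qed.

Lemma wcv_psi q Ks K (psi : G -> R) : bmeas (psi : borel G -> R) ->
  wcv q Ks K -> (forall n, carried q (Ks n)) -> carried q K ->
  {ae K, forall z, {for z.1, continuous psi} /\ {for z.2, continuous psi}} ->
  \int[Ks n]_z (psi z.1 * psi z.2) @[n --> \oo] --> \int[K]_z (psi z.1 * psi z.2).
Proof.
move=> bp wK cK_ cK cp; have [mp [M pM]] := bp.
apply: (@portmanteau R _ dist2 _ _ _ _ setT _ _ Ks (fun n z => cut2 q z) _ _ K
   (fun z => cut2 q z) _ (fun z => psi z.1 * psi z.2) (M * M)).
- by move=> z; exact: (dm0 dm2).
- by move=> z; exact: (dm_ge0 dm2).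
- by move=> z; exact: (dm_sym dm2).
- by move=> z; exact: (dm_tri dm2).
- move=> L' f L'0 _ fl; have bf := cut2_bmeas q L'0 fl; split => //.
  exact: (wK L').
- by move=> z; rewrite normrM ler_pM.
- by move=> n; exact: bmeas_psi2.
- exact: bmeas_psi2.
- by move=> n; apply: aeS (cK_ n) => z [c1 c2]; rewrite cut2_id.
- apply: aeS2 cK cp => z [c1 c2] [p1 p2]; rewrite cut2_id//; split => // e e0.
  have M0 : 0 <= M := le_trans (normr_ge0 _) (pM point).
  (* An increment of [psi] times a value bounded by [M] has to stay below [e / 2]; the [+ 1] allows
     [M = 0]. *)
  have M1 : 0 < 2 * (M + 1) by rewrite mulr_gt0// ltr_wpDl.
  have [eta1 eta10 h1] := (for_continuous_mdist psi z.1).1 p1 _ (divr_gt0 e0 M1).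
  have [eta2 eta20 h2] := (for_continuous_mdist psi z.2).1 p2 _ (divr_gt0 e0 M1).
  exists (Num.min eta1 eta2); first by rewrite lt_min eta10.
  move=> y _; rewrite lt_min /sumd => /andP[d1 d2].
  have {}h1 := h1 y.1 (le_lt_trans (ler_wpDr (mdist_ge0 _ _) (lexx _)) d1).
  have {}h2 := h2 y.2 (le_lt_trans (ler_wpDl (mdist_ge0 _ _) (lexx _)) d2).
  rewrite (_ : _ - _ = (psi y.1 - psi z.1) * psi y.2 + psi z.1 * (psi y.2 - psi z.2)); last by ring.
  rewrite (le_trans (ler_normD _ _))// !normrM.
  have e' : e / (2 * (M + 1)) * M <= e / 2.
    rewrite invfM mulrA -[leRHS]mulr1 -mulrA ler_wpM2l ?divr_ge0// ?(ltW e0)//.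
    by rewrite mulrC ler_pdivrMr ?mul1r ?lerDl// ltr_wpDl.
  rewrite (splitr e) lerD// (le_trans _ e')//; first by rewrite ler_pM.
  by rewrite mulrC ler_pM.
Qed.

End weak_convergence.

(** * Block laws and the chains they generate *)

Section block_steps.
Context (R : realType) (G : undergroupType R).
Local Notation dist := (@mdist R G).
Local Notation dist2 := (sumd (@mdist R G) (@mdist R G)).
Local Notation B2 := (borel G * borel G)%type.

Let dm := @mdist_dmetric R G.
Let dm2 := sumd_dmetric dm dm.

Lemma lip_bmeas L (f : G -> R) : 0 <= L -> lip dist L f -> bmeas (f : borel G -> R).
Proof.
move=> L0 fl; split; first exact: lip_measurable fl.
by apply: (dist_bounded_lip point _ L0 fl); exact: mdist_le1.
Qed.

Lemma KR_ge (mu nu : probability (borel G) R) (phi : G -> R) : lip dist 1 phi ->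
  `|\int[mu]_f phi f - \int[nu]_f phi f| <= KR mu nu.
Proof.
move=> pl; apply: ub_le_sup; last first.
  by exists phi => // f g; have := pl f g; rewrite mul1r.
(* By [mdist_le1] each integral is within 1 of [f point], so the set whose supremum defines [KR] is
   bounded by 2. *)
exists 2 => _ [f fl <-].
have bf : bmeas (f : borel G -> R).
  by apply: (@lip_bmeas 1) => // x y; rewrite mul1r; exact: fl.
have b1 (P : probability (borel G) R) : `|\int[P]_x f x - f point| <= 1.
  rewrite -[X in _ - X](int_cst P); apply: int_dist => //; first exact: bmeas_cst.
  by move=> x; rewrite (le_trans (fl _ _))// mdist_le1.
rewrite -[X in X - _](subrK (f point)) -addrA (le_trans (ler_normD _ _))//.
by rewrite (_ : 2 = 1 + 1 :> R) ?lerD// distrC.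
Qed.

Lemma KR_le (mu nu : probability (borel G) R) e :
  (forall phi : G -> R, lip dist 1 phi -> `|\int[mu]_f phi f - \int[nu]_f phi f| <= e) ->
  KR mu nu <= e.
Proof.
move=> h; apply: ge_sup => [|_ [f fl <-]].
  exists `|\int[mu]_f (cst 0 : G -> R) f - \int[nu]_f (cst 0 : G -> R) f|, (cst 0) => //.
  by move=> f g /=; rewrite subrr normr0 mdist_ge0.
by apply: h => x y; rewrite mul1r; exact: fl.
Qed.

Lemma KR_ge0 (mu nu : probability (borel G) R) : 0 <= KR mu nu.
Proof.
apply: le_trans (@KR_ge mu nu (cst 0) _); first exact: normr_ge0.
by move=> x y /=; rewrite subrr normr0 mul1r mdist_ge0.
Qed.

(* [be] is the law of one block of both paths: they agree on it if [b], and are independent otherwise. *)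
Definition isb (b : bool) (al : probability (borel G) R) (be : probability B2 R) :=
  if b then hasLaw al (fun x => (x, x)) be else eqm be (al \x al)%E.

Lemma isb_ex b al : exists be, isb b al be.
Proof.
case: b => /=; last by exists (al \x al)%E.
by apply: hasLaw_ex; apply: measurable_fun_pair; exact: measurable_id.
Qed.

Lemma isb_marg b al be : isb b al be -> hasLaw be fst al /\ hasLaw be snd al.
Proof.
case: b => /= h.
  split.
    exact: (hasLaw_factor h (@measurable_fst _ _ _ _) (hasLaw_id al)).
  exact: (hasLaw_factor h (@measurable_snd _ _ _ _) (hasLaw_id al)).
have [m1 l1] := hasLaw_fst al al; have [m2 l2] := hasLaw_snd al al.
split; split => // B mB; rewrite h ?l1 ?l2//; exact: measurable_preim.
Qed.

Lemma marg_carried (q : nat -> G) (be : probability B2 R) (al : probability (borel G) R) : hasLaw be fst al -> hasLaw be snd al ->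
  {ae al, forall x, cl q x} -> carried q be.
Proof. by move=> h1 h2 c; apply: aeS2 (hasLaw_ae h1 c) (hasLaw_ae h2 c). Qed.

Let cut_ae q (al : probability (borel G) R) (f : G -> R) : {ae al, forall x, cl q x} ->
  bmeas (f : borel G -> R) -> \int[al]_x f (cutq q x) = \int[al]_x f x.
Proof.
move=> c bf; apply: int_ae => //.
  exact: (bmeas_comp bf (@cut_measurable _ _ q)).
by apply: aeS c => x cx; rewrite cut_id.
Qed.

Lemma krc_isb q b als al bes be :
  (forall n, isb b (als n) (bes n)) -> isb b al be ->
  (forall n, {ae als n, forall x, cl q x}) -> {ae al, forall x, cl q x} ->
  KR (als n) al @[n --> \oo] --> (0 : R) -> krc q bes be.
Proof.
move=> hs h cs c kr e e0.
have e20 : 0 < e / 2 by rewrite divr_gt0.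
apply: filterS ((cvgrPdist_le _ _).1 kr _ e20) => n.
rewrite sub0r normrN ger0_norm ?KR_ge0// => kn phi pl.
have bphi := cut2_bmeas q ler01 pl.
case: b h hs => /= h hs.
  rewrite (hasLaw_int (hs n) bphi) (hasLaw_int h bphi).
  (* On the diagonal [phi] is 2-Lipschitz for the sum metric, hence the factor one half and the
     tolerance [e / 2]. *)
  pose f (x : G) := 2^-1 * phi (x, x).
  have fl : lip dist 1 f.
    move=> x y; rewrite /f -mulrBr normrM gtr0_norm ?invr_gt0// ler_pdivrMl//.
    by rewrite (le_trans (pl _ _))// /sumd/= mul1r mul1r; lra.
  have bf := lip_bmeas ler01 fl.
  have E (P : probability (borel G) R) : {ae P, forall x, cl q x} ->
      \int[P]_w phi (cut2 q (w, w)) = 2 * \int[P]_x f x.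
    move=> cP; rewrite -(cut_ae cP bf) -intZ.
      by apply: eq_Rintegral => x _; rewrite /f mulrA divff ?mul1r.
    exact: (bmeas_comp bf (@cut_measurable _ _ q)).
  rewrite !E// -mulrBr normrM gtr0_norm// -ler_pdivlMl// mulrC.
  exact: (le_trans (KR_ge _ _ fl)).
rewrite (eqm_int _ (hs n)) (eqm_int _ h) !fubini_int//=.
have lx (x : G) : lip dist 1 (fun y => phi (x, y)).
  by move=> y y'; rewrite (le_trans (pl _ _))// /sumd/= mdistxx add0r.
(* The two factors are exchanged one at a time: first [al] for the inner [als n], uniformly in [x],
   then for the outer one, tested on the Lipschitz function [F]. *)
pose F (x : G) := \int[al]_y phi (x, cutq q y).
have bF (x : G) : bmeas ((fun y => phi (x, cutq q y)) : borel G -> R).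
  exact: (bmeas_comp (lip_bmeas ler01 (lx x)) (@cut_measurable _ _ q)).
have Fl : lip dist 1 F.
  move=> x x'; apply: int_dist => // y.
  by rewrite (le_trans (pl _ _))// /sumd/= mdistxx addr0.
rewrite -[X in X - _](subrK (\int[als n]_x F (cutq q x))) -addrA.
rewrite (le_trans (ler_normD _ _))// (splitr e) lerD//.
  apply: int_dist.
  - exact: (fubini_bmeas (als n) (als n) bphi).
  - exact: (bmeas_comp (lip_bmeas ler01 Fl) (@cut_measurable _ _ q)).
  - move=> x; rewrite /F /cut2/=.
    rewrite (cut_ae (f := fun y => phi (cutq q x, y)) (cs n) (lip_bmeas ler01 (lx _))).
    rewrite (cut_ae (f := fun y => phi (cutq q x, y)) c (lip_bmeas ler01 (lx _))).
    exact: (le_trans (KR_ge _ _ (lx _))).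
rewrite -/(F _) (cut_ae (cs n) (lip_bmeas ler01 Fl)).
rewrite [X in _ - X](_ : _ = \int[al]_x F (cutq q x))//.
rewrite (cut_ae c (lip_bmeas ler01 Fl)).
exact: (le_trans (KR_ge _ _ Fl)).
Qed.

Lemma krc_wcv (q : nat -> G) (bes : nat -> probability B2 R) (be : probability B2 R) : krc q bes be -> wcv q bes be.
Proof.
move=> kb L phi L0 pl; apply/cvgrPdist_le => e e0.
have L1 : 0 < L + 1 by rewrite ltr_wpDl.
apply: filterS (kb _ (divr_gt0 e0 L1)) => n /(_ (fun s => (L + 1)^-1 * phi s)).
have bphi := cut2_bmeas q L0 pl.
rewrite !intZ// -mulrBr normrM gtr0_norm ?invr_gt0// [_^-1 * `|_|]mulrC.
rewrite ler_pM2r ?invr_gt0// distrC; apply.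
move=> s s'; rewrite -mulrBr normrM gtr0_norm ?invr_gt0// ler_pdivrMl// mul1r.
by rewrite (le_trans (pl _ _))// ler_wpM2r ?(dm_ge0 dm2)// lerDl.
Qed.

Section chains.
Variables (p al : nat -> probability (borel G) R) (q : nat -> G).
Hypothesis p0 : {ae p 0, forall x, x = point :> G}.
Hypothesis pS : forall j, is_conv (p j) (al j) (p j.+1).
Hypothesis cp : forall j, {ae p j, forall x, cl q x}.
Hypothesis cal : forall j, {ae al j, forall x, cl q x}.

Section general.
Variables (be : nat -> probability B2 R) (b : nat -> bool).
Hypothesis hbe : forall j, isb (b j) (al j) (be j).

(** [K j.+1] is the image of the product of [K j] and [be j] under [m j] in both coordinates. The
    marginals have to be followed as well: only under [p j] and [al j] is [m j] known to be the
    product. *)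
Lemma conv_chain : exists K, [/\ forall N, chain q N K be,
  forall j, hasLaw (K j) fst (p j) & forall j, hasLaw (K j) snd (p j)].
Proof.
have /(_ _)/cid-/all_sig[m hm] j := (is_convP _ _ _).1 (pS j).
pose M j (w : B2 * B2) : B2 := (m j (w.1.1, w.2.1), m j (w.1.2, w.2.2)).
have mM j : measurable_fun setT (M j).
  have [[mm _] _] := hm j.
  apply: measurable_fun_pair; apply: (measurableT_comp mm); apply: measurable_fun_pair.
  - by apply: measurableT_comp; [exact: measurable_fst|exact: measurable_fst].
  - by apply: measurableT_comp; [exact: measurable_fst|exact: measurable_snd].
  - by apply: measurableT_comp; [exact: measurable_snd|exact: measurable_fst].
  - by apply: measurableT_comp; [exact: measurable_snd|exact: measurable_snd].
pose M' j : {mfun (B2 * B2)%type >-> B2} := mfun_Sub (mem_set (mM j)).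
pose K := fix K (j : nat) : probability B2 R :=
  if j is j'.+1 then distribution (K j' \x be j')%E (M' j') else \d_(point, point).
have lM j : hasLaw (K j \x be j)%E (M j) (K j.+1) by split.
have K0 : {ae K 0%N, forall z, z = (point, point) :> G * G}.
  have [N [mN N0 sN]] := @unit_mass_ae R G.
  exists ((~` N `*` ~` N) `&` ~` (~` N `*` ~` N) `|` ~` (~` N `*` ~` N)).
  have mNN : measurable (~` N `*` ~` N) by apply: measurableX; exact: measurableC.
  have Np : ~ N point.
    move=> h; move: N0; rewrite /unit_mass/= /dirac indicE mem_set//= => /eqP.
    by rewrite onee_eq0.
  rewrite setICr set0U; split.
  - exact: measurableC.
  - by rewrite /K/= /dirac indicE memNset//= => -[]; split.
  - move=> [x y] /= h [nx ny]; apply: h.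
    have ex : x = point by apply: contrapT => h; apply: nx; exact: sN.
    have ey : y = point by apply: contrapT => h; apply: ny; exact: sN.
    by rewrite ex ey.
have hK j : hasLaw (K j) fst (p j) /\ hasLaw (K j) snd (p j).
  elim: j => [|j [IH1 IH2]].
    have e (f : B2 -> borel G) : measurable_fun setT f -> f (point, point) = point ->
        hasLaw (K 0%N) f (p 0%N).
      move=> mf fp; split => // B mB.
      have -> : K 0%N (f @^-1` B) = @unit_mass R G B.
        by rewrite /K/= /unit_mass /= /dirac !indicE /in_mem/= /in_set/= fp.
      have [N [mN N0 sN]] := p0.
      have [Bp|nBp] := pselect (B point).
        rewrite /unit_mass/= /dirac indicE mem_set//=.
        apply/eqP; rewrite eq_le (probability_le1 _ mB) andbT.
        have <- : p 0%N (~` N) = 1%E by rewrite probability_setC// N0 sube0.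
        apply: le_measure; rewrite ?inE//; first exact: measurableC.
        move=> x nNx; rewrite (_ : x = point)//.
        by apply: contrapT => h; apply: nNx; exact: sN.
      rewrite /unit_mass/= /dirac indicE memNset//=.
      apply/esym/eqP; rewrite eq_le measure_ge0 andbT.
      apply: (@le_trans _ _ (p 0%N N)); last by rewrite N0.
      apply: le_measure; rewrite ?inE// => x Bx; apply: sN => /= ex.
      by apply: nBp; rewrite -ex.
    by split; [exact: (e fst (@measurable_fst _ _ _ _))|exact: (e snd (@measurable_snd _ _ _ _))].
  have [h1 h2] := isb_marg (hbe j); have [lm _] := hm j.
  split.
    apply: (hasLaw_factor (lM j) (@measurable_fst _ _ _ _)).
    exact: (hasLaw_comp (hasLaw_prod_map IH1 h1) lm).
  apply: (hasLaw_factor (lM j) (@measurable_snd _ _ _ _)).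
  exact: (hasLaw_comp (hasLaw_prod_map IH2 h2) lm).
exists K; split=> [N|j|j]; [|by have [] := hK j|by have [] := hK j].
split => //.
- move=> j _; have [h1 h2] := isb_marg (hbe j); have [lm em] := hm j.
  have [k1 k2] := hK j.
  unshelve eexists; last by [].
  apply: (@Stepping _ _ _ _ _ _ _ (K j \x be j)%E fst snd (M j)).
  + have -> : (fun w : B2 * B2 => (w.1, w.2)) = id by apply/funext => -[].
    exact: hasLaw_id.
  + exact: lM.
  + have e1 := hasLaw_ae (hasLaw_prod_map k1 h1) em.
    have e2 := hasLaw_ae (hasLaw_prod_map k2 h2) em.
    by apply: aeS2 e1 e2.
- by move=> j _; have [h1 h2] := hK j; exact: marg_carried h1 h2 (cp j).
- by move=> j _; have [h1 h2] := isb_marg (hbe j); exact: marg_carried h1 h2 (cal j).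
Qed.

End general.

(** Both paths coincide. This chain is the limit in [energy_avoid], whose block lengths need not be
    dyadic. *)
Lemma diag_chain (K be : nat -> probability B2 R) :
  (forall j, isb true (p j) (K j)) -> (forall j, isb true (al j) (be j)) ->
  forall N, chain q N K be.
Proof.
move=> hK hbe N; split.
- have [h1 h2] := isb_marg (hK 0%N).
  by apply: aeS2 (hasLaw_ae h1 p0) (hasLaw_ae h2 p0) => -[x y] /= -> ->.
- move=> j _; have [m [lm em]] := (is_convP _ _ _).1 (pS j).
  unshelve eexists; last by [].
  apply: (@Stepping _ _ _ _ _ _ _ (p j \x al j)%E (fun w => (w.1, w.1))
    (fun w => (w.2, w.2)) (fun w => (m w, m w))).
  + exact: (hasLaw_prod_map (hK j) (hbe j)).
  + exact: (hasLaw_comp lm (hK j.+1)).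
  + by apply: aeS em.
- by move=> j _; have [h1 h2] := isb_marg (hK j); exact: marg_carried h1 h2 (cp j).
- by move=> j _; have [h1 h2] := isb_marg (hbe j); exact: marg_carried h1 h2 (cal j).
Qed.

End chains.

Section semigroup.
Variable mu : R -> probability (borel G) R.
Hypothesis Hmu : conv_semigroup mu.

Lemma mu0_ae : {ae mu 0, forall x, x = point :> G}.
Proof. by apply: eqm_ae (@unit_mass_ae R G) => B mB; exact: (conv_semigroup0 Hmu). Qed.

(** By [mdist_umull] a factor moves a point by at most the distance of that factor from the unity,
    so the left side is at most the mean of this distance under [mu r]. The distance from the unity
    is itself a 1-Lipschitz test function, with integral 0 under [mu 0]. *)
Lemma KR_semigroup s r : 0 <= s -> 0 <= r -> KR (mu (s + r)) (mu s) <= KR (mu r) (mu 0).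
Proof.
move=> s0 r0; apply: KR_le => phi pl.
have bphi := lip_bmeas ler01 pl.
have [m [lm em]] := (is_convP _ _ _).1 (conv_semigroupD Hmu s0 r0).
have dl : lip dist 1 (dist point).
  by move=> x y; rewrite mul1r !(metric_sym point); exact: mdist_lip.
have bd := lip_bmeas ler01 dl.
apply: le_trans (le_trans (ler_norm _) (KR_ge (mu r) (mu 0) dl)).
rewrite [X in _ <= _ - X](_ : _ = 0) ?subr0; last first.
  rewrite -[RHS](int_cst (mu 0) 0); apply: int_ae => //; first exact: bmeas_cst.
  by apply: aeS mu0_ae => x ->; rewrite mdistxx.
rewrite (hasLaw_int lm bphi) (hasLaw_int (hasLaw_fst (mu s) (mu r)) bphi).
rewrite (hasLaw_int (hasLaw_snd (mu s) (mu r)) bd).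
have b1 := bmeas_comp bphi lm.1.
have b2 := bmeas_comp bphi (@measurable_fst _ _ (borel G) (borel G)).
have b3 := bmeas_comp bd (@measurable_snd _ _ (borel G) (borel G)).
have key : {ae (mu s \x mu r)%E, forall w, `|phi (m w) - phi w.1| <= dist point w.2}.
  apply: aeS em => w /mdist_umull h.
  by rewrite (le_trans (pl _ _))// mul1r metric_sym.
rewrite -intB// ler_norml -intN//; apply/andP; split.
  apply: int_le_ae; [exact: bmeasN|exact: bmeasB|].
  by apply: aeS key => w; rewrite ler_norml => /andP[].
apply: int_le_ae; [exact: bmeasB|by []|].
by apply: aeS key => w; rewrite ler_norml => /andP[].
Qed.

Lemma KR_sym (P Q : probability (borel G) R) : KR P Q = KR Q P.
Proof.
suff h (P' Q' : probability (borel G) R) : KR P' Q' <= KR Q' P' by apply/eqP; rewrite eq_le !h.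
by apply: KR_le => phi pl; rewrite distrC; exact: KR_ge.
Qed.

Lemma KR_semigroup_cvg (s : nat -> R) (t : R) : (forall n, 0 <= s n) -> 0 <= t ->
  s n @[n --> \oo] --> t -> KR (mu (s n)) (mu t) @[n --> \oo] --> (0 : R).
Proof.
move=> s0 t0 st; apply/cvgrPdist_le => e e0.
have : \forall r \near 0^'+, KR (mu r) (mu 0) <= e.
  apply: filterS ((cvgrPdist_le _ _).1 (conv_semigroup_cvg Hmu) _ e0) => r.
  by rewrite sub0r normrN ger0_norm ?KR_ge0.
move=> [eta /= eta0 heta].
have {}heta r : 0 <= r -> r < eta -> KR (mu r) (mu 0) <= e.
  rewrite le_eqVlt => /orP[/eqP <- _|r0 re].
    by apply: KR_le => phi pl; rewrite subrr normr0 ltW.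
  by apply: heta => //=; rewrite sub0r normrN gtr0_norm.
apply: filterS ((cvgrPdist_lt _ _).1 st _ eta0) => n hn.
rewrite sub0r normrN ger0_norm ?KR_ge0//.
have [le|/ltW le] := leP t (s n).
  have h : 0 <= s n - t by rewrite subr_ge0.
  have := KR_semigroup t0 h; rewrite addrC subrK => /le_trans; apply.
  by apply: heta => //; rewrite -[ltLHS]ger0_norm// distrC.
have h : 0 <= t - s n by rewrite subr_ge0.
have := KR_semigroup (s0 n) h; rewrite addrC subrK KR_sym => /le_trans; apply.
by apply: heta => //; rewrite -[ltLHS]ger0_norm.
Qed.

End semigroup.

End block_steps.

(** * Independent sigma-fields *)

Lemma int_indep d (T : measurableType d) (R : realType) (Q : probability T R) (A B : set T) :
  measurable A -> measurable B ->
  \int[Q]_z (\1_A z * \1_B z) = \int[Q]_z \1_A z * \int[Q]_z \1_B z ->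
  Q (A `&` B) = (Q A * Q B)%E.
Proof.
move=> mA mB h; have k C : measurable C -> (fine (Q C))%:E = Q C.
  by move=> mC; rewrite fineK// fin_num_measure.
have mAB := measurableI _ _ mA mB.
rewrite -(k _ mAB) -(k _ mA) -(k _ mB) -EFinM -!int_indic// -h; congr (_ %:E).
by apply: eq_Rintegral => z _; rewrite indicI.
Qed.

Section independence.
Context d (O : measurableType d) (R : realType) (P : probability O R).

Definition indepS (F1 F2 : set (set O)) := forall A B, F1 A -> F2 B ->
  P (A `&` B) = (P A * P B)%E.

Lemma indepS_sub F1 F2 F1' F2' : F1' `<=` F1 -> F2' `<=` F2 -> indepS F1 F2 -> indepS F1' F2'.
Proof. by move=> s1 s2 h A B /s1 FA /s2 FB; exact: h. Qed.

(** The pi-lambda argument for two finite measures: the restriction of [P] to [B], and [P]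
    multiplied by [P B]. *)
Lemma indep_pi (G : set (set O)) B : measurable B -> G `<=` measurable -> setI_closed G ->
  G setT -> (forall A, G A -> P (A `&` B) = (P A * P B)%E) ->
  forall A, <<s G >> A -> P (A `&` B) = (P A * P B)%E.
Proof.
move=> mB mG IG GT h A sA.
have PB0 : 0 <= fine (P B) by rewrite fine_ge0.
pose m1 : {measure set O -> \bar R} := mrestr P mB.
pose m2 : {measure set O -> \bar R} := mscale (NngNum PB0) P.
have e2 C : m2 C = (P C * P B)%E.
  by rewrite /m2/= /mscale/= fineK ?fin_num_measure// muleC.
rewrite -e2; have -> : P (A `&` B) = m1 A by [].
apply: (@g_sigma_algebra_measure_unique _ _ _ G mG (fun=> setT) _ _ m1 m2 IG) => //.
- by rewrite bigcup_const//; exists 0%N.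
- by move=> C GC; rewrite e2 -h.
- by move=> k; rewrite /m1/= /mrestr setTI (le_lt_trans (probability_le1 P mB))// ltry.
Qed.

Lemma indepS_pi G1 G2 : G1 `<=` measurable -> G2 `<=` measurable ->
  setI_closed G1 -> setI_closed G2 -> G1 setT -> G2 setT ->
  indepS G1 G2 -> indepS <<s G1 >> <<s G2 >>.
Proof.
move=> m1 m2 I1 I2 T1 T2 h A B sA sB.
have mA : measurable A by apply: sA; split=> //; exact: sigma_algebra_measurable.
rewrite setIC muleC; apply: (indep_pi mA m2 I2 T2) => // C GC.
have mC := m2 _ GC.
rewrite setIC muleC; apply: (indep_pi mC m1 I1 T1) => // D GD.
exact: h.
Qed.

Section sigma_field_theory.
Hypothesis Pc : measure_is_complete P.
Context d' (T : measurableType d') (I : choiceType) (Y : I -> O -> T).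
Hypothesis mY : forall i, measurable_fun setT (Y i).

(** Finite-dimensional cylinders over [D]: the pi-system from which independence is extended, with
    or without the negligible sets. *)
Definition rects (D : set I) : set (set O) := [set A | exists s : seq I, exists B : I -> set T,
  [/\ forall i, i \in s -> D i, forall i, measurable (B i) &
   A = \bigcap_(i in [set` s]) (Y i @^-1` B i)]].

Lemma rects_measurable D : rects D `<=` measurable.
Proof.
move=> _ [s [B [_ mB ->]]]; apply: fin_bigcap_measurable => // i _.
exact: measurable_preim.
Qed.

Lemma rectsI D : setI_closed (rects D).
Proof.
move=> _ _ [s [B [sD mB ->]]] [s' [B' [sD' mB' ->]]].
exists (s ++ s'), (fun i => (if i \in s then B i else setT) `&` (if i \in s' then B' i else setT)).
split.
- by move=> i; rewrite mem_cat => /orP[/sD|/sD'].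
- by move=> i; apply: measurableI; case: ifP.
- apply/seteqP; split=> [w [h h'] i /=|w h].
    rewrite mem_cat => _; split; case: ifP => // si; [exact: h|exact: h'].
  split=> i /= si; have := h i; rewrite /= mem_cat si ?orbT => /(_ isT) [] //.
Qed.

Lemma rectsT D : rects D setT.
Proof.
exists [::], (fun=> setT); split => //.
by apply/seteqP; split.
Qed.

Let rN D := rects D `|` [set N | P.-negligible N].

Let rN_measurable D : rN D `<=` measurable.
Proof. by move=> A [/rects_measurable|/Pc]. Qed.

Let rNI D : setI_closed (rN D).
Proof.
move=> A B [rA|nA] [rB|nB].
- by left; exact: rectsI.
- by right; apply: negligibleS nB => x [].
- by right; apply: negligibleS nA => x [].
- by right; apply: negligibleS nA => x [].
Qed.

Let sub_rN D : sigma_field P Y D `<=` <<s rN D >>.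
Proof.
apply: smallest_sub; first exact: smallest_sigma_algebra.
move=> A [[i Di [B mB <-]]|nA]; apply: sub_sigma_algebra; last by right.
left; exists [:: i], (fun j => if j == i then B else setT); split.
- by move=> j; rewrite inE => /eqP ->.
- by move=> j; case: ifP.
- rewrite setTI; apply/seteqP; split=> [w /= h j|w h].
    by rewrite /= inE => /eqP ->; rewrite eqxx.
  by have := h i; rewrite /= inE eqxx => /(_ isT).
Qed.

Lemma sigma_field_indep D1 D2 :
  (forall (s1 s2 : seq I) (B1 B2 : I -> set T), (forall i, i \in s1 -> D1 i) ->
    (forall i, i \in s2 -> D2 i) -> (forall i, measurable (B1 i)) -> (forall i, measurable (B2 i)) ->
    P (\bigcap_(i in [set` s1]) (Y i @^-1` B1 i) `&` \bigcap_(i in [set` s2]) (Y i @^-1` B2 i)) =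
    (P (\bigcap_(i in [set` s1]) (Y i @^-1` B1 i)) * P (\bigcap_(i in [set` s2]) (Y i @^-1` B2 i)))%E) ->
  indepS (sigma_field P Y D1) (sigma_field P Y D2).
Proof.
move=> h; apply: (indepS_sub (@sub_rN D1) (@sub_rN D2)).
apply: indepS_pi => //; try exact: rN_measurable; try exact: rNI; try (by left; exact: rectsT).
have n0 N : P.-negligible N -> P N = 0%E by move=> nN; apply: measure_negligible => //; exact: Pc.
move=> A B [[s1 [B1 [sD mB ->]]]|nA] [[s2 [B2 [sD' mB' ->]]]|nB].
- exact: h.
- by rewrite (n0 _ nB) mule0 n0//; apply: negligibleS nB => x [].
- by rewrite (n0 _ nA) mul0e n0//; apply: negligibleS nA => x [].
- by rewrite (n0 _ nA) mul0e n0//; apply: negligibleS nA => x [].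
Qed.

Lemma mutual_rects D1 D2 : mutually_independent P Y -> D1 `&` D2 = set0 ->
  indepS (rects D1) (rects D2).
Proof.
move=> mi D12 _ _ [s1 [B1 [sD1 mB1 ->]]] [s2 [B2 [sD2 mB2 ->]]].
(* [mutually_independent] speaks of lists without repetition, whereas a cylinder may list an index
   twice. *)
have und (s : seq I) : [set` s] = [set` undup s].
  by apply/seteqP; split=> i /=; rewrite mem_undup.
rewrite (und s1) (und s2).
have s12 i : i \in undup s1 -> i \in undup s2 = false.
  rewrite !mem_undup => /sD1 D1i; apply/negP => /sD2 D2i.
  by have : (D1 `&` D2) i by []; rewrite D12.
pose B i := if i \in undup s1 then B1 i else B2 i.
have u12 : uniq (undup s1 ++ undup s2).
  rewrite cat_uniq !undup_uniq/= andbT; apply/hasPn => i; apply: contraTN => /s12.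
  by move=> /= ->.
transitivity (P (\bigcap_(i in [set` undup s1 ++ undup s2]) (Y i @^-1` B i))).
  congr (P _); apply/seteqP; split=> [w [h h'] i /=|w h].
    rewrite mem_cat /B => /orP[i1|i2]; first by rewrite i1; exact: h.
    by case: ifP => [i1|_]; [exact: h|exact: h'].
  split=> i /= si; have := h i; rewrite /= mem_cat si ?orbT => /(_ isT); rewrite /B.
    by rewrite si.
  by case: ifP => // /s12; rewrite si.
rewrite mi//; last by move=> i; rewrite /B; case: ifP.
rewrite big_cat/= !mi ?undup_uniq//; congr (_ * _)%E.
  by rewrite !big_seq; apply: eq_bigr => i si; rewrite /B si.
by rewrite !big_seq; apply: eq_bigr => i si; rewrite /B; case: ifP => // /s12; rewrite si.
Qed.

Lemma mutual_indep_rects D1 D2 : mutually_independent P Y -> D1 `&` D2 = set0 ->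
  indepS <<s rects D1 >> <<s rects D2 >>.
Proof.
move=> mi D12; apply: indepS_pi; try exact: rects_measurable; try exact: rectsI; try exact: rectsT.
exact: mutual_rects.
Qed.

Lemma mutual_indepS D1 D2 : mutually_independent P Y -> D1 `&` D2 = set0 ->
  indepS (sigma_field P Y D1) (sigma_field P Y D2).
Proof.
move=> mi D12; apply: sigma_field_indep => s1 s2 B1 B2 sD1 sD2 mB1 mB2.
by apply: (mutual_rects mi D12); [exists s1, B1|exists s2, B2].
Qed.

Lemma rects_sub_sigma_field D : rects D `<=` sigma_field P Y D.
Proof.
move=> _ [s [B [sD mB ->]]].
have h : measurable (\bigcap_(i in [set` s]) (Y i @^-1` B i) :
    set (g_sigma_algebraType (\bigcup_(i in D) preimage_set_system setT (Y i) measurable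
      `|` [set N | P.-negligible N]))).
  apply: fin_bigcap_measurable => // i /= si; apply: sub_sigma_algebra; left.
  by exists i; [exact: sD|exists (B i) => //; rewrite setTI].
exact: h.
Qed.

Lemma rects_preim D i B : D i -> measurable B -> rects D (Y i @^-1` B).
Proof.
move=> Di mB; exists [:: i], (fun j => if j == i then B else setT); split.
- by move=> j; rewrite inE => /eqP ->.
- by move=> j; case: ifP.
- apply/seteqP; split=> [w /= h j|w h].
    by rewrite /= inE => /eqP ->; rewrite eqxx.
  by have := h i; rewrite /= inE eqxx => /(_ isT).
Qed.

Lemma rects_meas D i : D i -> measurable_fun setT (Y i : g_sigma_algebraType (rects D) -> T).
Proof.
by move=> Di _ B mB; rewrite setTI; apply: sub_sigma_algebra; exact: rects_preim.
Qed.

End sigma_field_theory.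

Record subsig (F : set (set O)) : Prop := {
  subsig_sa : sigma_algebra setT F ;
  subsig_m : F `<=` measurable ;
  subsig_N : [set N | P.-negligible N] `<=` F }.

Lemma sigma_field_subsig d' (T : measurableType d') (I : Type) (Y : I -> O -> T) (D : set I) :
  measure_is_complete P -> (forall i, measurable_fun setT (Y i)) -> subsig (sigma_field P Y D).
Proof.
move=> Pc mY; split.
- exact: smallest_sigma_algebra.
- apply: smallest_sub; first exact: sigma_algebra_measurable.
  move=> A [[i Di [B mB <-]]|nA]; last exact: Pc.
  by rewrite setTI; exact: measurable_preim.
- by move=> N nN; apply: sub_sigma_algebra; right.
Qed.

Lemma sigma_field_preim d' (T : measurableType d') (I : Type) (Y : I -> O -> T) (D : set I) i B :
  D i -> measurable B -> sigma_field P Y D (Y i @^-1` B).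
Proof.
by move=> Di mB; apply: sub_sigma_algebra; left; exists i => //; exists B => //; rewrite setTI.
Qed.

Lemma sigma_field_min d' (T : measurableType d') (I : Type) (Y : I -> O -> T) (D : set I) F :
  subsig F -> (forall i B, D i -> measurable B -> F (Y i @^-1` B)) -> sigma_field P Y D `<=` F.
Proof.
move=> sF h; apply: smallest_sub; first exact: subsig_sa.
move=> A [[i Di [B mB <-]]|nA]; first by rewrite setTI; exact: h.
exact: subsig_N.
Qed.

Lemma sigma_field_mono d' (T : measurableType d') (I : Type) (Y : I -> O -> T) (D D' : set I) :
  D `<=` D' -> sigma_field P Y D `<=` sigma_field P Y D'.
Proof.
move=> DD; apply: sub_smallest2r; first exact: smallest_sigma_algebra.
by move=> A [[i Di h]|nA]; [left; exists i => //; exact: DD|right].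
Qed.

Section subsig_theory.
Variable F : set (set O).
Hypothesis sF : subsig F.

Definition measF d' (T : measurableType d') (Z : O -> T) := forall B, measurable B -> F (Z @^-1` B).

Lemma subsigE : <<s F >> = F.
Proof.
apply/seteqP; split; last exact: sub_sigma_algebra.
by apply: smallest_sub => //; exact: (subsig_sa sF).
Qed.

Lemma measFP d' (T : measurableType d') (Z : O -> T) :
  measF Z <-> measurable_fun setT (Z : g_sigma_algebraType F -> T).
Proof.
split=> [h _ B mB|h B mB].
  by rewrite setTI; apply: sub_sigma_algebra; exact: h.
by rewrite -subsigE -[X in <<s _>> X]setTI; exact: h.
Qed.

(** This rests on [F] containing all negligible sets: [Z] and [Z'] differ on a subset of a null
    set. *)
Lemma measF_ae d' (T : measurableType d') (Z Z' : O -> T) : measF Z ->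
  {ae P, forall w, Z w = Z' w} -> measF Z'.
Proof.
move=> h [N [mN N0 sN]] B mB.
have nN : P.-negligible N by apply/negligibleP.
have FN := subsig_N sF nN.
have FD : F ((Z' @^-1` B) `&` N) by apply: (subsig_N sF); apply: negligibleS nN => x [].
have mE : measurable (((Z @^-1` B) `\` N) `|` ((Z' @^-1` B) `&` N) : set (g_sigma_algebraType F)).
  apply: measurableU; last exact: sub_sigma_algebra.
  by apply: measurableD; apply: sub_sigma_algebra => //; exact: h.
rewrite (_ : Z' @^-1` B = ((Z @^-1` B) `\` N) `|` ((Z' @^-1` B) `&` N)).
  by rewrite -subsigE.
have e w : ~ N w -> Z w = Z' w by move=> nNw; apply: contrapT => ne; apply/nNw/sN.
apply/seteqP; split=> w /=.
  move=> Bw; have [Nw|nNw] := pselect (N w); [by right|left].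
  by rewrite e.
by move=> [[Bw /e <-]|[]].
Qed.

Lemma subsig_law : exists PF : probability (g_sigma_algebraType F) R,
  hasLaw P (id : O -> g_sigma_algebraType F) PF.
Proof.
apply: hasLaw_ex => _ B mB; rewrite setTI; apply: (subsig_m sF).
by rewrite -subsigE.
Qed.

End subsig_theory.

Lemma gsT_law (G : set (set O)) : G `<=` measurable ->
  exists PF : probability (g_sigma_algebraType G) R, hasLaw P (id : O -> g_sigma_algebraType G) PF.
Proof.
move=> mG; apply: hasLaw_ex => _ B mB; rewrite setTI.
by apply: mB; split=> //; exact: sigma_algebra_measurable.
Qed.

(* Freezing: an argument measurable with respect to one of two independent sigma-fields may be
   replaced by an independent copy of itself. *)
Lemma freeze (G1 G2 : set (set O)) (h : O -> O -> R) :
  G1 `<=` measurable -> G2 `<=` measurable -> indepS <<s G1 >> <<s G2 >> ->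
  bmeas ((fun z => h z.1 z.2) : (g_sigma_algebraType G1 * g_sigma_algebraType G2)%type -> R) ->
  \int[P]_w h w w = \int[P]_w \int[P]_w' h w w'.
Proof.
move=> s1 s2 ind bh.
have [P1 l1] := gsT_law s1; have [P2 l2] := gsT_law s2.
have l12 : hasLaw P (fun w => (w : g_sigma_algebraType G1, w : g_sigma_algebraType G2)) (P1 \x P2)%E.
  apply: (hasLaw_pair l1.1 l2.1) => A B mA mB.
  by rewrite -l1.2// -l2.2//; exact: ind.
have := hasLaw_int l12 bh; rewrite /= => <-.
rewrite fubini_int//= (hasLaw_int l1); last exact: fubini_bmeas bh.
apply: eq_Rintegral => w _; rewrite (hasLaw_int l2)//.
exact: (bmeas_comp bh (@pair1_measurable _ _ (g_sigma_algebraType G1) (g_sigma_algebraType G2) w)).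
Qed.

Lemma indepS_int (G1 G2 : set (set O)) (a b : O -> R) :
  G1 `<=` measurable -> G2 `<=` measurable -> indepS <<s G1 >> <<s G2 >> ->
  bmeas (a : g_sigma_algebraType G1 -> R) -> bmeas (b : g_sigma_algebraType G2 -> R) ->
  \int[P]_w (a w * b w) = \int[P]_w a w * \int[P]_w b w.
Proof.
move=> s1 s2 ind ba bb; rewrite (freeze (h := fun w w' => a w * b w') s1 s2 ind); last first.
  by apply: bmeasM; [exact: (bmeas_comp ba (@measurable_fst _ _ _ _))|exact: (bmeas_comp bb (@measurable_snd _ _ _ _))].
have [P1 l1] := gsT_law s1; have [P2 l2] := gsT_law s2.
have bb' := bmeas_comp bb l2.1; have ba' := bmeas_comp ba l1.1.
under eq_Rintegral do rewrite (intZ P _ bb').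
by rewrite mulrC -intZ//; apply: eq_Rintegral => w _; rewrite mulrC.
Qed.

(* The two-copy version: functions of (w, w') that are measurable with respect to the past (in both
   coordinates) and to the future (in both coordinates) are independent under P x P. *)
Lemma dbl_indep (G1 G2 : set (set O)) d1 (T1 : measurableType d1) d2 (T2 : measurableType d2)
    (Phi : O * O -> T1) (Psi : O * O -> T2) (l1 : probability T1 R) (l2 : probability T2 R) :
  G1 `<=` measurable -> G2 `<=` measurable -> indepS <<s G1 >> <<s G2 >> ->
  measurable_fun setT (Phi : g_sigma_algebraType G1 * g_sigma_algebraType G1 -> T1) ->
  measurable_fun setT (Psi : g_sigma_algebraType G2 * g_sigma_algebraType G2 -> T2) ->
  hasLaw (P \x P)%E Phi l1 -> hasLaw (P \x P)%E Psi l2 ->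
  hasLaw (P \x P)%E (fun w => (Phi w, Psi w)) (l1 \x l2)%E.
Proof.
move=> s1 s2 ind mPhi mPsi [mPhi' h1] [mPsi' h2]; apply: hasLaw_pair => // A B mA mB.
rewrite -h1// -h2//.
have mA' := measurable_preim mPhi' mA; have mB' := measurable_preim mPsi' mB.
set A' := Phi @^-1` A in mA' *; set B' := Psi @^-1` B in mB' *.
have [P1 k1] := gsT_law s1; have [P2 k2] := gsT_law s2.
have bA : bmeas (\1_A' : g_sigma_algebraType G1 * g_sigma_algebraType G1 -> R).
  by apply: bmeas_indic; exact: measurable_preim mPhi mA.
have bB : bmeas (\1_B' : g_sigma_algebraType G2 * g_sigma_algebraType G2 -> R).
  by apply: bmeas_indic; exact: measurable_preim mPsi mB.
have bA0 := bmeas_indic R mA'; have bB0 := bmeas_indic R mB'.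
apply: (@int_indep _ _ _ (P \x P)%E) => //.
have bAB : bmeas (fun z => \1_A' z * \1_B' z : R) by exact: bmeasM.
rewrite !fubini_int//.
have ba : bmeas ((fun w => \int[P]_w' \1_A' (w, w')) : g_sigma_algebraType G1 -> R).
  rewrite (_ : (fun w => _) = fun w => \int[P1]_w' \1_A' (w, w')); first exact: (fubini_bmeas P1 P1 bA).
  apply/funext => w; rewrite (hasLaw_int k1)//.
  exact: (bmeas_comp bA (@pair1_measurable _ _ (g_sigma_algebraType G1) (g_sigma_algebraType G1) w)).
have bb : bmeas ((fun w => \int[P]_w' \1_B' (w, w')) : g_sigma_algebraType G2 -> R).
  rewrite (_ : (fun w => _) = fun w => \int[P2]_w' \1_B' (w, w')); first exact: (fubini_bmeas P2 P2 bB).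
  apply/funext => w; rewrite (hasLaw_int k2)//.
  exact: (bmeas_comp bB (@pair1_measurable _ _ (g_sigma_algebraType G2) (g_sigma_algebraType G2) w)).
rewrite -(indepS_int s1 s2 ind ba bb); apply: eq_Rintegral => w _.
apply: (indepS_int s1 s2 ind).
  exact: (bmeas_comp bA (@pair1_measurable _ _ (g_sigma_algebraType G1) (g_sigma_algebraType G1) w)).
exact: (bmeas_comp bB (@pair1_measurable _ _ (g_sigma_algebraType G2) (g_sigma_algebraType G2) w)).
Qed.

End independence.

(** * Conditional expectation *)

Section conditional_expectation.
Context d (O : measurableType d) (R : realType) (P : probability O R).
Variable F : set (set O).
Hypothesis sF : subsig P F.
Local Notation OF := (g_sigma_algebraType F).

(** For bounded [Y] there is a bounded version of the conditional expectation; asking for one makes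
    all integrals real numbers. [is_ce_cond_exp] returns to [is_cond_exp]. *)
Definition is_ce (Y Z : O -> R) := [/\ measF F Z, bmeas Z &
  forall A, F A -> \int[P]_w (\1_A w * Z w) = \int[P]_w (\1_A w * Y w)].

Let int_set (A : set O) (f : O -> R) : measurable A -> bmeas f ->
  (\int[P]_(w in A) (f w)%:E = (\int[P]_w (\1_A w * f w))%:E)%E.
Proof.
move=> mA bf; rewrite -intE; last by apply: bmeasM => //; exact: bmeas_indic.
rewrite [LHS]integral_mkcond; apply: eq_integral => w _.
rewrite patchE indicE; case: (w \in A); by rewrite ?mul1r ?mul0r.
Qed.

Lemma is_ce_cond_exp Y Z : bmeas Y -> is_ce Y Z -> is_cond_exp P F Y Z.
Proof.
move=> bY [mZ bZ h]; split.
- by move=> _ [B mB <-]; rewrite setTI; exact: mZ.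
- exact: bmeas_int.
- move=> A FA; have mA := subsig_m sF FA.
  by rewrite !int_set// h.
Qed.

(** Both versions are measurable for [F] and have equal integrals over its sets; on [F] with the
    restriction [PF] of [P] this forces almost sure equality, by [integral_ae_eq]. *)
Lemma cond_exp_uniq Y Z Z' : is_cond_exp P F Y Z -> is_cond_exp P F Y Z' ->
  {ae P, forall w, Z w = Z' w}.
Proof.
move=> [mZ iZ hZ] [mZ' iZ' hZ'].
have [PF l] := subsig_law sF.
have mF (f : O -> R) : preimage_set_system setT f measurable `<=` F -> measurable_fun setT (f : OF -> R).
  move=> h _ B mB; rewrite setTI; apply: sub_sigma_algebra; apply: h.
  by exists B => //; rewrite setTI.
have intF (f : O -> R) : measurable_fun setT (f : OF -> R) ->
    P.-integrable setT (EFin \o f) ->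
    PF.-integrable setT (EFin \o (f : OF -> R)) /\
    forall A, measurable (A : set OF) -> (\int[PF]_(w in A) (f w)%:E = \int[P]_(w in A) (f w)%:E)%E.
  move=> mf if_.
  pose X : {mfun O >-> OF} := mfun_Sub (mem_set l.1).
  have e : forall B, measurable B -> PF B = pushforward P X B by move=> B mB; exact/esym/l.2.
  have mef : measurable_fun setT ((EFin \o f) : OF -> \bar R) by exact/measurable_EFinP.
  have ip : (pushforward P X).-integrable setT ((EFin \o f) : OF -> \bar R).
    exact: (integrable_pushforward (phi := X)).
  split.
    move/integrableP : ip => [_ ip]; apply/integrableP; split => //.
    rewrite (_ : (\int[PF]_x _ = \int[pushforward P X]_x `|(EFin \o f) x|)%E)//.
    by apply: eq_measure_integral => A mA _; exact: e.
  move=> A mA; transitivity (\int[pushforward P X]_(w in A) (EFin \o f) w)%E.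
    by apply: eq_measure_integral => B mB _; exact: e.
  rewrite [LHS]integral_mkcond.
  rewrite [in RHS]integral_mkcond.
  have ipA : P.-integrable setT ((((EFin \o f) : OF -> \bar R) \_ A) \o X).
    rewrite (_ : _ \o X = ((EFin \o f) \_ A)); last by [].
    apply/(integrable_mkcond _ _).1 => //.
      by apply: (subsig_m sF); rewrite -(subsigE sF).
    apply: integrableS if_ => //.
    by apply: (subsig_m sF); rewrite -(subsigE sF).
  rewrite integral_pushforward//.
  by apply/(measurable_restrictT _ mA); exact: measurable_funTS.
have [iPF e1] := intF _ (mF _ mZ) iZ; have [iPF' e2] := intF _ (mF _ mZ') iZ'.
have h : ae_eq PF setT ((EFin \o Z) : OF -> \bar R) (EFin \o Z').
  apply: integral_ae_eq => //; first exact: measurable_int iPF'.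
  move=> E _ mE; rewrite /= e1// e2//.
  have FE : F E by rewrite -(subsigE sF).
  by rewrite hZ// hZ'.
have := hasLaw_ae l h; apply: filterS => w /= /(_ I) [].
exact.
Qed.

(** [cond_exp] picks an unspecified version; by almost sure uniqueness its energy is that of any
    bounded version [Z]. *)
Lemma cond_energyE Y Z : bmeas Y -> is_ce Y Z -> cond_energy P F Y = (\int[P]_w (Z w) ^+ 2)%:E.
Proof.
move=> bY cZ; have iZ := is_ce_cond_exp bY cZ; have [_ bZ _] := cZ.
have iC : is_cond_exp P F Y (cond_exp P F Y) by rewrite /cond_exp; apply: xgetPex; exists Z.
have mC : measurable_fun setT (cond_exp P F Y).
  by move=> _ B mB; rewrite setTI; apply: (subsig_m sF); case: iC => h _ _; apply: h; exists B; rewrite ?setTI.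
have bZ2 : bmeas (fun w => Z w ^+ 2) by apply: (bmeasM bZ bZ).
rewrite -intE// /cond_energy unlock; apply: ae_eq_integral => //.
- apply/measurable_EFinP; apply: (measurable_funX 2).
  by apply: measurableT_comp.
- by apply/measurable_EFinP; exact: bZ2.1.
- by apply: aeS (cond_exp_uniq iC iZ) => w -> _; rewrite real_normK ?num_real.
Qed.

Lemma int_sum K (g : 'I_K -> O -> R) : (forall k, bmeas (g k)) ->
  bmeas (fun w => \sum_(k < K) g k w) /\
  \int[P]_w (\sum_(k < K) g k w) = \sum_(k < K) \int[P]_w g k w.
Proof.
elim: K g => [|K IH] g bg.
  have -> : (fun w => \sum_(k < 0) g k w) = (fun=> 0).
    by apply/funext => w; rewrite big_ord0.
  by rewrite big_ord0 int_cst; split => //; exact: bmeas_cst.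
have [b1 e1] := IH (fun k => g (widen_ord (leqnSn K) k)) (fun k => bg _).
have -> : (fun w => \sum_(k < K.+1) g k w) =
    (fun w => \sum_(k < K) g (widen_ord (leqnSn K) k) w + g ord_max w).
  by apply/funext => w; rewrite big_ord_recr.
split; first exact: bmeasD.
by rewrite intD// e1 big_ord_recr.
Qed.

Lemma is_ce_test Y Z W : bmeas Y -> is_ce Y Z -> measF F W -> bmeas W ->
  \int[P]_w (W w * Z w) = \int[P]_w (W w * Y w).
Proof.
move=> bY [mZ bZ hZ] mW bW.
pose D w := Z w - Y w; have bD : bmeas D by exact: bmeasB.
have hD A : F A -> \int[P]_w (\1_A w * D w) = 0.
  move=> FA; have bA := bmeas_indic R (subsig_m sF FA).
  transitivity (\int[P]_w (\1_A w * Z w - \1_A w * Y w)).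
    by apply: eq_Rintegral => w _; rewrite mulrBr.
  by rewrite intB ?hZ ?subrr//; exact: bmeasM.
have FT : F setT by rewrite -(subsigE sF); exact: (@measurableT _ OF).
have iD : \int[P]_w D w = 0.
  rewrite -[RHS](hD _ FT); apply: eq_Rintegral => w _.
  by rewrite indicT mul1r.
suff h : \int[P]_w (W w * D w) = 0.
  apply/eqP; rewrite -subr_eq0 -intB; [|exact: bmeasM|exact: bmeasM].
  by rewrite -[X in _ == X]h; apply/eqP/eq_Rintegral => w _; rewrite mulrBr.
have [N WN] := bW.2; have [C DC] := bD.2.
have N0 : 0 <= N := le_trans (normr_ge0 _) (WN point).
have C0 : 0 <= C := le_trans (normr_ge0 _) (DC point).
pose V w := W w + N.
have V0 w : 0 <= V w by have := WN w; rewrite ler_norml /V => /andP[h _]; lra.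
have V2 w : V w <= 2 * N by have := WN w; rewrite ler_norml /V => /andP[_ h]; lra.
have bV : bmeas V by apply: bmeasD => //; exact: bmeas_cst.
suff h : \int[P]_w (V w * D w) = 0.
  transitivity (\int[P]_w (V w * D w - N * D w)).
    by apply: eq_Rintegral => w _; rewrite /V mulrDl addrK.
  by rewrite intB ?h ?intZ ?iD ?mulr0 ?subrr//; [exact: bmeasM|exact: bmeasZ].
(* [V] is approximated by the step function equal to [k / n.+1] on [A k], for which the integral
   against [D] vanishes; the error is at most [1 / n.+1] times the bound [C] of [D]. *)
have step (n : nat) : `|\int[P]_w (V w * D w)| <= n.+1%:R^-1 * C.
  have n0 : 0 < n.+1%:R :> R by [].
  pose K := (Num.trunc (n.+1%:R * (2 * N))).+1.
  pose A (k : 'I_K) := V @^-1` `[k%:R / n.+1%:R, k.+1%:R / n.+1%:R[%classic.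
  have FA k : F (A k).
    rewrite (_ : A k = W @^-1` `[k%:R / n.+1%:R - N, k.+1%:R / n.+1%:R - N[%classic).
      exact: mW.
    by apply/seteqP; split=> w /=; rewrite /A/= /V !in_itv/= lerBlDr ltrBrDr.
  pose g (k : 'I_K) w := k%:R / n.+1%:R * (\1_(A k) w * D w).
  have bg k : bmeas (g k).
    by apply: bmeasZ; apply: bmeasM => //; apply: bmeas_indic; exact: (subsig_m sF).
  have [bs es] := int_sum bg.
  have es0 : \int[P]_w (\sum_(k < K) g k w) = 0.
    rewrite es big1// => k _; rewrite /g intZ ?hD ?mulr0//.
    by apply: bmeasM => //; apply: bmeas_indic; exact: (subsig_m sF).
  rewrite -[X in `|X|]subr0 -es0; apply: int_dist => //; first exact: bmeasM.
  move=> w; pose k0 := Num.trunc (n.+1%:R * V w).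
  have /trunc_itv/andP[t1 t2] : 0 <= n.+1%:R * V w by rewrite mulr_ge0.
  have k0K : (k0 < K)%N.
    by rewrite ltnS; apply: le_truncn; rewrite ler_wpM2l.
  have inA (k : 'I_K) : (w \in A k) = (k == k0 :> nat).
    rewrite (_ : (w \in A k) = (k%:R / n.+1%:R <= V w < k.+1%:R / n.+1%:R)); last first.
      by apply/idP/idP => [|h]; rewrite inE /A/= in_itv.
    rewrite ler_pdivrMr// ltr_pdivlMr// mulrC.
    apply/idP/eqP => [/andP[h1 h2]|-> ]; last by apply/andP.
    apply/eqP; rewrite eqn_leq; apply/andP; split.
      by rewrite -ltnS -(ltr_nat R) (le_lt_trans h1).
    by rewrite -ltnS -(ltr_nat R) (le_lt_trans t1).
  rewrite (bigD1 (Ordinal k0K))//= big1 ?addr0; last first.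
    move=> k kk0; rewrite /g indicE inA (_ : _ == _ = false) ?mul0r ?mulr0//.
    by apply: contra_neqF kk0 => /eqP e; apply: val_inj.
  rewrite /g indicE inA eqxx mul1r -mulrBl normrM.
  apply: ler_pM => //; rewrite ger0_norm.
    rewrite -(ler_pM2r n0) mulVf ?gt_eqF// mulrBl divfK ?gt_eqF// mulrC lerBlDl.
    by rewrite natr1; exact: (ltW t2).
  by rewrite subr_ge0 ler_pdivrMr// mulrC.
apply/eqP; rewrite -normr_eq0 eq_le normr_ge0 andbT.
apply/ler_addgt0Pr => e e0; rewrite add0r.
have C1 : 0 < C + 1 by rewrite ltr_wpDl.
have [n ne] := invS_lt (divr_gt0 e0 C1).
rewrite (le_trans (step n))// (@le_trans _ _ (e / (C + 1) * C))//.
  by rewrite ler_wpM2r// ltW.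
by rewrite -mulrA -[leRHS]mulr1 ler_wpM2l ?(ltW e0)// mulrC ler_pdivrMr// mul1r lerDl.
Qed.

End conditional_expectation.

Lemma ae_le_of_int d (T : measurableType d) (R : realType) (Q : probability T R) (g : T -> R) M :
  Q.-integrable setT (EFin \o g) ->
  (forall A, measurable A -> (\int[Q]_(w in A) (g w)%:E <= M%:E * Q A)%E) ->
  {ae Q, forall w, g w <= M}.
Proof.
move=> ig h.
have mg : measurable_fun setT g by apply/measurable_EFinP; exact: measurable_int ig.
pose A := g @^-1` `]M, +oo[%classic.
have mA : measurable A by exact: measurable_preim.
have iM : Q.-integrable setT (EFin \o cst M) by exact: (bmeas_int Q (bmeas_cst T M)).
have igA := integrableS measurableT mA (@subsetT _ _) ig.
have iMA := integrableS measurableT mA (@subsetT _ _) iM.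
have e : (\int[Q]_(w in A) `|(g w)%:E - M%:E| = 0)%E.
  apply/eqP; rewrite eq_le integral_ge0 ?andbT//.
  rewrite (_ : (\int[Q]_(w in A) _)%E = (\int[Q]_(w in A) ((g w)%:E - M%:E))%E); last first.
    apply: eq_integral => w; rewrite inE /A/= in_itv/= andbT => Mg.
    by rewrite -EFinB /= ger0_norm// subr_ge0 ltW.
  rewrite (integralB mA igA iMA) /= integral_cst//.
  by rewrite leeBlDr ?add0e ?h// fin_numM// fin_num_measure.
have mgM : measurable_fun A (fun w => (g w)%:E - M%:E)%E.
  apply: measurable_funTS; apply: emeasurable_funB => //; first exact/measurable_EFinP.
have := (ae_eq_integral_abs Q mA mgM).1 e; apply: filterS => w.
rewrite /= /A/= in_itv/= andbT => hw; rewrite leNgt; apply/negP => Mg.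
have := hw Mg; rewrite -EFinB => -[/eqP]; rewrite subr_eq0 => /eqP gM.
by rewrite gM ltxx in Mg.
Qed.

Section conditional_expectation_existence.
Context d (O : measurableType d) (R : realType) (P : probability O R).
Variable F : set (set O).
Hypothesis sF : subsig P F.
Local Notation OF := (g_sigma_algebraType F).
Variable Y : O -> R.
Hypothesis bY : bmeas Y.

Let subm (A : set OF) : measurable A -> measurable (A : set O).
Proof. by move=> mA; apply: (subsig_m sF); rewrite -(subsigE sF). Qed.

(** The signed measure with density [Y] on the sub-sigma-field; its Radon-Nikodym derivative is the
    conditional expectation. *)
Definition density_charge (A : set OF) : \bar R := induced_charge (bmeas_int P bY) (A : set O).

Let dc0 : density_charge set0 = 0%E.
Proof. by rewrite /density_charge charge0. Qed.

Let dcfin A : measurable A -> density_charge A \is a fin_num.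
Proof.
by move=> /subm mA; rewrite /density_charge; apply: fin_num_measure.
Qed.

Let dcsig : semi_sigma_additive density_charge.
Proof.
move=> /= E mE tE mUE.
exact: (charge_semi_sigma_additive (s := induced_charge (bmeas_int P bY)) E (fun i => subm (mE i)) tE (subm mUE)).
Qed.

HB.instance Definition _ := isCharge.Build _ OF R density_charge dc0 dcfin dcsig.

Lemma ce_exists : exists Z, is_ce P F Y Z.
Proof.
have [M YM] := bY.2; have [PF l] := subsig_law sF.
have dE A : measurable (A : set OF) -> density_charge A = (\int[P]_w (\1_A w * Y w))%:E.
  move=> /subm mA; rewrite -intE; last by apply: bmeasM => //; exact: bmeas_indic.
  rewrite /density_charge /induced_charge integral_mkcond; apply: eq_integral => w _.
  rewrite patchE indicE; case: (w \in A); by rewrite ?mul1r ?mul0r.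
have dle A : measurable (A : set OF) -> `|\int[P]_w (\1_A w * Y w)| <= M * fine (PF A).
  move=> mA; have mA' := subm mA; have bA := bmeas_indic R mA'.
  have -> : PF A = P (id @^-1` A) by rewrite l.2.
  rewrite preimage_id -int_indic// -intZ//.
  have b1 : bmeas (fun w : O => \1_(A : set O) w * Y w) by exact: (bmeasM bA bY).
  have b2 : bmeas (fun w : O => M * (\1_(A : set O) w : R)) by exact: (bmeasZ M bA).
  have k w : `|\1_A w * Y w| <= M * \1_A w.
    by rewrite normrM mulrC indicE; case: (w \in A); rewrite ?normr1 ?normr0 ?mulr1 ?mulr0.
  rewrite ler_norml -intN//; apply/andP; split; apply: int_le => //.
  - exact: bmeasN.
  - by move=> w; have := k w; rewrite ler_norml => /andP[].
  - by move=> w; have := k w; rewrite ler_norml => /andP[].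
have dom : density_charge `<< PF.
  apply/null_content_dominatesP => /= A mA A0; rewrite dE//.
  by have := dle A mA; rewrite A0/= mulr0 normr_le0 => /eqP ->.
pose f := Radon_Nikodym density_charge PF.
have ffin x : f x \is a fin_num by exact: Radon_Nikodym_fin_num.
have fi : PF.-integrable setT f by exact: Radon_Nikodym_integrable.
have fE A : measurable A -> density_charge A = (\int[PF]_(x in A) f x)%E.
  exact: Radon_Nikodym_integral.
pose g (x : OF) : R := fine (f x).
have gf : EFin \o g = f by apply/funext => x; rewrite /= fineK.
have gi : PF.-integrable setT (EFin \o g) by rewrite gf.
have M0 : 0 <= M := le_trans (normr_ge0 _) (YM point).
have u : {ae PF, forall w, g w <= M}.
  apply: ae_le_of_int gi _ => A mA.
  rewrite (_ : (\int[PF]_(w in A) (g w)%:E)%E = (\int[PF]_(w in A) f w)%E); last first.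
    by apply: eq_integral => w _; rewrite -gf.
  rewrite -fE// dE// -[PF A]fineK ?fin_num_measure// -EFinM lee_fin.
  by rewrite (le_trans (ler_norm _))// dle.
have lo : {ae PF, forall w, - g w <= M}.
  apply: ae_le_of_int => [|A mA].
    by rewrite (_ : EFin \o _ = (\- (EFin \o g))%E)//; exact: integrableN.
  rewrite (_ : (\int[PF]_(w in A) (- g w)%:E)%E = (- \int[PF]_(w in A) f w)%E); last first.
    rewrite -integralN; first by apply: eq_integral => w _; rewrite -gf.
    apply: fin_num_adde_defl; rewrite fin_numN; apply: integrable_fin_num => //.
    by apply: integrable_funeneg => //; exact: (integrableS measurableT mA (@subsetT _ _) fi).
  rewrite -fE// dE// -[PF A]fineK ?fin_num_measure// -EFinM -EFinN lee_fin.
  by rewrite (le_trans (ler_norm _))// normrN dle.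
have mg : measurable_fun setT g by apply/measurable_EFinP; exact: measurable_int gi.
(* The derivative lies between [- M] and [M] almost everywhere; truncating makes it bounded
   everywhere. *)
pose Z (w : OF) : R := Num.max (- M) (Num.min M (g w)).
have ZM w : `|Z w| <= M.
  by rewrite ler_norml /Z le_max lexx ge_max ge_min lexx/= (le_trans _ M0) ?oppr_le0.
have bZF : bmeas Z.
  by split; [apply: measurable_maxr => //; exact: measurable_minr|exists M].
exists Z; split.
- by apply/(measFP sF); exact: bZF.1.
- by apply: (bmeas_comp bZF l.1).
- move=> A FA; have mA : measurable (A : set OF) by exact: sub_sigma_algebra.
  apply/EFin_inj; rewrite -(dE A mA) fE//.
  have bAZ : bmeas (fun w : OF => \1_A w * Z w) by apply: bmeasM => //; exact: bmeas_indic.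
  rewrite -(hasLaw_int l bAZ) -intE// [RHS]integral_mkcond.
  apply: ae_eq_integral => //.
  + by apply/measurable_EFinP; exact: bAZ.1.
  + by apply/(measurable_restrictT _ mA); exact: (measurable_funTS (measurable_int _ fi)).
  + apply: aeS2 u lo => w uw lw _.
    rewrite patchE indicE -gf /Z; case: (w \in A); rewrite ?mul1r ?mul0r//=.
    by rewrite (min_idPr uw) (max_idPr _)// lerNl.
Qed.

End conditional_expectation_existence.

(** Pythagoras: testing with [Z] gives the same integral for [Z * Z'] and [Z * Z], so the difference
    of the energies is the integral of a square. *)
Lemma cond_energy_mono d (O : measurableType d) (R : realType) (P : probability O R)
    F F' (Y : O -> R) : subsig P F -> subsig P F' -> F `<=` F' -> bmeas Y ->
  (cond_energy P F Y <= cond_energy P F' Y)%E.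
Proof.
move=> sF sF' FF' bY.
have [Z cZ] := ce_exists sF bY; have [Z' cZ'] := ce_exists sF' bY.
rewrite (cond_energyE sF bY cZ) (cond_energyE sF' bY cZ') lee_fin.
have [mZ bZ _] := cZ; have [mZ' bZ' _] := cZ'.
have mZ'' : measF F' Z by move=> B mB; apply: FF'; exact: mZ.
have e1 := is_ce_test sF bY cZ mZ bZ.
have e2 := is_ce_test sF' bY cZ' mZ'' bZ.
have bZZ := bmeasM bZ bZ; have bZZ' := bmeasM bZ bZ'; have bZ'Z' := bmeasM bZ' bZ'.
have : 0 <= \int[P]_w (Z' w - Z w) ^+ 2 by apply: int_ge0 => w; exact: sqr_ge0.
rewrite (_ : \int[P]_w (Z' w - Z w) ^+ 2 =
   \int[P]_w (Z' w * Z' w) - 2 * \int[P]_w (Z w * Z' w) + \int[P]_w (Z w * Z w)); last first.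
  rewrite -intZ// -intB//; last exact: bmeasZ.
  rewrite -intD//; last by apply: bmeasB => //; exact: bmeasZ.
  by apply: eq_Rintegral => w _; ring.
by rewrite e2 -e1 => h; rewrite -subr_ge0; move: h; move: (\int[P]_w _) => A; lra.
Qed.

(** * Products of independent increments *)

Section pointwise_products.
Context (R : realType) (G : undergroupType R).
Implicit Types x : nat -> G.

Fixpoint up x k : option G :=
  if k is k'.+1 then obind (fun f => umul f (x k')) (up x k') else Some point.

Lemma up_uprod x n : up x n = uprod [seq x k | k <- iota 0 n].
Proof.
elim: n => [//|n IH]; rewrite [LHS]/= IH /uprod -addn1 iotaD map_cat foldl_cat add0n /=.
by case: (foldl _ _ _).
Qed.

Definition chained x := forall k, umul (x k) (x k.+1).

Lemma chained_shift x s : chained x -> chained (fun k => x (s + k)%N).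
Proof. by move=> c k; rewrite addnS; exact: c. Qed.

(** Definedness of the next multiplication is carried along because [umulA] asks for it: from [fx]
    and [xy] defined it yields that [(fx)y] is defined. *)
Lemma up_last x k : chained x -> exists f, exists g,
  [/\ up x k.+1 = Some f, umul f (x k.+1) = Some g & True].
Proof.
move=> c; elim: k => [|k [f [g [e1 e2 _]]]].
  rewrite /= umul1g; have := c 0%N; case E : umul => [g|//] _.
  by exists (x 0%N), g.
have := c k.+1; case E : umul => [h|//] _.
have [i e3 e4] := @umulA R G _ _ _ _ _ e2 E.
by exists g, i; split => //; rewrite [LHS]/= -/(up x k.+1) e1 /=.
Qed.

(** General associativity when only products of neighbours are assumed to be defined; the induction
    step applies [umulA] to the first block, the part of the second one multiplied so far and the
    next factor. *)
Lemma up_add x j k : chained x ->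
  exists f g, [/\ up x j = Some f, up (fun i => x (j + i)%N) k = Some g &
    umul f g = up x (j + k)%N].
Proof.
move=> c; have [f ef] : exists f, up x j = Some f.
  case: j => [|j]; first by exists point.
  by have [f [g [-> _ _]]] := up_last j c; exists f.
elim: k => [|k IH].
  by exists f, point; rewrite addn0 umulg1.
case: k IH => [|k] IH.
  exists f, (x j); split=> //; first by rewrite /= umul1g addn0.
  by rewrite addn1 /= ef.
have [f' [g [ef' eg e]]] := IH.
move: ef'; rewrite ef => -[ff']; subst f'.
have [g' [h [eg' eh _]]] := up_last k (chained_shift j c).
move: eg'; rewrite eg => -[gg']; subst g'.
have [f1 [h1 [ef1 eh1 _]]] := up_last (j + k)%N c.
rewrite addnS ef1 in e.
have [i e3 e4] := @umulA R G _ _ _ _ _ e eh.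
exists f, h; split => //.
  by rewrite [LHS]/= -/(up _ k.+1) eg.
have -> : (j + k.+2)%N = (j + k).+2 by rewrite !addnS.
by rewrite e4 [RHS]/= -/(up x (j + k).+1) ef1 /= -e3 addnS.
Qed.

End pointwise_products.

Lemma ae_measure1 d (T : measurableType d) (R : realType) (P : probability T R) (A : set T) :
  measurable A -> {ae P, forall x, A x} -> P A = 1%E.
Proof.
move=> mA [N [mN N0 sN]]; apply/eqP; rewrite eq_le probability_le1//=.
have <- : P (~` N) = 1%E by rewrite probability_setC// N0 sube0.
apply: le_measure; rewrite ?inE//; first exact: measurableC.
by move=> x nN; apply: contrapT => nA; apply/nN/sN.
Qed.

(** * Products of independent identically distributed increments *)

Section iid_products.
Context (R : realType) (G : undergroupType R).
Variables (al : probability (borel G) R) (p : nat -> probability (borel G) R)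
  (m : nat -> G * G -> G).
Hypothesis p0 : {ae p 0%N, forall x, x = point :> G}.
Hypothesis hm : forall k, hasLaw (p k \x al)%E (m k : borel G * borel G -> borel G) (p k.+1) /\
  {ae (p k \x al)%E, forall z, umul z.1 z.2 = Some (m k z)}.

(** An everywhere defined measurable version of the running product [up]; [up_pre] shows that the
    two agree almost surely. *)
Fixpoint pre (x : nat -> G) k : G := if k is k'.+1 then m k' (pre x k', x k') else point.

Lemma p1_eqm : eqm (p 1) al.
Proof.
have [l e] := hm 0%N.
apply: (hasLaw_uniq l); apply: (hasLaw_aeE (hasLaw_snd (p 0%N) al) l.1).
apply: aeS2 e (hasLaw_ae (hasLaw_fst (p 0%N) al) p0) => z /= + z1.
by rewrite z1 umul1g => -[].
Qed.

(** [p 1] is [al], so the second multiplication, known to be defined under [p 1] and [al], is that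
    of two increments. *)
Lemma al_chained : {ae (al \x al)%E, forall z : G * G, umul z.1 z.2}.
Proof.
have [_ e] := hm 1%N.
have h : hasLaw (al \x al)%E (fun z => (z.1, z.2)) (p 1%N \x al)%E.
  apply: (hasLaw_prod_map (f := id) (g := id)); last exact: hasLaw_id.
  by apply: (hasLaw_eqm (hasLaw_id al)) => B mB; rewrite p1_eqm.
by apply: aeS (hasLaw_ae h e) => z /= ->.
Qed.

Lemma pre_meas d (T : measurableType d) (x : nat -> T -> G) k :
  (forall j, (j < k)%N -> measurable_fun setT (x j : T -> borel G)) ->
  measurable_fun setT ((fun w => pre (x^~ w) k) : T -> borel G).
Proof.
elim: k => [_|k IH h] /=; first exact: measurable_cst.
have [[mm _] _] := hm k.
apply: (measurableT_comp mm); apply: measurable_fun_pair; last exact: h.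
by apply: IH => j jk; apply: h; exact: ltnW.
Qed.

Section iid.
Context d (T : measurableType d) (Q : probability T R).

Definition iid (x : nat -> T -> G) := (forall k, hasLaw Q (x k : T -> borel G) al) /\
  mutually_independent Q (x : nat -> T -> borel G).

Lemma pre_joint x k : iid x -> hasLaw Q ((fun w => pre (x^~ w) k) : T -> borel G) (p k) ->
  hasLaw Q (fun w => (pre (x^~ w) k : borel G, x k w : borel G)) (p k \x al)%E.
Proof.
move=> [hx mi] hp; have mx j := (hx j).1.
apply: (hasLaw_pair hp.1 (mx k)) => A B mA mB.
rewrite -hp.2// -(hx k).2//.
apply: (mutual_indep_rects (D1 := [set j | (j < k)%N]) (D2 := [set k]) mx mi).
- apply/seteqP; split=> j //= [/[swap] ->]; by rewrite ltnn.
- have := @pre_meas _ (g_sigma_algebraType (rects (x : nat -> T -> borel G) [set j | (j < k)%N])) x k.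
  move=> /(_ _)/measurable_preim; apply => // j jk.
  exact: (rects_meas (Y := x : nat -> T -> borel G)).
- by apply: sub_sigma_algebra; exact: rects_preim.
Qed.

Lemma pre_law x k : iid x -> hasLaw Q ((fun w => pre (x^~ w) k) : T -> borel G) (p k).
Proof.
move=> hx; elim: k => [|k IH].
  split; first exact: measurable_cst.
  move=> B mB; have [Bp|nBp] := pselect (B point).
    rewrite (_ : _ @^-1` B = setT); last by apply/seteqP; split.
    rewrite (@ae_measure1 _ _ _ (p 0%N) B)//; first exact: probT.
    by apply: aeS p0 => x' ->.
  rewrite (_ : _ @^-1` B = set0) ?measure0; last by apply/seteqP; split.
  apply/esym/measure_negligible => //.
  have [N [mN N0 sN]] := p0; exists N; split=> // y By; apply: sN => /= e.
  by apply: nBp; rewrite -e.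
exact: (hasLaw_comp (pre_joint hx IH) (hm k).1).
Qed.

Lemma up_pre x : iid x -> {ae Q, forall w, forall k, up (x^~ w) k = Some (pre (x^~ w) k)}.
Proof.
move=> hx; have h k := hasLaw_ae (pre_joint hx (pre_law k hx)) (hm k).2.
have h' : {ae Q, forall w, forall k, umul (pre (x^~ w) k) (x k w) = Some (m k (pre (x^~ w) k, x k w))}.
  by apply: ae_foralln => k; exact: h.
apply: aeS h' => w hw; elim=> [//|k IH].
by rewrite /= IH /= hw.
Qed.

Lemma chained_ae x : iid x -> {ae Q, forall w, chained (x^~ w)}.
Proof.
move=> [hx mi]; apply: ae_foralln => k.
have mx j := (hx j).1.
have h : hasLaw Q (fun w => (x k w : borel G, x k.+1 w : borel G)) (al \x al)%E.
  apply: (hasLaw_pair (mx k) (mx k.+1)) => A B mA mB.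
  rewrite -(hx k).2// -(hx k.+1).2//.
  apply: (mutual_rects (D1 := [set k]) (D2 := [set k.+1]) mi).
  - by apply/seteqP; split=> j //= [-> /eqP]; rewrite eqn_leq ltnn andbF.
  - exact: rects_preim.
  - exact: rects_preim.
exact: (hasLaw_ae h al_chained).
Qed.

Lemma iid_shift x s : iid x -> iid (fun k => x (s + k)%N).
Proof.
move=> [hx mi]; split=> [k //|u B uu mB].
have := mi [seq (s + i)%N | i <- u] (fun j => B (j - s)%N).
rewrite map_inj_uniq; last exact: addnI.
move=> /(_ uu (fun i => mB _)); rewrite big_map.
under [X in _ = X -> _]eq_bigr do rewrite addKn.
move=> <-; congr (Q _); apply/seteqP; split=> [w h _ /= /mapP[i iu ->]|w h i /= iu].
  by rewrite addKn; exact: h.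
by have := h (s + i)%N; rewrite /= map_f// addKn => /(_ isT).
Qed.

(** [up_add] is pointwise, and [up] agrees with [pre] almost surely for the sequence and all its
    shifts at once. *)
Lemma block_ae x : iid x -> {ae Q, forall w, forall s len,
  umul (pre (x^~ w) s) (pre (fun k => x (s + k)%N w) len) = Some (pre (x^~ w) (s + len)%N)}.
Proof.
move=> hx; have h1 := up_pre hx; have h2 := chained_ae hx.
have h3 : {ae Q, forall w, forall s k, up (fun k => x (s + k)%N w) k = Some (pre (fun k => x (s + k)%N w) k)}.
  by apply: ae_foralln => s; exact: (up_pre (iid_shift s hx)).
apply: aeS2 (aeS2 (fun w a b => conj a b) h1 h2) h3 => w [e1 c] e3 s len.
have [f [g [ef eg e]]] := up_add s len c.
by move: ef eg e; rewrite !e1 e3 => -[<-] [<-].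
Qed.

End iid.

Section mixing.
Context d (O : measurableType d) (P : probability O R) (X : nat -> O -> G) (A : nat -> bool).
Hypothesis iX : iid P X.

Definition mix k (w : O * O) : G := X k (if A k then w.1 else w.2).

Lemma mix_iid : iid (P \x P)%E mix.
Proof.
have [hX mi] := iX; have mX j := (hX j).1.
split=> [k|s B us mB].
  rewrite /mix; case: (A k).
    exact: (hasLaw_comp (hasLaw_fst P P) (hX k)).
  exact: (hasLaw_comp (hasLaw_snd P P) (hX k)).
pose S (b : bool) := \bigcap_(i in [set` [seq i <- s | A i == b]]) (X i @^-1` B i : set O).
have mS b : measurable (S b).
  by apply: fin_bigcap_measurable => // i _; exact: measurable_preim (mX i) (mB i).
(* A cylinder for the mixed sequence is a rectangle: the indices with [A i] constrain the first copy
   only, the others the second. *)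
rewrite (_ : \bigcap_(i in [set` s]) _ = S true `*` S false); last first.
  apply/seteqP; split=> [w h|w [h1 h2] i /= si].
    split=> i /=; rewrite mem_filter => /andP[/eqP Ai si]; by have := h i si; rewrite /mix /= Ai.
  rewrite /mix; case E : (A i).
    by apply: h1; rewrite /= mem_filter E si.
  by apply: h2; rewrite /= mem_filter E si.
have := product_measure1E P P (mS true) (mS false); rewrite /= => ->.
rewrite !mi ?filter_uniq// !big_filter.
have Xk i : (P \x P)%E (mix i @^-1` B i) = P (X i @^-1` B i).
  have mXB := measurable_preim (mX i) (mB i).
  rewrite /mix; case: (A i).
    by rewrite (hX i).2// (hasLaw_comp (hasLaw_fst P P) (hX i)).2.
  by rewrite (hX i).2// (hasLaw_comp (hasLaw_snd P P) (hX i)).2.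
rewrite [RHS](eq_bigr (fun i => P (X i @^-1` B i))); last by move=> i _; exact: Xk.
rewrite [RHS](bigID A)/=; congr (_ * _)%E.
  by apply: eq_bigl => i; rewrite eqb_id.
by apply: eq_bigl => i; rewrite eqbF_neg.
Qed.

Lemma fst_iid : iid (P \x P)%E (fun k w => X k w.1).
Proof.
have [hX mi] := iX; have mX j := (hX j).1.
split=> [k|s B us mB]; first exact: (hasLaw_comp (hasLaw_fst P P) (hX k)).
have Xk i : (P \x P)%E ((fun w : O * O => X i w.1) @^-1` B i) = P (X i @^-1` B i).
  by rewrite (hX i).2// (hasLaw_comp (hasLaw_fst P P) (hX i)).2.
rewrite [RHS](eq_bigr (fun i => P (X i @^-1` B i))); last by move=> i _; exact: Xk.
rewrite -mi//.
have mI : measurable (\bigcap_(i in [set` s]) (X i @^-1` B i : set O)).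
  by apply: fin_bigcap_measurable => // i _; exact: measurable_preim (mX i) (mB i).
by rewrite -((hasLaw_fst P P).2 _ mI).
Qed.

End mixing.

End iid_products.

(** * From block laws to conditional energies *)

Section block_chain.
Context (R : realType) (G : undergroupType R).
Local Notation B2 := (borel G * borel G)%type.
Variables (al : probability (borel G) R) (p : nat -> probability (borel G) R)
  (m : nat -> G * G -> G).
Hypothesis p0 : {ae p 0%N, forall x, x = point :> G}.
Hypothesis hm : forall k, hasLaw (p k \x al)%E (m k : borel G * borel G -> borel G) (p k.+1) /\
  {ae (p k \x al)%E, forall z, umul z.1 z.2 = Some (m k z)}.
Context d (O : measurableType d) (P : probability O R) (X : nat -> O -> G) (A : nat -> bool).
Hypothesis iX : iid al P X.

Let mX k : measurable_fun setT (X k : O -> borel G).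
Proof. by have [h _] := iX; exact: (h k).1. Qed.

Section chain.
Variables (q : nat -> G) (t : nat -> nat) (M : nat) (b : nat -> bool).
Hypothesis qp : forall k, {ae p k, forall x, cl q x}.
Hypothesis t0 : t 0%N = 0%N.
Hypothesis tS : forall i, (t i <= t i.+1)%N.
Hypothesis tb : forall i k, (i < M)%N -> (t i <= k < t i.+1)%N -> A k = b i.

Let U k (w : O * O) : B2 := (pre m (fun j => X j w.1) k, pre m (fun j => mix X A j w) k).
Let V s k (w : O * O) : B2 :=
  (pre m (fun j => X (s + j)%N w.1) k, pre m (fun j => mix X A (s + j)%N w) k).

Let fi := fst_iid iX.
Let mi := mix_iid A iX.

Let U1 k := pre_law p0 hm k fi.
Let U2 k := pre_law p0 hm k mi.
Let V1 s k := pre_law p0 hm k (iid_shift s fi).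
Let V2 s k := pre_law p0 hm k (iid_shift s mi).

Let mU k : measurable_fun setT (U k).
Proof. by apply: measurable_fun_pair; [exact: (U1 k).1|exact: (U2 k).1]. Qed.

Let mV s k : measurable_fun setT (V s k).
Proof. by apply: measurable_fun_pair; [exact: (V1 s k).1|exact: (V2 s k).1]. Qed.

Let joint s k K be : hasLaw (P \x P)%E (U s) K -> hasLaw (P \x P)%E (V s k) be ->
  hasLaw (P \x P)%E (fun w => (U s w, V s k w)) (K \x be)%E.
Proof.
have [_ ind] := iX.
pose G1 := rects (X : nat -> O -> borel G) [set j | (j < s)%N].
pose G2 := rects (X : nat -> O -> borel G) [set j | (s <= j)%N].
apply: (@dbl_indep _ _ _ _ G1 G2).
- exact: rects_measurable.
- exact: rects_measurable.
- apply: mutual_indep_rects => //.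
  by apply/seteqP; split=> j //= []; rewrite ltnNge => /negP.
- have mXj j : (j < s)%N -> measurable_fun setT (X j : g_sigma_algebraType G1 -> borel G).
    by move=> js; exact: (rects_meas (Y := X : nat -> O -> borel G)).
  apply: measurable_fun_pair.
    apply: (@pre_meas _ _ _ _ _ hm _ (g_sigma_algebraType G1 * g_sigma_algebraType G1)%type (fun j w => X j w.1)) => j js.
    by apply: (measurableT_comp (mXj _ js)); exact: measurable_fst.
  apply: (@pre_meas _ _ _ _ _ hm _ (g_sigma_algebraType G1 * g_sigma_algebraType G1)%type (fun j w => mix X A j w)) => j js.
  rewrite /mix; case: (A j); apply: (measurableT_comp (mXj _ js)); [exact: measurable_fst|exact: measurable_snd].
- have mXj j : measurable_fun setT (X (s + j)%N : g_sigma_algebraType G2 -> borel G).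
    by apply: (rects_meas (Y := X : nat -> O -> borel G)); rewrite /= leq_addr.
  apply: measurable_fun_pair.
    apply: (@pre_meas _ _ _ _ _ hm _ (g_sigma_algebraType G2 * g_sigma_algebraType G2)%type (fun j w => X (s + j)%N w.1)) => j js.
    by apply: (measurableT_comp (mXj _)); exact: measurable_fst.
  apply: (@pre_meas _ _ _ _ _ hm _ (g_sigma_algebraType G2 * g_sigma_algebraType G2)%type (fun j w => mix X A (s + j)%N w)) => j js.
  rewrite /mix; case: (A _); apply: (measurableT_comp (mXj _)); [exact: measurable_fst|exact: measurable_snd].
Qed.

Let mulUV : {ae (P \x P)%E, forall w, forall s k,
  umul ((U s w).1 : G) ((V s k w).1 : G) = Some ((U (s + k)%N w).1 : G) /\
  umul ((U s w).2 : G) ((V s k w).2 : G) = Some ((U (s + k)%N w).2 : G)}.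
Proof.
by apply: aeS2 (block_ae p0 hm fi) (block_ae p0 hm mi) => w h1 h2 s k; split; [exact: h1|exact: h2].
Qed.

(** [t] cuts time into blocks on which the mask is constant, so each block law is of one of the two
    kinds of [isb]; [dbl_indep] makes a block independent of the past for both paths at once. *)
Lemma block_chain : exists K be,
  [/\ chain q M K be, forall i, (i < M)%N -> isb (b i) (p (t i.+1 - t i)%N) (be i) &
   forall i, hasLaw (P \x P)%E
     (fun w : O * O => (pre m (fun j => X j w.1) (t i) : borel G,
                        pre m (fun j => mix X A j w) (t i) : borel G)) (K i)].
Proof.
have /(_ _)/cid-/all_sig[K hK] i := hasLaw_ex (P \x P)%E (mU (t i)).
have /(_ _)/cid-/all_sig[be hbe] i := hasLaw_ex (P \x P)%E (mV (t i) (t i.+1 - t i)%N).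
have K1 i : hasLaw (K i) fst (p (t i)) by exact: (hasLaw_factor (hK i) (@measurable_fst _ _ _ _) (U1 (t i))).
have K2 i : hasLaw (K i) snd (p (t i)) by exact: (hasLaw_factor (hK i) (@measurable_snd _ _ _ _) (U2 (t i))).
have be1 i : hasLaw (be i) fst (p (t i.+1 - t i)%N) by exact: (hasLaw_factor (hbe i) (@measurable_fst _ _ _ _) (V1 (t i) _)).
have be2 i : hasLaw (be i) snd (p (t i.+1 - t i)%N) by exact: (hasLaw_factor (hbe i) (@measurable_snd _ _ _ _) (V2 (t i) _)).
exists K, be; split => //.
- split.
  + have := K2 0%N; have := K1 0%N; rewrite t0 => h1 h2.
    by apply: aeS2 (hasLaw_ae h1 p0) (hasLaw_ae h2 p0) => -[x y] /= -> ->.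
  + move=> i iM; unshelve eexists; last by [].
    apply: (@Stepping _ _ _ _ _ _ _ (P \x P)%E (U (t i)) (V (t i) (t i.+1 - t i)%N) (U (t i.+1))).
    * exact: joint.
    * exact: hK.
    * by apply: aeS mulUV => w /(_ (t i) (t i.+1 - t i)%N); rewrite subnKC.
  + by move=> i _; exact: marg_carried (K1 i) (K2 i) (qp _).
  + by move=> i _; exact: marg_carried (be1 i) (be2 i) (qp _).
- move=> i iM; set k := (t i.+1 - t i)%N.
  have Ab j : (j < k)%N -> A (t i + j)%N = b i.
    by move=> jk; apply: tb => //; rewrite leq_addr/= -ltn_subRL.
  have pre_eq (x y : nat -> G) : (forall j, (j < k)%N -> x j = y j) -> pre m x k = pre m y k.
    elim: k {Ab} => [//|k IH] e /=; rewrite IH ?e// => j jk; apply: e; exact: ltnW.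
  have hv := hbe i; case Eb : (b i) => /=.
    apply: (hasLaw_factor (V1 (t i) k)).
      by apply: measurable_fun_pair; exact: measurable_id.
    rewrite (_ : _ \o _ = V (t i) k)//; apply/funext => w /=.
    by rewrite /V; congr (_, _); apply: pre_eq => j jk; rewrite /mix Ab// Eb.
  have h : hasLaw (P \x P)%E (V (t i) k) (p k \x p k)%E.
    rewrite (_ : V (t i) k = fun w => (pre m (fun j => X (t i + j)%N w.1) k, pre m (fun j => X (t i + j)%N w.2) k)).
      have hp := pre_law p0 hm k (iid_shift (t i) iX).
      exact: (hasLaw_prod_map hp hp).
    by apply/funext => w; rewrite /V; congr (_, _); apply: pre_eq => j jk; rewrite /mix Ab// Eb.
  exact: (hasLaw_uniq hv h).
Qed.

End chain.

Section energy.
Variables (N : nat) (F : set (set O)) (out : O -> G) (psi : G -> R).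
Hypothesis sF : subsig P F.
Hypothesis hFA : forall k, (k < N)%N -> A k -> measF F (X k : O -> borel G).
Hypothesis hind : indepS P F <<s rects (X : nat -> O -> borel G) [set k | (k < N)%N /\ ~~ A k] >>.
Hypothesis hout : {ae P, forall w, up (fun k => X k w) N = Some (out w)}.
Hypothesis bpsi : bmeas (psi : borel G -> R).
Hypothesis bout : bmeas (psi \o out : O -> R).

Let G2 := rects (X : nat -> O -> borel G) [set k | (k < N)%N /\ ~~ A k].
(** The value of [psi] at the end of the path that reads [w] on the mask and [w'] off it; on the
    diagonal this is the true end value. *)
Let h w w' := psi (pre m (fun k => mix X A k (w, w')) N).

Let bh : bmeas ((fun z => h z.1 z.2) : (g_sigma_algebraType F * g_sigma_algebraType G2)%type -> R).
Proof.
apply: (bmeas_comp bpsi).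
apply: (@pre_meas _ _ _ _ _ hm _ (g_sigma_algebraType F * g_sigma_algebraType G2)%type
  (fun k z => mix X A k (z.1, z.2))) => k kN; rewrite /mix; case E : (A k).
  apply: (measurableT_comp (f := X k : g_sigma_algebraType F -> borel G)); last exact: measurable_fst.
  by apply/(measFP sF); exact: hFA.
apply: (measurableT_comp (f := X k : g_sigma_algebraType G2 -> borel G)); last exact: measurable_snd.
by apply: (rects_meas (Y := X : nat -> O -> borel G)); rewrite /= kN E.
Qed.

Let mF := subsig_m sF.
Let mG2 : G2 `<=` measurable.
Proof. exact: rects_measurable. Qed.

Let ind : indepS P <<s F >> <<s G2 >>.
Proof. by rewrite (subsigE sF). Qed.

Let Z w := \int[P]_w' h w w'.

Let bZF : bmeas (Z : g_sigma_algebraType F -> R).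
Proof.
have [P1 k1] := gsT_law P mF; have [P2 k2] := gsT_law P mG2.
rewrite (_ : Z = fun w => \int[P2]_w' h w w'); first exact: (fubini_bmeas P1 P2 bh).
apply/funext => w; rewrite (hasLaw_int k2)//.
exact: (bmeas_comp bh (@pair1_measurable _ _ (g_sigma_algebraType F) (g_sigma_algebraType G2) w)).
Qed.

Let bZ : bmeas Z.
Proof. by have [P1 k1] := gsT_law P mF; exact: (bmeas_comp bZF k1.1). Qed.

Let hdiag w : h w w = psi (pre m (fun k => X k w) N).
Proof. by rewrite /h; congr (psi (pre _ _ _)); apply/funext => k; rewrite /mix; case: (A k). Qed.

Let preE : {ae P, forall w, psi (out w) = h w w}.
Proof.
by apply: aeS2 hout (up_pre p0 hm iX) => w e1 /(_ N); rewrite e1 hdiag => -[->].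
Qed.

Let bhd : bmeas (fun w => h w w).
Proof.
rewrite (_ : (fun w => h w w) = (fun w => psi (pre m (fun k => X k w) N))).
  exact: (bmeas_comp bpsi (pre_law p0 hm N iX).1).
by apply/funext => w; exact: hdiag.
Qed.

Let frz (f : O -> R) : bmeas (f : g_sigma_algebraType F -> R) ->
  \int[P]_w (f w * h w w) = \int[P]_w (f w * Z w).
Proof.
move=> bf; rewrite (freeze (h := fun w w' => f w * h w w') mF mG2 ind); last first.
  apply: bmeasM; last exact: bh.
  exact: (bmeas_comp bf (@measurable_fst _ _ (g_sigma_algebraType F) (g_sigma_algebraType G2))).
apply: eq_Rintegral => w _; rewrite intZ//.
have [P2 k2] := gsT_law P mG2.
exact: (bmeas_comp (bmeas_comp bh (@pair1_measurable _ _ (g_sigma_algebraType F) (g_sigma_algebraType G2) w)) k2.1).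
Qed.

(** By freezing, the increments off the mask may be averaged over an independent copy. [F] may
    exceed the sigma-field of the increments on the mask, provided it stays independent of the
    others; the continuous-time field of a dyadic union is of this kind. *)
Lemma setting_ce : is_ce P F (psi \o out) Z.
Proof.
split => //.
- by apply/(measFP sF); exact: bZF.1.
- move=> B FB; have mB : measurable (B : set (g_sigma_algebraType F)) by exact: sub_sigma_algebra.
  have bB := bmeas_indic R mB; have bB' := bmeas_indic R (mF FB).
  rewrite -(frz bB); apply: int_ae; [exact: bmeasM|exact: bmeasM|].
  by apply: aeS preE => w /= ->.
Qed.

(** One factor of the square [Z * Z] is turned back into [h w w] by freezing; the other remains an
    average over [w'], and what results is the mean of [psi] at one end point times [psi] at the
    other. *)
Lemma setting_energy K : hasLaw (P \x P)%E
     (fun w : O * O => (pre m (fun j => X j w.1) N : borel G,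
                        pre m (fun j => mix X A j w) N : borel G)) K ->
  cond_energy P F (psi \o out) = (\int[K]_z (psi z.1 * psi z.2))%:E.
Proof.
move=> hK; rewrite (cond_energyE sF bout setting_ce); congr (_ %:E).
have bb := bmeas_psi2 bpsi.
rewrite (hasLaw_int hK bb) fubini_int; last exact: (bmeas_comp bb hK.1).
transitivity (\int[P]_w (Z w * Z w)); first by [].
rewrite -(frz bZF); apply: eq_Rintegral => w _ /=.
rewrite mulrC hdiag /Z -intZ.
  by apply: eq_Rintegral => w' _.
have h2 := bmeas_comp bpsi (pre_law p0 hm N (mix_iid A iX)).1.
exact: (bmeas_comp h2 (@pair1_measurable _ _ O O w)).
Qed.

End energy.

End block_chain.

(** * Dyadic unions and energies *)

Section dyadic.
Variable R : realType.

(** Masks are functions on [nat], read below [2 ^ l] only, so that passing to a finer level is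
    composition with a division. *)
Definition dy l (B : nat -> bool) : set R :=
  \bigcup_(k in [set k | (k < 2 ^ l)%N /\ B k]) [set` `[k%:R / 2 ^+ l, k.+1%:R / 2 ^+ l]].

Lemma dyP l B (x : R) : dy l B x <->
  exists k : nat, [/\ (k < 2 ^ l)%N, B k & k%:R / 2 ^+ l <= x <= k.+1%:R / 2 ^+ l].
Proof.
split=> [[k [kl Bk]]|[k [kl Bk h]]]; rewrite /= ?in_itv/=; first by exists k.
by exists k => //; rewrite /= in_itv.
Qed.

Lemma pow2_gt0 l : 0 < 2 ^+ l :> R.
Proof. by rewrite exprn_gt0. Qed.

Lemma dyadic_unionP n (A : {set 'I_(2 ^ n)}) (x : R) : dyadic_union R A x <->
  exists k : 'I_(2 ^ n), k \in A /\ k%:R / 2 ^+ n <= x <= k.+1%:R / 2 ^+ n.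
Proof.
split=> [[k /= kA]|[k [kA h]]]; rewrite /= ?in_itv/=; first by exists k.
by exists k => //; rewrite /= in_itv.
Qed.

Lemma dyE n B : dyadic_union R [set k : 'I_(2 ^ n) | B (k : nat)] = dy n B.
Proof.
apply/seteqP; split=> x.
  by move=> /dyadic_unionP[k]; rewrite inE => -[Bk h]; apply/dyP; exists k.
move=> /dyP[k [kn Bk h]]; apply/dyadic_unionP; exists (Ordinal kn).
by rewrite inE.
Qed.

Lemma dy_refine l n B : (l <= n)%N -> dy l B = dy n (fun k => B (k %/ 2 ^ (n - l))%N).
Proof.
move=> ln; set D := (2 ^ (n - l))%N.
have D0 : (0 < D)%N by rewrite expn_gt0.
have e2 : (2 ^ n = 2 ^ l * D)%N by rewrite /D -expnD subnKC.
have e2R : 2 ^+ n = 2 ^+ l * D%:R :> R by rewrite -natrX e2 natrM natrX.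
have D0R : 0 < D%:R :> R by rewrite ltr0n.
have eq k : k%:R / 2 ^+ l = (k * D)%:R / 2 ^+ n :> R.
  rewrite e2R natrM invfM mulrACA divff ?mulr1//.
  by rewrite gt_eqF.
apply/seteqP; split=> x /dyP[k [kl Bk]].
  rewrite !eq ler_pdivrMr ?pow2_gt0// ler_pdivlMr ?pow2_gt0// => /andP[h1 h2].
  have x0 : 0 <= x * 2 ^+ n by rewrite (le_trans _ h1).
  have /andP[t1 t2] := trunc_itv x0.
  set j := Num.trunc (x * 2 ^+ n) in t1 t2.
  have kDj : (k * D <= j)%N by rewrite -ltnS -(ltr_nat R) (le_lt_trans h1).
  have [lt|ge] := ltnP j (k.+1 * D).
    apply/dyP; exists j; split.
    - by rewrite e2 (leq_trans lt)// leq_mul2r kl orbT.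
    - by rewrite (_ : (j %/ D)%N = k)//; apply/eqP; rewrite eqn_leq -ltnS ltn_divLR// lt leq_divRL.
    - by rewrite ler_pdivrMr ?pow2_gt0// ler_pdivlMr ?pow2_gt0// t1 ltW.
  (* Here [x] is the right end point of its block. The truncation points to the next block; the
     sub-block to take is the last one, [(k.+1 * D).-1]. *)
  have e : x * 2 ^+ n = (k.+1 * D)%:R.
    by apply/eqP; rewrite eq_le h2 (le_trans _ t1)// ler_nat.
  have kD0 : (0 < k.+1 * D)%N by rewrite muln_gt0.
  apply/dyP; exists (k.+1 * D).-1; split.
  - by rewrite prednK// e2 leq_mul2r kl orbT.
  - rewrite (_ : _ %/ _ = k)%N//; apply/eqP; rewrite eqn_leq -ltnS ltn_divLR// prednK// leqnn/=.
    by rewrite leq_divRL// -ltnS prednK// ltn_mul2r D0/=.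
  - rewrite ler_pdivrMr ?pow2_gt0// ler_pdivlMr ?pow2_gt0// prednK// e lexx andbT.
    by rewrite ler_nat leq_pred.
rewrite ler_pdivrMr ?pow2_gt0// ler_pdivlMr ?pow2_gt0// => /andP[h1 h2].
apply/dyP; exists (k %/ D)%N; split => //.
  by rewrite ltn_divLR// -e2.
rewrite !eq ler_pdivrMr ?pow2_gt0// ler_pdivlMr ?pow2_gt0//; apply/andP; split.
  by rewrite (le_trans _ h1)// ler_nat leq_trunc_div.
by rewrite (le_trans h2)// ler_nat ltn_ceil.
Qed.

End dyadic.

Section discrete.
Context (R : realType) (G : undergroupType R).

Lemma mutually_independent_comp d (O : measurableType d) (P : probability O R)
    d' (T : measurableType d') (I J : eqType) (Y : I -> O -> T) (f : J -> I) :
  injective f -> mutually_independent P Y -> mutually_independent P (fun j => Y (f j)).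
Proof.
move=> fi mi s B us mB.
have [B' hB'] : exists B' : I -> set T, (forall i, measurable (B' i)) /\ forall j, j \in s -> B' (f j) = B j.
  (* Since [f] is injective, the intersection has a single member when [i] is the image of some [j]
     in [s]. *)
  exists (fun i => if `[< exists2 j, j \in s & f j = i >] is true then
     \bigcap_(j in [set j | j \in s /\ f j = i]) B j else setT).
  split=> [i|j js].
    case: asboolP => // -[j js <-].
    rewrite (_ : \bigcap_(k in _) B k = B j)//.
    apply/seteqP; split=> [x|x Bx k [ks /fi ->]//]; exact.
  rewrite asboolT; last by exists j.
  by apply/seteqP; split=> [x|x Bx k [ks /fi ->]//]; exact.
have := mi (map f s) B'; rewrite map_inj_uniq// => /(_ us hB'.1).
rewrite big_map => h.
rewrite [RHS](_ : _ = (\prod_(j <- s) P (Y (f j) @^-1` B' (f j)))%E); last first.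
  by apply: eq_big_seq => j js; rewrite hB'.2.
rewrite -h; congr (P _); apply/seteqP; split=> [w hw _ /mapP[j js ->]|w hw j /= js].
  by rewrite hB'.2//; exact: hw.
by rewrite -hB'.2//; apply: hw; rewrite /= map_f.
Qed.

Lemma measurable_ae_complete d (O : measurableType d) (P : probability O R)
    d' (T : measurableType d') (Z Z' : O -> T) : measure_is_complete P ->
  measurable_fun setT Z -> {ae P, forall w, Z w = Z' w} -> measurable_fun setT Z'.
Proof.
move=> Pc mZ e.
have sF : subsig P (@measurable _ O).
  by split => //; exact: sigma_algebra_measurable.
have mF : measF (@measurable _ O) Z by move=> B mB; exact: measurable_preim.
by move=> _ C mC; rewrite setTI; exact: (measF_ae sF mF e).
Qed.

Lemma conv_pow_maps (mun : probability (borel G) R) : tight mun -> conv_defined mun mun ->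
  exists m : nat -> G * G -> G, forall k,
  hasLaw (conv_pow mun k \x mun)%E (m k : borel G * borel G -> borel G) (conv_pow mun k.+1) /\
  {ae (conv_pow mun k \x mun)%E, forall z, umul z.1 z.2 = Some (m k z)}.
Proof.
move=> tm dm; have /(_ _)/cid-/all_sig[m hm] k : exists m : G * G -> G,
    hasLaw (conv_pow mun k \x mun)%E (m : borel G * borel G -> borel G) (conv_pow mun k.+1) /\
    {ae (conv_pow mun k \x mun)%E, forall z, umul z.1 z.2 = Some (m z)}.
  by apply/is_convP; have [] := conv_powP tm dm k.
by exists m.
Qed.

Section energy.
Context d (O : measurableType d) (P : probability O R).
Variables (mun : probability (borel G) R) (X : int -> {RV P >-> borel G}) (n : nat).
Hypothesis tmun : tight mun.
Hypothesis dmun : conv_defined mun mun.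
Hypothesis Pc : measure_is_complete P.
Hypothesis HX : discrete_process mun X.
Variables (psi : G -> R) (q : nat -> G).
Hypothesis bpsi : bmeas (psi : borel G -> R).
Hypothesis qp : forall k, {ae conv_pow mun k, forall x, cl q x}.

Let x (k : nat) : O -> G := X k.+1%:Z.

Let ix : iid mun P x.
Proof.
split=> [k|].
  split; first exact: measurable_funP.
  by move=> B mB; rewrite -(discrete_process_law HX k.+1%:Z mB).
apply: (mutually_independent_comp (Y := fun k => X k : O -> borel G) (f := fun k : nat => k.+1%:Z)).
  by move=> i j [].
exact: (discrete_process_indep HX).
Qed.

(** A block of level [l] consists of [2 ^ (n - l)] steps, and [t] groups these blocks into [M] runs
    on which [B] is constant. [M] does not depend on [n], as [chain_wcv] requires. *)
Lemma discrete_energy l (B : nat -> bool) (t : nat -> nat) M (b : nat -> bool) : (l <= n)%N ->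
  t 0%N = 0%N -> (forall i, (t i <= t i.+1)%N) -> t M = (2 ^ l)%N ->
  (forall i k, (i < M)%N -> (t i <= k < t i.+1)%N -> B k = b i) ->
  exists K be, [/\ chain q M K be,
    forall i, (i < M)%N -> isb (b i) (conv_pow mun ((t i.+1 - t i) * 2 ^ (n - l))%N) (be i) &
    cond_energy P (discrete_field X [set k : 'I_(2 ^ n) | B (k %/ 2 ^ (n - l))%N])
      (psi \o discrete_X01 n X) = (\int[K M]_z (psi z.1 * psi z.2))%:E].
Proof.
move=> ln t0 tS tM tb; have [m hm] := conv_pow_maps tmun dmun.
have p0 : {ae conv_pow mun 0, forall x, x = point :> G} by exact: unit_mass_ae.
set D := (2 ^ (n - l))%N; have D0 : (0 < D)%N by rewrite expn_gt0.
have e2 : (2 ^ n = 2 ^ l * D)%N by rewrite /D -expnD subnKC.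
pose A k := B (k %/ D)%N.
have [||i k iM /andP[h1 h2]|K [be [cK hbe hK]]] := block_chain p0 hm ix (A := A) (t := fun i => (t i * D)%N) (M := M) (b := b) qp.
- by rewrite t0.
- by move=> i; rewrite leq_mul2r tS orbT.
- by apply: tb => //; rewrite leq_divRL// h1 ltn_divLR.
exists K, be; split => //.
  by move=> i iM; have := hbe i iM; rewrite mulnBl.
have mx k : measurable_fun setT (x k : O -> borel G) by exact: measurable_funP.
have upE w : up (fun k => x k w) (2 ^ n) = uprod [seq X k%:Z w : G | k <- iota 1 (2 ^ n)].
  by rewrite up_uprod -[1%N]addn0 iotaDl -map_comp.
have hout : {ae P, forall w, up (fun k => x k w) (2 ^ n) = Some (discrete_X01 n X w)}.
  apply: aeS (up_pre p0 hm ix) => w /(_ (2 ^ n)%N) h.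
  by rewrite h /discrete_X01 -upE h.
have bout : bmeas (psi \o discrete_X01 n X : O -> R).
  split; last by have [C h] := bpsi.2; exists C => w; exact: h.
  have bp := bmeas_comp bpsi (pre_law p0 hm (2 ^ n) ix).1.
  apply: (measurable_ae_complete Pc bp.1).
  apply: aeS2 (up_pre p0 hm ix) hout => w /(_ (2 ^ n)%N) -> [] /= ->.
  by [].
apply: (setting_energy p0 hm ix (A := A) (N := (2 ^ n)%N)) => //.
- by apply: sigma_field_subsig => // k; exact: measurable_funP.
- move=> k kn Ak C mC; apply: (sigma_field_preim (Y := fun k : 'I_(2 ^ n) => X k.+1%:Z : O -> borel G) (i := Ordinal kn)) => //=.
  by rewrite inE.
- have ind := mutual_indepS Pc mx ix.2 (D1 := [set k | (k < 2 ^ n)%N /\ A k]) (D2 := [set k | (k < 2 ^ n)%N /\ ~~ A k]).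
  apply: indepS_sub (ind _).
  + apply: smallest_sub; first exact: smallest_sigma_algebra.
    move=> C [[i Di [E mE <-]]|nC]; apply: sub_sigma_algebra; last by right.
    left; exists (i : nat); last by exists E.
    by move: Di; rewrite /= inE.
  + apply: smallest_sub; first exact: smallest_sigma_algebra.
    exact: rects_sub_sigma_field.
  + by apply/seteqP; split=> k //= [[_ Ak] [_]]; rewrite Ak.
- by rewrite e2 -tM; exact: hK.
Qed.

End energy.

End discrete.

(** * The continuous-time process *)

Section process.
Context (R : realType) (G : undergroupType R).
Variable mu : R -> probability (borel G) R.
Hypothesis Hmu : conv_semigroup mu.
Context d (O : measurableType d) (P : probability O R) (Y : R -> R -> {RV P >-> borel G}).
Hypothesis Pc : measure_is_complete P.
Hypothesis HY : indep_process mu Y.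

Lemma process_law s t : 0 <= s -> s <= t -> hasLaw P (Y s t : O -> borel G) (mu (t - s)).
Proof.
move=> s0 st; split; first exact: measurable_funP.
by move=> B mB; rewrite -(indep_process_law HY s0 st mB).
Qed.

Lemma process_diag s : 0 <= s -> {ae P, forall w, Y s s w = point :> G}.
Proof.
move=> s0; have h := process_law s0 (lexx s); rewrite subrr in h.
by apply: aeS (hasLaw_ae h (mu0_ae Hmu)) => w.
Qed.

Lemma process_mono (r : nat -> R) : {homo r : i j / (i <= j)%N >-> i <= j} -> r 0%N = 0 ->
  mutually_independent P (fun j => Y (r j) (r j.+1) : O -> borel G).
Proof.
move=> rm r0 s B us mB.
pose n := (\max_(i <- s) i).+1.
have sn i : i \in s -> (i < n)%N by move=> si; rewrite ltnS; exact: (@leq_bigmax_seq _ s xpredT id).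
have mi := indep_process_indep HY (n := n) r0 (fun i _ => rm _ _ (leqnSn i)).
pose f i : 'I_n := inord i.
have fK i : i \in s -> f i = i :> nat by move=> si; rewrite inordK// sn.
have := mi [seq f i | i <- s] (fun i => B i).
rewrite map_inj_in_uniq; last by move=> i j si sj /(congr1 val); rewrite /= !fK.
move=> /(_ us (fun i => mB i)); rewrite big_map.
rewrite [in X in _ = X -> _](eq_big_seq (fun i => P (Y (r i) (r i.+1) @^-1` B i))); last first.
  by move=> i si; rewrite fK.
move=> <-; congr (P _); apply/seteqP; split=> [w h _ /= /mapP[i si ->]|w h i /= si].
  by rewrite fK//; exact: h.
have := h (f i); rewrite /= fK//; apply.
by rewrite /= map_f.
Qed.

Lemma process_joint r s t : 0 <= r -> r <= s -> s <= t ->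
  hasLaw P (fun w => (Y r s w : borel G, Y s t w : borel G)) (mu (s - r) \x mu (t - s))%E.
Proof.
move=> r0 rs st; have s0 := le_trans r0 rs.
apply: hasLaw_pair; [exact: measurable_funP|exact: measurable_funP|].
move=> A B mA mB; rewrite -(process_law r0 rs).2// -(process_law s0 st).2//.
(* Independence is available for partitions starting at 0; of the partition [0, r, s, t, t, ...] the
   increments number 1 and 2 are taken. *)
pose tt k : R := if k is k'.+1 then if k' is k''.+1 then if k'' is _.+1 then t else s else r else 0.
have tm : {homo tt : i j / (i <= j)%N >-> i <= j}.
  by apply: homo_leq => // [x y z|[|[|[|i]]]] //=; exact: le_trans.
have mi := process_mono tm (erefl _).
have mC (i : nat) : measurable (if i == 1%N then A else B) by case: ifP.
have := mi [:: 1; 2]%N (fun i => if i == 1%N then A else B) isT mC.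
rewrite !big_cons big_nil mule1 /= => <-.
congr (P _); apply/seteqP; split=> [w [h1 h2] i /=|w h].
  by rewrite !inE => /orP[]/eqP ->.
by split; [exact: (h 1%N)|exact: (h 2%N)].
Qed.

(** [Y r t] is only almost surely the product of the two increments, and the product itself needs a
    measurable version [m]; both corrections are absorbed by the negligible sets in [F]. *)
Lemma process_mulF F r s t : subsig P F -> 0 <= r -> r <= s -> s <= t ->
  measF F (Y r s : O -> borel G) -> measF F (Y s t : O -> borel G) ->
  measF F (Y r t : O -> borel G).
Proof.
move=> sF r0 rs st F1 F2.
have rs0 : 0 <= s - r by rewrite subr_ge0.
have st0 : 0 <= t - s by rewrite subr_ge0.
have [m [[mm _] em]] := (is_convP _ _ _).1 (conv_semigroupD Hmu rs0 st0).
have FZ : measF F ((fun w => m (Y r s w, Y s t w)) : O -> borel G).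
  apply/(measFP sF); apply: (measurableT_comp (f := m : borel G * borel G -> borel G)) => //.
  by apply: measurable_fun_pair; apply/(measFP sF).
apply: (measF_ae sF FZ).
apply: aeS2 (indep_process_mul HY r0 rs st) (hasLaw_ae (process_joint r0 rs st) em) => w /=.
by move=> -> [].
Qed.

Lemma process_cellsF F (r : nat -> R) a b : subsig P F ->
  {homo r : i j / (i <= j)%N >-> i <= j} -> r 0%N = 0 -> (a <= b)%N ->
  (forall j, (a <= j < b)%N -> measF F (Y (r j) (r j.+1) : O -> borel G)) ->
  measF F (Y (r a) (r b) : O -> borel G).
Proof.
move=> sF rm r0; have rp j : 0 <= r j by rewrite -r0; exact: rm.
elim: b => [|b IH].
  rewrite leqn0 => /eqP -> _.
  apply: (measF_ae sF (Z := (fun=> point) : O -> borel G)); last by apply: aeS (process_diag (rp 0%N)) => w.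
  by apply/(measFP sF); exact: measurable_cst.
rewrite leq_eqVlt => /orP[/eqP -> _|].
  apply: (measF_ae sF (Z := (fun=> point) : O -> borel G)); last by apply: aeS (process_diag (rp b.+1)) => w.
  by apply/(measFP sF); exact: measurable_cst.
rewrite ltnS => ab h.
apply: (process_mulF (s := r b) sF) => //; [exact: rm|exact: rm| |].
  by apply: IH => // j /andP[aj jb]; apply: h; rewrite aj/= ltnS ltnW.
by apply: h; rewrite ab /=.
Qed.

Lemma grid_exists (s : seq R) : (forall x, x \in s -> 0 <= x) ->
  exists (r : nat -> R) (N : nat), [/\ {homo r : i j / (i <= j)%N >-> i <= j}, r 0%N = 0,
    forall j, (j < N)%N -> r j < r j.+1 & forall x, x \in s -> exists2 j, (j <= N)%N & r j = x].
Proof.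
move=> s0; pose L := sort <=%R (undup (0 :: s)).
have Lm x : (x \in L) = (x \in 0 :: s) by rewrite mem_sort mem_undup.
have L0 x : x \in L -> 0 <= x by rewrite Lm inE => /orP[/eqP -> //|/s0].
have Ls : sorted <%R L by rewrite sort_lt_sorted undup_uniq.
have sL : (0 < size L)%N by have := Lm 0; rewrite mem_head; case: (L).
have [N eN] : exists N, size L = N.+1 by case: (size L) sL => // k _; exists k.
pose r j := nth 0 L (minn j N).
have rlt i j : (i < j)%N -> (j <= N)%N -> nth 0 L i < nth 0 L j.
  move=> ij jN; apply: (sorted_ltn_nth lt_trans 0 Ls) => //; rewrite inE eN ltnS//.
  exact: ltnW (leq_trans ij jN).
have rle i j : (i <= j)%N -> (j <= N)%N -> nth 0 L i <= nth 0 L j.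
  by rewrite leq_eqVlt => /orP[/eqP ->//|ij jN]; exact/ltW/rlt.
have rm : {homo r : i j / (i <= j)%N >-> i <= j}.
  by move=> i j ij; apply: rle; [rewrite leq_min geq_minr andbT (leq_trans (geq_minl _ _))|exact: geq_minr].
have rx x : x \in 0 :: s -> exists2 j, (j <= N)%N & r j = x.
  rewrite -Lm => xL; exists (index x L); first by rewrite -ltnS -eN index_mem.
  by rewrite /r (minn_idPl _) ?nth_index// -ltnS -eN index_mem.
exists r, N; split => //.
- apply/eqP; rewrite eq_le; apply/andP; split.
    by have [j _ <-] := rx 0 (mem_head _ _); exact: rm.
  by rewrite L0// mem_nth// eN ltnS geq_minr.
- by move=> j jN; rewrite /r (minn_idPl (ltnW jN)) (minn_idPl jN); exact: rlt.
- by move=> x xs; apply: rx; rewrite inE xs orbT.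
Qed.

(** A cylinder involves finitely many increments; a common refinement of their end points and of the
    dyadic grid cuts them into cells, and the cells inside [dy l B] are independent of the
    others. *)
Lemma process_field_indep l B : indepS P (process_field Y (dy l B))
  (sigma_field P (fun uv : R * R => Y uv.1 uv.2 : O -> borel G)
    [set uv | exists2 k : nat, (k < 2 ^ l)%N && ~~ B k & uv = (k%:R / 2 ^+ l, k.+1%:R / 2 ^+ l)]).
Proof.
have p2 := pow2_gt0 R l.
apply: (sigma_field_indep Pc) => [i|s1 s2 B1 B2 D1 D2 mB1 mB2]; first exact: measurable_funP.
have nn (k : nat) : 0 <= k%:R / 2 ^+ l :> R by rewrite divr_ge0// ltW.
have le12 i : i \in s1 -> 0 <= i.1 /\ i.1 <= i.2.
  move=> /D1[i12 sub]; split => //; have /sub/dyP[k [_ _ /andP[h _]]] : `[i.1, i.2]%classic i.1.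
    by rewrite /= in_itv/= lexx.
  exact: le_trans (nn k) h.
pose ends := [seq i.1 | i <- s1] ++ [seq i.2 | i <- s1] ++
             [seq (k%:R / 2 ^+ l : R) | k <- iota 0 (2 ^ l).+1].
have [x|r [N [rm r0 rlt rx]]] := @grid_exists ends.
  rewrite !mem_cat => /or3P[] /mapP[i].
  - by move=> /le12[] ? ? ->.
  - by move=> /le12[] h1 h2 ->; exact: le_trans h2.
  - by move=> _ ->.
pose W (j : nat) : O -> borel G := Y (r j) (r j.+1).
pose E1 := [set j | `[r j, r j.+1]%classic `<=` dy l B].
have mi : mutually_independent P W by exact: process_mono.
have mW j : measurable_fun setT (W j) by exact: measurable_funP.
have ind := mutual_indepS (D1 := E1) (D2 := ~` E1) Pc mW mi (setICr _).
have sub D : subsig P (sigma_field P W D) by exact: sigma_field_subsig.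
have cap (s : seq (R * R)) (C : R * R -> set (borel G)) D : (forall i, measurable (C i)) ->
    (forall i, i \in s -> measF (sigma_field P W D) (Y i.1 i.2 : O -> borel G)) ->
    sigma_field P W D (\bigcap_(i in [set` s]) (Y i.1 i.2 @^-1` C i)).
  move=> mC h; rewrite -(subsigE (sub D)).
  apply: (@fin_bigcap_measurable _ (g_sigma_algebraType (sigma_field P W D))) => // i /= si.
  by apply: sub_sigma_algebra; exact: h.
have rS i : (i <= N)%N -> forall j, (j <= N)%N -> r i <= r j -> (i <= j)%N.
  move=> iN j jN; rewrite leNgt => /negP ij; rewrite leqNgt; apply/negP => ji; apply: ij.
  by apply: lt_le_trans (rm _ _ ji); apply: rlt; exact: leq_trans ji iN.
apply: ind; apply: cap => // i si.
- have [i0 i12] := le12 _ si; have [_ dsub] := D1 _ si.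
  have [|a aN ea] := rx i.1; first by rewrite /ends !mem_cat map_f.
  have [|b bN eb] := rx i.2; first by rewrite /ends !mem_cat map_f ?orbT.
  have ab : (a <= b)%N by apply: rS => //; rewrite ea eb.
  rewrite -ea -eb; apply: process_cellsF => // j /andP[aj jb] C mC.
  apply: (sigma_field_preim (Y := W)) => // x /=; rewrite in_itv/= => /andP[h1 h2].
  apply: dsub; rewrite /= in_itv/= -ea -eb (le_trans (rm _ _ aj))// (le_trans h2)//.
  exact: rm.
- have [k /andP[kl nBk] ->] := D2 _ si.
  have [|a aN ea] := rx (k%:R / 2 ^+ l).
    by rewrite !mem_cat (map_f (fun k : nat => k%:R / 2 ^+ l : R)) ?orbT// mem_iota/= ltnS ltnW.
  have [|b bN eb] := rx (k.+1%:R / 2 ^+ l).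
    by rewrite !mem_cat (map_f (fun k : nat => k%:R / 2 ^+ l : R)) ?orbT// mem_iota.
  have ab : (a <= b)%N.
    by apply: rS => //; rewrite ea eb ler_pM2r ?invr_gt0// ler_nat.
  rewrite /= -ea -eb; apply: process_cellsF => // j /andP[aj jb] C mC.
  apply: (sigma_field_preim (Y := W)) => // sb.
  have jN : (j < N)%N by exact: leq_trans jb bN.
  (* The midpoint of a nondegenerate cell is interior to block [k], hence in no other block of level
     [l]. *)
  have rj := rlt _ jN; pose x := (r j + r j.+1) / 2.
  have x1 : r j < x by rewrite /x; lra.
  have x2 : x < r j.+1 by rewrite /x; lra.
  have kx : k%:R / 2 ^+ l < x by rewrite -ea (le_lt_trans (rm _ _ aj)).
  have xk : x < k.+1%:R / 2 ^+ l by rewrite -eb (lt_le_trans x2)// rm.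
  have /dyP[k' [_ Bk' /andP[h1 h2]]] : dy l B x by apply: sb; rewrite /= in_itv/= !ltW.
  have e : k' = k.
    apply/eqP; rewrite eqn_leq -ltnS -[(k <= k')%N]ltnS; apply/andP; split.
      by have := le_lt_trans h1 xk; rewrite ltr_pM2r ?invr_gt0// ltr_nat.
    by have := lt_le_trans kx h2; rewrite ltr_pM2r ?invr_gt0// ltr_nat.
  by rewrite -e Bk' in nBk.
Qed.

Variables (psi : G -> R) (q : nat -> G).
Hypothesis bpsi : bmeas (psi : borel G -> R).

Lemma process_energy l B :
  (forall k : nat, {ae mu (k%:R / 2 ^+ l), forall x, cl q x}) ->
  exists K be, [/\ chain q (2 ^ l) K be,
    forall i, (i < 2 ^ l)%N -> isb (B i) (mu (1 / 2 ^+ l)) (be i) &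
    cond_energy P (process_field Y (dy l B)) (psi \o Y 0 1) =
      (\int[K (2 ^ l)%N]_z (psi z.1 * psi z.2))%:E].
Proof.
move=> qp; have p2 := pow2_gt0 R l.
have nn (k : nat) : 0 <= k%:R / 2 ^+ l :> R by rewrite divr_ge0// ltW.
pose r (k : nat) : R := k%:R / 2 ^+ l.
have rm : {homo r : i j / (i <= j)%N >-> i <= j}.
  by move=> i j ij; rewrite ler_pM2r ?invr_gt0// ler_nat.
have r0 : r 0%N = 0 by rewrite /r mul0r.
have rS k : r k.+1 = r k + 1 / 2 ^+ l by rewrite /r -mulrDl natr1.
have rB k : r k.+1 - r k = 1 / 2 ^+ l by rewrite rS addrC addKr.
pose p k := mu (r k).
have n1 : 0 <= 1 / 2 ^+ l :> R by exact: (nn 1%N).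
have p0 : {ae p 0%N, forall x, x = point :> G} by rewrite /p r0; exact: mu0_ae.
have /(_ _)/cid-/all_sig[m hm] k : exists m : G * G -> G,
    hasLaw (p k \x mu (1 / 2 ^+ l))%E (m : borel G * borel G -> borel G) (p k.+1) /\
    {ae (p k \x mu (1 / 2 ^+ l))%E, forall z, umul z.1 z.2 = Some (m z)}.
  by apply/is_convP; rewrite /p rS; exact: (conv_semigroupD Hmu (nn k) n1).
pose x (k : nat) : O -> G := Y (r k) (r k.+1).
have ix : iid (mu (1 / 2 ^+ l)) P x.
  split=> [k|]; last exact: process_mono.
  by have := process_law (nn k) (rm _ _ (leqnSn k)); rewrite rB.
have [|i k iM h|K [be [cK hbe hK]]] := block_chain p0 hm ix (A := B) (t := id) (M := (2 ^ l)%N) (b := B) qp (erefl _).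
- by [].
- by rewrite (_ : k = i)//; apply/eqP; rewrite eqn_leq andbC -ltnS.
exists K, be; split => //.
  by move=> i iM; have := hbe i iM; rewrite subSnn /p /r.
have mx k : measurable_fun setT (x k : O -> borel G) by exact: measurable_funP.
have r2 : r (2 ^ l)%N = 1 by rewrite /r natrX divff// gt_eqF.
apply: (setting_energy p0 hm ix (A := B) (N := (2 ^ l)%N)) => //.
- by apply: sigma_field_subsig => // k; exact: measurable_funP.
- move=> k kn Bk C mC.
  apply: (sigma_field_preim (Y := fun uv : R * R => Y uv.1 uv.2 : O -> borel G) (i := (r k, r k.+1))) => //=.
  split; first exact: rm.
  by move=> y yk; exists k.
- apply: indepS_sub (@process_field_indep l B) => //.
  apply: smallest_sub; first exact: smallest_sigma_algebra.
  move=> C rC; have {rC} : sigma_field P (x : nat -> O -> borel G) [set k | (k < 2 ^ l)%N /\ ~~ B k] C.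
    by move: rC => /rects_sub_sigma_field; exact.
  move: C.
  apply: sigma_field_min; first by apply: sigma_field_subsig => // uv; exact: measurable_funP.
  move=> k C [kl nBk] mC.
  apply: (sigma_field_preim (Y := fun uv : R * R => Y uv.1 uv.2 : O -> borel G) (i := (r k, r k.+1))) => //=.
  by exists k => //; rewrite kl.
- have h k : {ae P, forall w, up (fun k => x k w) k = Some (Y 0 (r k) w : G)}.
    elim: k => [|k IH].
      by rewrite r0; apply: aeS (process_diag (lexx 0)) => w /= ->.
    apply: aeS2 IH (indep_process_mul HY (lexx 0) (nn k) (rm _ _ (leqnSn k))) => w /= ->.
    by [].
  by rewrite -[1]r2; exact: h.
- by apply: (bmeas_comp bpsi); exact: measurable_funP.
Qed.

End process.

(** * Limits of energies *)

Lemma cvg_shift (R : realType) k (u : nat -> R) (l : R) :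
  (u (n + k)%N @[n --> \oo] --> l) <-> (u n @[n --> \oo] --> l).
Proof. by rewrite -(cvg_shiftn k u (nbhs l)). Qed.

Section energy_limits.
Context (R : realType) (G : undergroupType R).
Local Notation dist2 := (sumd (@mdist R G) (@mdist R G)).
Local Notation B2 := (borel G * borel G)%type.
Variable mu : R -> probability (borel G) R.
Hypothesis Hmu : conv_semigroup mu.

(** The joint laws of a chain depend on the kinds of the blocks, the marginals only on the
    convolutions. They are needed to know that [psi] is continuous at almost every end point of
    either path. *)
Lemma chain_marg (p al : nat -> probability (borel G) R) (q : nat -> G) M
    (K be : nat -> probability B2 R) (b : nat -> bool) :
  {ae p 0%N, forall x, x = point :> G} -> (forall j, is_conv (p j) (al j) (p j.+1)) ->
  chain q M K be -> (forall j, (j < M)%N -> isb (b j) (al j) (be j)) ->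
  forall j, (j <= M)%N -> hasLaw (K j) fst (p j) /\ hasLaw (K j) snd (p j).
Proof.
move=> p0 pS cK hb.
have const (X : B2 -> borel G) : measurable_fun setT X -> {ae K 0%N, forall z, X z = point} ->
    hasLaw (K 0%N) X (p 0%N).
  move=> mX hX; have hc : hasLaw (p 0%N) ((fun=> point) : borel G -> borel G) (p 0%N).
    by apply: (hasLaw_aeE (hasLaw_id _) (@measurable_cst _ _ _ _ _ _)); apply: aeS p0 => x ->.
  have hk : hasLaw (K 0%N) ((fun=> point) : B2 -> borel G) (p 0%N).
    split; first exact: measurable_cst.
    move=> B mB; rewrite -(hc.2 _ mB) !preimage_cst.
    by case: ifP => _; rewrite ?measure0//; transitivity (1%E : \bar R); [|apply: esym]; exact: probT.
  by apply: (hasLaw_aeE hk mX); apply: aeS hX => z ->.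
elim=> [_|j IH jM].
  split; apply: const; [exact: measurable_fst| |exact: measurable_snd|].
    by apply: aeS (chain0 cK) => z ->.
  by apply: aeS (chain0 cK) => z ->.
have [h1 h2] := IH (ltnW jM); have [g1 g2] := isb_marg (hb j jM).
have [s _] := chainS cK jM.
have [m [lm em]] := (is_convP _ _ _).1 (pS j).
have out (f : B2 -> borel G) : measurable_fun setT f -> hasLaw (K j) f (p j) -> hasLaw (be j) f (al j) ->
    {ae st_P s, forall w, umul (f (@st_z _ _ _ _ _ s w) : G) (f (@st_s _ _ _ _ _ s w) : G) = Some (f (@st_z' _ _ _ _ _ s w) : G)} ->
    hasLaw (K j.+1) f (p j.+1).
  move=> mf hK hbe hmul.
  have hj := hasLaw_comp (st_joint s) (hasLaw_prod_map hK hbe).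
  apply: (hasLaw_factor (st_out s) mf).
  apply: (hasLaw_aeE (hasLaw_comp hj lm)); first exact: (measurableT_comp mf (st_out s).1).
  by apply: aeS2 hmul (hasLaw_ae hj em) => w /= -> [].
split; [apply: out h1 g1 _ => //|apply: out h2 g2 _ => //].
- by apply: aeS (st_mul s) => w [].
- by apply: aeS (st_mul s) => w [].
Qed.

Lemma semigroup_conv (tm : nat -> R) : {homo tm : i j / (i <= j)%N >-> i <= j} -> tm 0%N = 0 ->
  forall j, is_conv (mu (tm j)) (mu (tm j.+1 - tm j)) (mu (tm j.+1)).
Proof.
move=> tmm t0 j.
have h1 : 0 <= tm j by rewrite -t0; exact: tmm.
have h2 : 0 <= tm j.+1 - tm j by rewrite subr_ge0; exact: tmm.
by have := conv_semigroupD Hmu h1 h2; rewrite subrKC.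
Qed.

Lemma tight_cl_seq (a : nat -> probability (borel G) R) : (forall n, tight (a n)) ->
  exists q, forall n, {ae a n, forall x, cl q x}.
Proof.
move=> ta; have /(_ _)/cid-/all_sig[q hq] n := tight_cl (ta n).
have [q' h] := cl_merge q; exists q' => n.
by apply: aeS (hq n) => x; exact: h.
Qed.

(** Cut points of a partition of the [2 ^ l] blocks into [M] runs. Runs may be empty, as happens in
    [energy_avoid] for [t] near 0 or 1. *)
Definition bp l (t : nat -> nat) M := [/\ t 0%N = 0%N, {homo t : i j / (i <= j)%N} & t M = (2 ^ l)%N].

Let rt l (t : nat -> nat) k : R := (t k)%:R / 2 ^+ l.

Let rt_homo l M t : bp l t M -> {homo rt l t : i j / (i <= j)%N >-> i <= j} /\ rt l t 0%N = 0.
Proof.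
move=> [t0 tm _]; split; last by rewrite /rt t0 mul0r.
by move=> i j ij; rewrite ler_pM2r ?invr_gt0 ?pow2_gt0// ler_nat tm.
Qed.

Let rtB l M t j : bp l t M -> rt l t j.+1 - rt l t j = (t j.+1 - t j)%:R / 2 ^+ l.
Proof. by move=> [_ tm _]; rewrite -mulrBl natrB// tm. Qed.

Let mu_tight t : 0 <= t -> tight (mu t).
Proof. by move=> t0; exact: sigma_compact_tight (conv_semigroup_M Hmu t0). Qed.

Lemma block_marg q l t M b K be : bp l t M -> chain q M K be ->
  (forall i, (i < M)%N -> isb (b i) (mu ((t i.+1 - t i)%:R / 2 ^+ l)) (be i)) ->
  hasLaw (K M) fst (mu 1) /\ hasLaw (K M) snd (mu 1).
Proof.
move=> bt cK hb; have [rm r0] := rt_homo bt.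
have p0 : {ae mu (rt l t 0%N), forall x, x = point :> G} by rewrite r0; exact: mu0_ae.
have := chain_marg p0 (semigroup_conv rm r0) cK (b := b) _ (leqnn M).
have -> : rt l t M = 1.
  by rewrite /rt; have [_ _ ->] := bt; rewrite natrX divff// gt_eqF// pow2_gt0.
apply.
by move=> j jM; rewrite (rtB _ bt); exact: hb.
Qed.

Lemma block_chain_exists q l t M (b : nat -> bool) : bp l t M ->
  (forall k : nat, {ae mu (k%:R / 2 ^+ l), forall x, cl q x}) ->
  exists K be, chain q M K be /\
    forall i, (i < M)%N -> isb (b i) (mu ((t i.+1 - t i)%:R / 2 ^+ l)) (be i).
Proof.
move=> bt qm; have [rm r0] := rt_homo bt.
have p0 : {ae mu (rt l t 0%N), forall x, x = point :> G} by rewrite r0; exact: mu0_ae.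
have /(_ _)/cid-/all_sig[be hbe] i := isb_ex (b i) (mu (rt l t i.+1 - rt l t i)).
have [j|j|K [cK _ _]] := conv_chain p0 (semigroup_conv rm r0) (q := q) _ _ hbe.
- exact: qm.
- by rewrite (rtB _ bt); exact: qm.
exists K, be; split => // i iM; have := hbe i; by rewrite (rtB _ bt).
Qed.

Section discrete_limits.
Variable mun : nat -> probability (borel G) R.
Hypothesis HmunM : forall n, (0 < n)%N -> sigma_compact_supported (mun n).
Hypothesis Hmun : forall n, (0 < n)%N -> conv_defined (mun n) (mun n).
Hypothesis Hcvg : forall k l : nat,
  KR (conv_pow (mun n) (k * 2 ^ (n - l))) (mu (k%:R / 2 ^+ l)) @[n --> \oo] --> (0 : R).
Variable psi : G -> R.
Hypothesis bpsi : bmeas (psi : borel G -> R).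
Hypothesis psi_continuous : {ae mu 1, forall f : G, {for f, continuous psi}}.
Hypothesis psi_norm : \int[mu 1]_f `|psi f| ^+ 2 = 1.
Variable c : nat -> R.
Hypothesis Hc : forall n, c n = \int[conv_pow (mun n) (2 ^ n)]_f `|psi f| ^+ 2.

(** Indices start at [n.+1] since [mun n] is constrained for positive [n]. *)
Definition carrier q := (forall n k, {ae conv_pow (mun n.+1) k, forall x, cl q x}) /\
  forall l k : nat, {ae mu (k%:R / 2 ^+ l), forall x, cl q x}.

(** The additional sequence [a] admits the laws at the possibly non-dyadic times [t] and [1 - t]. *)
Lemma carrier_exists (a : nat -> probability (borel G) R) : (forall n, tight (a n)) ->
  exists q, carrier q /\ forall n, {ae a n, forall x, cl q x}.
Proof.
move=> ta; pose f (i : nat * nat * nat) : probability (borel G) R :=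
  if i.1.1 is k.+1 then if k is _.+1 then a i.2 else mu (i.2%:R / 2 ^+ i.1.2)
  else conv_pow (mun i.1.2.+1) i.2.
have tf i : tight (f i).
  case: i => -[[|[|k]] n] j; last exact: ta.
    by have [] := conv_powP (sigma_compact_tight (HmunM (ltn0Sn n))) (Hmun (ltn0Sn n)) j.
  by apply: mu_tight; rewrite divr_ge0// ltW// pow2_gt0.
have [|q hq] := @tight_cl_seq (fun n => f (odflt (0, 0, 0)%N (unpickle n))); first by [].
have {}hq i : {ae f i, forall x, cl q x} by have := hq (pickle i); rewrite pickleK.
exists q; split; first split.
- by move=> n k; exact: (hq (0, n, k)%N).
- by move=> l k; exact: (hq (1, l, k)%N).
- by move=> n; exact: (hq (2, 0, n)%N).
Qed.

Let psi_ae q K : hasLaw K fst (mu 1) -> hasLaw K snd (mu 1) ->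
  {ae (K : probability B2 R), forall z, {for z.1, continuous psi} /\ {for z.2, continuous psi}} /\
  ({ae mu 1, forall x, cl q x} -> carried q K).
Proof.
move=> h1 h2; split; last by move=> h; exact: marg_carried h1 h2 h.
by apply: aeS2 (hasLaw_ae h1 psi_continuous) (hasLaw_ae h2 psi_continuous).
Qed.

Let diag_int al (K : probability B2 R) : isb true al K ->
  \int[K]_z (psi z.1 * psi z.2) = \int[al]_x `|psi x| ^+ 2.
Proof.
move=> /= h; rewrite (hasLaw_int h (bmeas_psi2 bpsi)); apply: eq_Rintegral => x _ /=.
by rewrite real_normK ?num_real.
Qed.

(** The square of [psi] is [psi z.1 * psi z.2] on the diagonal, so [wcv_psi] applies to the diagonal
    images of the laws at time 1. *)
Lemma c_cvg1 : c n @[n --> \oo] --> (1 : R).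
Proof.
have [q [[q1 q2] _]] := carrier_exists (fun=> mu_tight (lexx 0)).
have /(_ _)/cid-/all_sig[bes hbes] n := isb_ex true (conv_pow (mun n.+1) (2 ^ n.+1)).
have [be hbe] := isb_ex true (mu 1).
have q21 : {ae mu 1, forall x, cl q x} by have := q2 0%N 1%N; rewrite expr0 divr1.
have kr : KR (conv_pow (mun n.+1) (2 ^ n.+1)) (mu 1) @[n --> \oo] --> (0 : R).
  have := Hcvg 1 0; rewrite expr0 divr1 => h.
  have := (cvg_shift 1 _ _).2 h; apply: cvg_trans; apply: near_eq_cvg.
  by near=> n; rewrite addn1 mul1n subn0.
have [h1 h2] := isb_marg hbe.
have [pa pc] := psi_ae q h1 h2.
have cs n : carried q (bes n) by have [g1 g2] := isb_marg (hbes n); exact: marg_carried g1 g2 (q1 n _).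
have := wcv_psi bpsi (krc_wcv (krc_isb hbes hbe (fun n => q1 n _) q21 kr)) cs (pc q21) pa.
rewrite (diag_int hbe) psi_norm => h; apply/(cvg_shift 1 _ _).1.
apply: cvg_trans h; apply: near_eq_cvg; near=> n.
by rewrite addn1 (diag_int (hbes n)) -Hc.
Unshelve. all: by end_near. Qed.

Section energy.
Context (d : nat -> measure_display) (Omega : forall n, measurableType (d n))
  (P : forall n, probability (Omega n) R)
  (P_complete : forall n, (0 < n)%N -> measure_is_complete (P n))
  (X : forall n, int -> {RV (P n) >-> borel G})
  (HX : forall n, (0 < n)%N -> discrete_process (mun n) (X n))
  (nun : nat -> probability (borel (closed01 R)) R)
  (Hnun : forall n, (0 < n)%N -> 0 < c n ->
    is_spectral_measure n (X n) (fun f => (Num.sqrt (c n))^-1 * psi f) (nun n)).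

Definition inside l B : set (closed01 R) := [set S | (S : set R) `<=` dy l B].

Lemma energy_cvg q l B t M (b : nat -> bool) K be : carrier q -> bp l t M ->
  (forall i k, (i < M)%N -> (t i <= k < t i.+1)%N -> B k = b i) ->
  chain q M K be ->
  (forall i, (i < M)%N -> isb (b i) (mu ((t i.+1 - t i)%:R / 2 ^+ l)) (be i)) ->
  fine (nun n (inside l B)) @[n --> \oo] --> \int[K M]_z (psi z.1 * psi z.2).
Proof.
move=> [q1 q2] bt tb cK hb; have [t0 tm tM] := bt.
(* Pitches from level [l.+1] on: positive, as the hypotheses on [mun] require, and fine enough for
   masks of level [l]. *)
pose s n := (n + l)%N.+1.
pose chi n f := (Num.sqrt (c n))^-1 * psi f.
have bchi n : bmeas (chi n : borel G -> R) by exact: bmeasZ.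
have /(_ _)/cid-/all_sig[Ks] n := discrete_energy (sigma_compact_tight (HmunM (ltn0Sn (n + l))))
  (Hmun (ltn0Sn (n + l))) (P_complete (ltn0Sn (n + l))) (HX (ltn0Sn (n + l))) (bchi (s n)) (q1 (n + l)%N)
  (leqW (leq_addl n l)) t0 (fun i => tm _ _ (leqnSn i)) tM tb.
move=> /(_ _)/cid-/all_sig[bes] /all_and3[cs hbs es].
have krs i : (i < M)%N -> krc q (fun n => bes n i) (be i).
  move=> iM; apply: (krc_isb (fun n => hbs n i iM) (hb i iM)).
  - by move=> n; exact: q1.
  - exact: q2.
  - by have := (cvg_shift l.+1 _ _).2 (Hcvg (t i.+1 - t i) l); rewrite (_ : (fun n => _) = (fun n => KR (conv_pow (mun (n + l).+1) ((t i.+1 - t i) * 2 ^ ((n + l).+1 - l))) (mu ((t i.+1 - t i)%:R / 2 ^+ l))))//; apply/funext => n; rewrite addnS.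
have [h1 h2] := block_marg bt cK hb; have [pa pc] := psi_ae q h1 h2.
have cM : carried q (K M) := chain_K cK (leqnn M).
have csM n : carried q (Ks n M) := chain_K (cs n) (leqnn M).
have lim := wcv_psi bpsi (chain_wcv cs cK krs) csM cM pa.
apply/(cvg_shift l.+1 _ _).1.
have c1 := (cvg_shift l.+1 _ _).2 c_cvg1.
(* The normalization in [chi] enters squared and contributes the inverse of [c], which tends to
   1. *)
have lim2 : (c (n + l.+1)%N)^-1 * \int[Ks n M]_z (psi z.1 * psi z.2) @[n --> \oo] -->
    1^-1 * \int[K M]_z (psi z.1 * psi z.2).
  by apply: cvgM => //; apply: cvgV => //; exact: oner_neq0.
rewrite invr1 mul1r in lim2; apply: cvg_trans lim2; apply: near_eq_cvg.
have cpos : \forall n \near \oo, 0 < c (n + l.+1)%N.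
  apply: filterS ((cvgrPdist_lt _ _).1 c1 _ ltr01) => n /=.
  by rewrite ltr_norml => /andP[_]; rewrite ltrBlDr addrC -ltrBlDr subrr.
near=> n.
have cn : 0 < c (s n) by rewrite /s -addnS; near: n.
pose A := [set k : 'I_(2 ^ (s n)) | B (k %/ 2 ^ (s n - l))%N]%SET.
have eA : dyadic_union R A = dy l B.
  rewrite (@dy_refine R l (s n) B) ?leqW ?leq_addl//.
  exact: (@dyE R (s n) (fun k => B (k %/ 2 ^ (s n - l))%N)).
have [_ /(_ A)] := Hnun (ltn0Sn (n + l)) cn.
rewrite eA.
rewrite [X in _ = X -> _](es n) addnS => -> /=.
have b1 := bmeas_psi2 bpsi; rewrite -intZ//.
apply: eq_Rintegral => z _; rewrite /chi mulrACA -invfM -expr2 sqr_sqrtr// ltW//.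
Unshelve. all: by end_near. Qed.

(** Defined from the discrete spectral measures and not from a chain: any limit chain representing
    the mask, for any block partition, then has the same integral by uniqueness of limits
    ([energy_uniq]). *)
Definition energy l B : R := lim (fine (nun n (inside l B)) @[n --> \oo]).

Let tu l i := minn i (2 ^ l).

Let bpu l : bp l (tu l) (2 ^ l).
Proof.
split; [by rewrite /tu min0n| |by rewrite /tu minnn].
by move=> i j ij; rewrite /tu leq_min geq_minr andbT (leq_trans (geq_minl _ _)).
Qed.

Let tuS l i : (i < 2 ^ l)%N -> (tu l i.+1 - tu l i = 1)%N.
Proof. by move=> h; rewrite /tu (minn_idPl h) (minn_idPl (ltnW h)) subSnn. Qed.

Let tub l B i k : (i < 2 ^ l)%N -> (tu l i <= k < tu l i.+1)%N -> B k = B i :> bool.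
Proof.
move=> h; rewrite /tu (minn_idPl h) (minn_idPl (ltnW h)) ltnS => h'.
by congr B; apply/eqP; rewrite eqn_leq andbC.
Qed.

Lemma energyP l B : fine (nun n (inside l B)) @[n --> \oo] --> energy l B.
Proof.
have [q [cq _]] := carrier_exists (fun=> mu_tight (lexx 0)).
have [K [be [cK hb]]] := block_chain_exists B (bpu l) (cq.2 l).
have h := energy_cvg cq (bpu l) (@tub l B) cK hb.
by apply/cvg_ex; eexists; exact: h.
Qed.

Lemma energy_uniq q l B t M (b : nat -> bool) K be : carrier q -> bp l t M ->
  (forall i k, (i < M)%N -> (t i <= k < t i.+1)%N -> B k = b i) ->
  chain q M K be ->
  (forall i, (i < M)%N -> isb (b i) (mu ((t i.+1 - t i)%:R / 2 ^+ l)) (be i)) ->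
  energy l B = \int[K M]_z (psi z.1 * psi z.2).
Proof. by move=> cq bt tb cK hb; apply: cvg_lim (energy_cvg cq bt tb cK hb). Qed.

Lemma energy_process d' (O' : measurableType d') (P' : probability O' R)
    (Y : R -> R -> {RV P' >-> borel G}) l B : measure_is_complete P' -> indep_process mu Y ->
  cond_energy P' (process_field Y (dy l B)) (psi \o Y 0 1) = (energy l B)%:E.
Proof.
move=> Pc HY; have [q [cq _]] := carrier_exists (fun=> mu_tight (lexx 0)).
have [K [be [cK hb ->]]] := process_energy Hmu Pc HY bpsi (l := l) B (cq.2 l).
congr (_ %:E); apply/esym/(energy_uniq cq (bpu l) (@tub l B) cK).
by move=> i il; rewrite (tuS il); exact: hb.
Qed.

(** The block given by truncation and its left neighbour: both contain [t] when [t] is an inner grid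
    point, and for [t = 1] only the left one lies in the unit interval. *)
Definition near_block l (t : R) k :=
  ((Num.trunc (t * 2 ^+ l)).-1 <= k < (Num.trunc (t * 2 ^+ l)).+1)%N.

(** With three runs the number of blocks is bounded in [l]. The middle run has length tending to 0,
    so it disappears in the limit, where the two paths coincide and the energy is the integral of
    [psi ^ 2], which is 1. *)
Lemma energy_avoid t : 0 <= t <= 1 ->
  energy l (fun k => ~~ near_block l t k) @[l --> \oo] --> (1 : R).
Proof.
move=> /andP[t0 t1].
have a1 : 0 <= 1 - t by rewrite subr_ge0.
pose a n := if n is 0%N then mu t else mu (1 - t).
have [|q [cq qa]] := @carrier_exists a; first by case=> [|n]; exact: mu_tight.
pose T l := Num.trunc (t * 2 ^+ l).
have tp l : 0 <= t * 2 ^+ l by rewrite mulr_ge0// ltW// pow2_gt0.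
have T1 l : (T l)%:R <= t * 2 ^+ l by have /andP[] := trunc_itv (tp l).
have T2 l : t * 2 ^+ l < (T l).+1%:R by have /andP[] := trunc_itv (tp l).
have Tl l : (T l <= 2 ^ l)%N.
  by rewrite -(ler_nat R) natrX (le_trans (T1 l))// ler_piMl// ltW// pow2_gt0.
pose ti l k := if k is k'.+1 then if k' is k''.+1 then if k'' is _.+1 then (2 ^ l)%N
  else minn (T l).+1 (2 ^ l) else (T l).-1 else 0%N.
have bti l : bp l (ti l) 3.
  split => //; apply: homo_leq => // [x y z|[|[|[|i]]]] //=; first exact: leq_trans.
    by rewrite leq_min (leq_trans (leq_pred _))// (leq_trans (leq_pred _)).
  exact: geq_minr.
pose b k := k != 1%N.
have tib l i k : (i < 3)%N -> (ti l i <= k < ti l i.+1)%N -> ~~ near_block l t k = b i.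
  rewrite /near_block -/(T l); case: i => [|[|[|//]]] _ /=.
  - move=> h2; by rewrite [(_ <= k)%N]leqNgt h2.
  - move=> /andP[h1 h2]; by rewrite h1 (leq_trans h2)// geq_minl.
  - move=> /andP[h1 h2]; move: h1; rewrite geq_min => /orP[h|h]; last by rewrite leqNgt h2 in h.
    by rewrite negb_and -leqNgt h orbT.
have /(_ _)/cid-/all_sig[Ks] l := block_chain_exists b (bti l) (cq.2 l).
move=> /(_ _)/cid-/all_sig[bes] /all_and2[cs hbs].
pose tm k : R := if k is k'.+1 then if k' is k''.+1 then if k'' is _.+1 then 1 else t else t else 0.
have tmm : {homo tm : i j / (i <= j)%N >-> i <= j}.
  by apply: homo_leq => // [x y z|[|[|[|i]]]] //=; exact: le_trans.
have p0 : {ae mu (tm 0%N), forall x, x = point :> G} by exact: mu0_ae.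
have qm0 : {ae mu 0, forall x, cl q x} by have := cq.2 0%N 0%N; rewrite mul0r.
have qm1 : {ae mu 1, forall x, cl q x} by have := cq.2 0%N 1%N; rewrite expr0 divr1.
have /(_ _)/cid-/all_sig[K hK] i := isb_ex true (mu (tm i)).
have /(_ _)/cid-/all_sig[be hbe] i := isb_ex true (mu (tm i.+1 - tm i)).
have cK : chain q 3 K be.
  apply: (diag_chain p0 (semigroup_conv tmm (erefl _)) _ _ hK hbe).
  - by case=> [|[|[|j]]] //=; exact: (qa 0%N).
  - case=> [|[|[|j]]] /=; rewrite ?subr0 ?subrr //; [exact: (qa 0%N)|exact: (qa 1%N)].
have p2i l : 0 < (2 ^+ l)^-1 :> R by rewrite invr_gt0 pow2_gt0.
have cv0 : (2 ^+ l)^-1 @[l --> \oo] --> (0 : R).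
  rewrite (_ : (fun l => (2 ^+ l)^-1) = (fun l => 2^-1 ^+ l)); last by apply/funext => l; rewrite exprVn.
  apply: cvg_expr.
  by rewrite ger0_norm ?invr_ge0// invf_lt1// ltr1n.
have lt1 l : (T l).-1%:R / 2 ^+ l <= t.
  rewrite ler_pdivrMr ?pow2_gt0// (le_trans _ (T1 l))// ler_nat; exact: leq_pred.
have lt2 l : t - 2 * (2 ^+ l)^-1 <= (T l).-1%:R / 2 ^+ l.
  rewrite ler_pdivlMr ?pow2_gt0// mulrBl -mulrA mulVf ?gt_eqF ?pow2_gt0// mulr1.
  have : (T l).+1%:R <= (T l).-1%:R + 2 :> R by rewrite -natrD ler_nat; case: (T l) => // m; rewrite addn2.
  by have := T2 l; lra.
have rt2 l : (minn (T l).+1 (2 ^ l))%:R / 2 ^+ l <= t + (2 ^+ l)^-1.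
  rewrite ler_pdivrMr ?pow2_gt0// mulrDl mulVf ?gt_eqF ?pow2_gt0//.
  rewrite (@le_trans _ _ (T l).+1%:R)// ?ler_nat ?geq_minl//.
  by rewrite -natr1 lerD2r.
have rt1 l : t <= (minn (T l).+1 (2 ^ l))%:R / 2 ^+ l.
  rewrite ler_pdivlMr ?pow2_gt0// /minn; case: ifP => _; first exact: ltW.
  by rewrite natrX ler_piMl// ltW// pow2_gt0.
have sandwich (u : nat -> R) x A : (forall l, x - A * (2 ^+ l)^-1 <= u l) ->
    (forall l, u l <= x + A * (2 ^+ l)^-1) -> u l @[l --> \oo] --> x.
  move=> h1 h2; apply: (@squeeze_cvgr _ _ _ _ (fun l => x - A * (2 ^+ l)^-1) (fun l => x + A * (2 ^+ l)^-1)).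
  - by near=> l; rewrite h1 h2.
  - rewrite -[X in _ --> X]subr0 -[X in _ - X](mulr0 A).
    by apply: cvgB; [exact: cvg_cst|apply: cvgM => //; exact: cvg_cst].
  - rewrite -[X in _ --> X]addr0 -[X in _ + X](mulr0 A).
    by apply: cvgD; [exact: cvg_cst|apply: cvgM => //; exact: cvg_cst].
have krs i : (i < 3)%N -> krc q (fun l => bes l i) (be i).
  move=> i3.
  have hl l : isb (b i) (mu ((ti l i.+1 - ti l i)%:R / 2 ^+ l)) (bes l i) by exact: hbs.
  have ge0 l : 0 <= (ti l i.+1 - ti l i)%:R / 2 ^+ l :> R by rewrite divr_ge0// ltW// pow2_gt0.
  have e l : (ti l i.+1 - ti l i)%:R / 2 ^+ l = (ti l i.+1)%:R / 2 ^+ l - (ti l i)%:R / 2 ^+ l :> R.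
    by rewrite -mulrBl natrB//; have [_ h _] := bti l; exact: h.
  have lim : (ti l i.+1 - ti l i)%:R / 2 ^+ l @[l --> \oo] --> tm i.+1 - tm i.
    (* The first inner cut point is at most [2 / 2 ^ l] below [t], the second at most [1 / 2 ^ l]
       above it, so the lengths are off by at most [3 / 2 ^ l]. *)
    apply: (sandwich _ _ 3) => l; rewrite e; have := p2i l; have := lt1 l; have := lt2 l;
      have := rt1 l; have := rt2 l;
      have e2 : (2 ^ l)%:R / 2 ^+ l = 1 :> R by rewrite natrX divff// gt_eqF// pow2_gt0.
      by case: i {hl ge0 e} i3 => [|[|[|//]]] _ /=; rewrite ?mul0r ?e2; lra.
    by case: i {hl ge0 e} i3 => [|[|[|//]]] _ /=; rewrite ?mul0r ?e2; lra.
  have hbi : isb (b i) (mu (tm i.+1 - tm i)) (be i).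
    case: i {hl ge0 e lim} i3 => [|[|[|//]]] _; [exact: (hbe 0%N)| |exact: (hbe 2%N)].
    (* The run around [t] is off the mask, but its limit law is a product of two unit masses, which
       is also the diagonal image of [mu 0]: the limit chain may treat it as common to both
       paths. *)
    have := hbe 1%N; rewrite /= subrr => hd.
    have h1 := hasLaw_comp (hasLaw_fst (mu 0) (mu 0)) hd.
    apply: hasLaw_uniq (hasLaw_id _).
    apply: (hasLaw_aeE h1) => //; have m0 := mu0_ae Hmu.
    apply: aeS2 (hasLaw_ae (hasLaw_fst _ _) m0) (hasLaw_ae (hasLaw_snd _ _) m0) => -[x y] /= -> ->.
    by [].
  apply: (krc_isb hl hbi).
  - by move=> l; exact: cq.2.
  - by case: i {hl ge0 e lim hbi} i3 => [|[|[|//]]] _ /=; rewrite ?subr0 ?subrr //; [exact: (qa 0%N)|exact: (qa 1%N)].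
  - by apply: (KR_semigroup_cvg Hmu) => //; rewrite subr_ge0; exact: tmm.
have [h1 h2] := isb_marg (hK 3%N); have [pa pc] := psi_ae q h1 h2.
have := wcv_psi bpsi (chain_wcv cs cK krs) (fun l => chain_K (cs l) (leqnn 3)) (pc qm1) pa.
rewrite (diag_int (hK 3%N)) psi_norm; apply: cvg_trans; apply: near_eq_cvg; near=> l.
exact/esym/(energy_uniq cq (bti l) (tib l) (cs l) (hbs l)).
Unshelve. all: by end_near. Qed.

End energy.
End discrete_limits.
End energy_limits.

(** * A random binary word with prescribed law *)

(** The uniform law on [[0, 1[], which serves as the probability space for the limit set. *)
Definition lebesgue01 (R : realType) : set (measurableTypeR R) -> \bar R :=
  mrestr (@lebesgue_measure R) (measurable_itv `[0, 1[).

HB.instance Definition _ (R : realType) := Measure.on (@lebesgue01 R).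

Lemma lebesgue01_itv (R : realType) (x y : R) : 0 <= x -> x <= y -> y <= 1 ->
  lebesgue01 `[x, y[%classic = (y - x)%:E.
Proof.
move=> x0 xy y1; rewrite /lebesgue01 /mrestr.
rewrite (_ : `[x, y[%classic `&` _ = `[x, y[%classic); last first.
  apply/seteqP; split=> [z []//|z /=]; rewrite !in_itv/= => /andP[xz zy].
  by rewrite xz zy (le_trans x0) ?(lt_le_trans zy).
rewrite lebesgue_measure_itv/= lte_fin lt_neqAle xy andbT -EFinB.
by case: eqP => //= ->; rewrite subrr.
Qed.

Lemma lebesgue01_setT (R : realType) : lebesgue01 [set: measurableTypeR R] = 1%E.
Proof.
rewrite -[1%E]/((1 : R)%:E) -[X in X%:E]subr0 -lebesgue01_itv//.
by rewrite /lebesgue01 /mrestr setTI setIid.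
Qed.

HB.instance Definition _ (R : realType) :=
  Measure_isProbability.Build _ _ _ (@lebesgue01 R) (@lebesgue01_setT R).

Section words.
Context (T : Type) (C : nat -> set T).

(** The latest letter comes first, so that one more letter is a cons and cylinders split by
    recursion; [word] has the usual order. *)
Fixpoint rword k (x : T) : seq bool :=
  if k is k'.+1 then `[< C k' x >] :: rword k' x else [::].

Definition word k x := mkseq (fun i => `[< C i x >]) k.

Lemma rev_rword k x : rev (rword k x) = word k x.
Proof. by elim: k => [//|k IH]; rewrite /word mkseqS /= rev_cons IH. Qed.

Definition cyl (w : seq bool) : set T := [set x | rword (size w) x = w].

Lemma cyl_cons b w x : cyl (b :: w) x <-> cyl w x /\ (C (size w) x <-> b).
Proof.
rewrite /cyl /=; split=> [[<- ->]|[-> h]]; first by split => //; split => /asboolP.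
by congr (_ :: _); apply/idP/idP => [/asboolP/h|/h/asboolP].
Qed.

End words.

Section words_measure.
Context (R : realType) d (T : measurableType d) (C : nat -> set T).
Hypothesis mC : forall i, measurable (C i).
Implicit Types w : seq bool.

Lemma cyl_consE b w : cyl C (b :: w) = cyl C w `&` (if b then C (size w) else ~` C (size w)).
Proof.
apply/seteqP; split=> x; first by move=> /cyl_cons[? h]; split => //; case: b h => -[h1 h2]; [exact: h2|move=> /h1].
by move=> [h1 h2]; apply/cyl_cons; split => //; case: b h2.
Qed.

Lemma cyl_meas w : measurable (cyl C w).
Proof.
elim: w => [|b w IH].
  by rewrite (_ : cyl _ _ = setT)//; apply/seteqP; split.
by rewrite cyl_consE; apply: measurableI => //; case: b => //; exact: measurableC.
Qed.

Lemma cyl_indic w x : \1_(cyl C w) x = \1_(cyl C (true :: w)) x + \1_(cyl C (false :: w)) x :> R.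
Proof.
rewrite !cyl_consE !indicE !in_setI in_setC.
by case: (x \in cyl C w); case: (x \in C _); rewrite ?addr0 ?add0r.
Qed.

Lemma cyl_prob w (P : probability T R) :
  fine (P (cyl C w)) = fine (P (cyl C (true :: w))) + fine (P (cyl C (false :: w))).
Proof.
rewrite -!int_indic; try exact: cyl_meas.
rewrite -intD; try exact/bmeas_indic/cyl_meas.
by apply: eq_Rintegral => x _; exact: cyl_indic.
Qed.

(** The part on the cylinder of [w] of a function of the first [size w + k] letters; splitting off
    one letter lowers [k], down to multiples of indicators of cylinders. *)
Definition gword (g : seq bool -> R) k w x : R := \1_(cyl C w) x * g (rword C (size w + k) x).

Lemma gwordS g k w : gword g k.+1 w = fun x => gword g k (true :: w) x + gword g k (false :: w) x.
Proof. by apply/funext => x; rewrite /gword cyl_indic mulrDl /= addnS. Qed.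

Lemma gword0 g w : gword g 0 w = fun x => g w * \1_(cyl C w) x.
Proof.
apply/funext => x; rewrite /gword addn0 indicE; case: (boolP (x \in cyl C w)).
  by rewrite inE /cyl /= => ->; rewrite mulrC.
by rewrite mul0r mulr0.
Qed.

Lemma gword_bmeas g k w : bmeas (gword g k w).
Proof.
elim: k w => [|k IH] w; last by rewrite gwordS; exact: bmeasD.
by rewrite gword0; apply/bmeasZ/bmeas_indic/cyl_meas.
Qed.

Lemma gword_nil g k : gword (g \o rev) k [::] = g \o word C k.
Proof.
apply/funext => x; rewrite /gword /= add0n rev_rword (_ : cyl C [::] = setT) ?indicT ?mul1r//.
by apply/seteqP; split.
Qed.

Lemma word_bmeas (g : seq bool -> R) k : bmeas (g \o word C k).
Proof. by rewrite -gword_nil; exact: gword_bmeas. Qed.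

End words_measure.

Lemma word_cvg (R : realType) d (T : measurableType d) d' (U : measurableType d')
    (C : nat -> set T) (D : nat -> set U) (P_ : nat -> probability T R) (Q : probability U R) :
  (forall i, measurable (C i)) -> (forall i, measurable (D i)) ->
  (forall w, fine (P_ n (cyl C w)) @[n --> \oo] --> fine (Q (cyl D w))) ->
  forall k (g : seq bool -> R),
  \int[P_ n]_x g (word C k x) @[n --> \oo] --> \int[Q]_u g (word D k u).
Proof.
move=> mC mD h k g.
have hh j w : \int[P_ n]_x gword C (g \o rev) j w x @[n --> \oo] --> \int[Q]_u gword D (g \o rev) j w u.
  elim: j w => [|j IH] w.
    rewrite !gword0 intZ ?int_indic; [|exact: cyl_meas|exact/bmeas_indic/cyl_meas].
    rewrite (_ : (fun n => _) = (fun n => (g \o rev) w * fine (P_ n (cyl C w)))); last first.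
      by apply/funext => n; rewrite intZ ?int_indic//; [exact: cyl_meas|exact/bmeas_indic/cyl_meas].
    by apply: cvgM; [exact: cvg_cst|exact: h].
  rewrite !gwordS// intD; [|exact: gword_bmeas|exact: gword_bmeas].
  rewrite (_ : (fun n => _) = (fun n => \int[P_ n]_x gword C (g \o rev) j (true :: w) x +
     \int[P_ n]_x gword C (g \o rev) j (false :: w) x)); last first.
    by apply/funext => n; rewrite intD//; exact: gword_bmeas.
  by apply: cvgD; exact: IH.
by have := hh k [::]; rewrite !gword_nil.
Qed.

Section tree.
Context (R : realType) (p : seq bool -> R).
Hypothesis p_ge0 : forall w, 0 <= p w.
Hypothesis p_split : forall w, p w = p (true :: w) + p (false :: w).
Hypothesis p_nil : p [::] = 1.

Fixpoint left_end (w : seq bool) : R :=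
  if w is b :: w' then left_end w' + (if b then 0 else p (true :: w')) else 0.

(* [path_of k u] lists, last choice first, the nested intervals containing [u]; the interval of [w]
   starts at [left_end w] and has length [p w]. *)
Fixpoint path_of k (u : R) : seq bool :=
  if k is k'.+1 then (u < left_end (path_of k' u) + p (true :: path_of k' u)) :: path_of k' u
  else [::].

Lemma left_end_itv w : 0 <= left_end w /\ left_end w + p w <= 1.
Proof.
elim: w => [|b w [h1 h2]] /=; first by rewrite p_nil add0r.
have := p_ge0 (true :: w); have := p_ge0 (false :: w); have := p_split w; case: b; lra.
Qed.

Lemma path_ofP w u : 0 <= u < 1 -> path_of (size w) u = w <-> left_end w <= u < left_end w + p w.
Proof.
move=> u01; elim: w => [|b w IH] /=; first by rewrite p_nil add0r u01.
have t0 := p_ge0 (true :: w); have f0 := p_ge0 (false :: w); have ps := p_split w.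
split=> [[<- e]|].
  have /IH/andP[h1 h2] := e; rewrite e; case: (ltP u (left_end w + p (true :: w))) => h.
    by rewrite addr0 h1 h.
  by rewrite h /= -addrA -ps.
case: b => /= /andP[h1 h2].
  have -> : path_of (size w) u = w by apply/IH; apply/andP; split; lra.
  by rewrite addr0 in h2; rewrite h2.
have -> : path_of (size w) u = w by apply/IH; apply/andP; split; lra.
by rewrite ltNge h1.
Qed.

Definition branch i : set (measurableTypeR R) := [set u | head false (path_of i.+1 u)].

Lemma rword_branch k u : rword branch k u = path_of k u.
Proof.
elim: k => [//|k IH] /=; rewrite IH; congr (_ :: _).
by rewrite /branch /=; apply/asboolP/idP.
Qed.

Lemma branch_meas i : measurable (branch i).
Proof.
suff h : (forall w, measurable ([set u | path_of i u = w] : set (measurableTypeR R))).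
  rewrite (_ : branch i = \bigcup_w ([set u | path_of i u = w] `&`
     `]-oo, left_end w + p (true :: w)[%classic)); last first.
    apply/seteqP; split=> u; first by move=> hu; exists (path_of i u) => //; split => //=; rewrite in_itv.
    by move=> [w _ [/= <-]]; rewrite in_itv.
  by apply: countable_bigcupT_measurable => // w; apply: measurableI => //; exact: measurable_itv.
elim: i => [|i IH] w.
  case: w => [|b w].
    by rewrite (_ : [set u | _] = setT)//; apply/seteqP; split.
  by rewrite (_ : [set u | _] = set0)//; apply/seteqP; split.
case: w => [|b w]; first by rewrite (_ : [set u | _] = set0)//; apply/seteqP; split.
rewrite (_ : [set u | _] = [set u | path_of i u = w] `&`
   (if b then `]-oo, left_end w + p (true :: w)[%classic else `[left_end w + p (true :: w), +oo[%classic)); last first.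
  apply/seteqP; split=> u /=.
    by move=> [<- e]; split => //; rewrite e; case: ifPn => /=; rewrite in_itv/= ?andbT -?leNgt.
  by move=> [-> h]; congr (_ :: _); case: b h => /=; rewrite in_itv/= ?andbT ltNge => ->.
by apply: measurableI => //; case: b; exact: measurable_itv.
Qed.

Lemma branch_prob w : lebesgue01 (cyl branch w) = (p w)%:E.
Proof.
have [h1 h2] := left_end_itv w.
rewrite -[p w](addKr (left_end w)) [_ + (_ + _)]addrC -lebesgue01_itv//; last by rewrite lerDl.
rewrite /lebesgue01 /mrestr; congr lebesgue_measure.
apply/seteqP; split=> u /=; rewrite !in_itv/= => -[h u01]; split => //.
  by move: h; rewrite /cyl /= rword_branch => /(path_ofP _ u01).
by rewrite /cyl /= rword_branch; apply/(path_ofP _ u01).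
Qed.

End tree.

(** Convergence of the probabilities of all finite intersections gives, by inclusion-exclusion, that
    of all cylinders; the limits are additive under splitting, hence are the interval lengths of a
    binary tree in [[0, 1[]. *)
Lemma tree_exists (R : realType) d (T : measurableType d) (P_ : nat -> probability T R) (C : nat -> set T) :
  (forall i, measurable (C i)) ->
  (forall s : seq nat, cvgn (fun n => fine (P_ n (\bigcap_(i in [set` s]) C i)))) ->
  exists D : nat -> set (measurableTypeR R), (forall i, measurable (D i)) /\
  forall k (g : seq bool -> R),
  \int[P_ n]_x g (word C k x) @[n --> \oo] --> \int[@lebesgue01 R]_u g (word D k u).
Proof.
move=> mC cvC.
(* The extra intersection over [s] makes the induction work: a complemented letter is a difference
   of two terms with a shorter word. *)
have cv w (s : seq nat) : cvgn (fun n => fine (P_ n (cyl C w `&` \bigcap_(i in [set` s]) C i))).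
  have mI (t : seq nat) : measurable (\bigcap_(i in [set` t]) C i) by exact: fin_bigcap_measurable.
  elim: w s => [|b w IH] s.
    rewrite (_ : cyl C [::] = setT); last by apply/seteqP; split.
    by under eq_fun do rewrite setTI; exact: cvC.
  have bc : \bigcap_(i in [set` size w :: s]) C i = C (size w) `&` \bigcap_(i in [set` s]) C i.
    apply/seteqP; split=> [x h|x [h1 h2] i /=].
      by split=> [|i si]; apply: h; rewrite /= ?mem_head// inE (si : i \in s) orbT.
    by rewrite inE => /orP[/eqP ->//|]; exact: h2.
  case: b.
    by rewrite cyl_consE -setIA -bc; exact: IH.
  rewrite cyl_consE.
  rewrite (_ : (fun n => _) = (fun n => fine (P_ n (cyl C w `&` \bigcap_(i in [set` s]) C i)) -
      fine (P_ n (cyl C w `&` \bigcap_(i in [set` size w :: s]) C i)))).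
    by apply: is_cvgB; exact: IH.
  apply/funext => n; rewrite -!int_indic; try (apply: measurableI => //; exact: cyl_meas).
    rewrite -intB; try (apply: bmeas_indic; apply: measurableI => //; exact: cyl_meas).
    apply: eq_Rintegral => x _; rewrite bc !indicE !in_setI in_setC.
    by case: (x \in cyl C w); case: (x \in C _); case: (x \in _); rewrite /= ?subr0 ?subrr.
  by apply: measurableI => //; apply: measurableI; [exact: cyl_meas|exact: measurableC].
have cv0 w : cvgn (fun n => fine (P_ n (cyl C w))).
  have := cv w [::]; rewrite (_ : \bigcap_(i in [set` [::]]) C i = setT) ?setIT//.
  by apply/seteqP; split.
pose p w := lim (fine (P_ n (cyl C w)) @[n --> \oo]).
have p0 w : 0 <= p w by apply: limr_ge => //; near=> n; rewrite fine_ge0.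
have ps w : p w = p (true :: w) + p (false :: w).
  rewrite /p -limD//; congr (limn _); apply/funext => n; exact: (cyl_prob mC).
have pn : p [::] = 1.
  rewrite /p (_ : (fun n => _) = cst 1) ?lim_cst//; apply/funext => n.
  by rewrite (_ : cyl _ _ = setT) ?probT//; apply/seteqP; split.
exists (branch p); split; first exact: branch_meas.
move=> k g; apply: word_cvg => //; first exact: branch_meas.
by move=> w; rewrite [X in fine X](branch_prob p0 ps pn w); exact: cv0.
Unshelve. all: by end_near. Qed.

(** * The space of closed subsets of [0,1] *)

Section dyadic_geometry.
Variable R : realType.
Implicit Types (B A : nat -> bool) (x t : R).

Let p2 l : 0 < 2 ^+ l :> R := pow2_gt0 R l.

Lemma dy_int l B (k : nat) x : k%:R / 2 ^+ l < x -> x < k.+1%:R / 2 ^+ l -> dy l B x -> B k.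
Proof.
move=> h1 h2 /dyP[k' [_ Bk' /andP[g1 g2]]].
suff <- : k' = k by [].
apply/eqP; rewrite eqn_leq -ltnS -[(k <= k')%N]ltnS; apply/andP; split.
  by have := le_lt_trans g1 h2; rewrite ltr_pM2r ?invr_gt0// ltr_nat.
by have := lt_le_trans h1 g2; rewrite ltr_pM2r ?invr_gt0// ltr_nat.
Qed.

Lemma dy_sub n l A B : (l <= n)%N ->
  dy n A `<=` (dy l B : set R) <-> forall k, (k < 2 ^ n)%N -> A k -> B (k %/ 2 ^ (n - l))%N.
Proof.
move=> ln; rewrite (dy_refine R B ln); split=> [sAB k kn Ak|h x /dyP[k [kn Ak kx]]]; last first.
  by apply/dyP; exists k; split => //; exact: h.
(* The midpoint of block [k] of level [n] lies in no other block of that level. *)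
pose x : R := (k%:R + 2^-1) / 2 ^+ n.
have x1 : k%:R / 2 ^+ n < x by rewrite ltr_pM2r ?invr_gt0// ltrDl invr_gt0.
have x2 : x < k.+1%:R / 2 ^+ n.
  rewrite ltr_pM2r ?invr_gt0// -[k.+1%:R]natr1 ltrD2l.
  lra.
apply: (dy_int x1 x2 (B := fun k => B (k %/ 2 ^ (n - l))%N)); apply: sAB.
by apply/dyP; exists k; split => //; rewrite !ltW.
Qed.

Lemma dy_closed l B : closed (dy l B : set R).
Proof.
rewrite /dy; rewrite (_ : [set k | _] = [set` [seq k <- iota 0 (2 ^ l) | B k]]); last first.
  apply/seteqP; split=> k; rewrite /= mem_filter mem_iota/= add0n.
    by move=> [-> ->].
  by move=> /andP[].
by rewrite bigcup_seq; apply: closed_bigsetU => k _; exact: interval_closed.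
Qed.

Lemma dy_sub01 l B : dy l B `<=` (`[0, 1] : set R).
Proof.
move=> x /dyP[k [kl _ /andP[h1 h2]]]; rewrite /= in_itv/=; apply/andP; split.
  by rewrite (le_trans _ h1)// divr_ge0// ltW.
by rewrite (le_trans h2)// ler_pdivrMr// mul1r -natrX ler_nat.
Qed.

Definition cdy l B : closed01 R := Closed01 (@dy_closed l B) (@dy_sub01 l B).

Lemma cdy_ext l B B' : (forall k, (k < 2 ^ l)%N -> B k = B' k) -> cdy l B = cdy l B'.
Proof.
move=> h; apply: closed01_inj; apply/seteqP; split=> x /dyP[k [kl Bk hx]]; apply/dyP; exists k; split => //.
  by rewrite -h.
by rewrite h.
Qed.

Lemma trunc_block l x : 0 <= x <= 1 -> exists k : nat, (k < 2 ^ l)%N /\ k%:R / 2 ^+ l <= x <= k.+1%:R / 2 ^+ l.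
Proof.
move=> /andP[x0 x1]; have : (`[0, 1]%classic : set R) x by rewrite /= in_itv/= x0.
have y0 : 0 <= x * 2 ^+ l by rewrite mulr_ge0// ltW.
have /andP[t1 t2] := trunc_itv y0; set j := Num.trunc _ in t1 t2 => _.
have [jl|jl] := ltnP j (2 ^ l).
  by exists j; rewrite ler_pdivrMr// ler_pdivlMr// t1 ltW.
have x1e : x = 1.
  apply/eqP; rewrite eq_le x1 -(ler_pM2r (p2 l)) mul1r (le_trans _ t1)// -natrX ler_nat//.
exists (2 ^ l).-1; rewrite prednK ?expn_gt0// leqnn; split => //.
by rewrite x1e ler_pdivrMr// mul1r ler_pdivlMr// mul1r natrX lexx -natrX ler_nat leq_pred.
Qed.

Lemma near_blockP l t (k : nat) : 0 <= t -> k%:R / 2 ^+ l <= t <= k.+1%:R / 2 ^+ l -> near_block l t k.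
Proof.
move=> t0; rewrite ler_pdivrMr// ler_pdivlMr// => /andP[h1 h2].
have y0 : 0 <= t * 2 ^+ l by rewrite mulr_ge0// ltW.
have /andP[t1 t2] := trunc_itv y0; rewrite /near_block; set j := Num.trunc _ in t1 t2 *.
rewrite ltnS -[(k <= j)%N]ltnS -(ltr_nat R k) (le_lt_trans h1)// andbT.
have : (j <= k.+1)%N by rewrite -(ler_nat R) (le_trans t1).
by case: (j).
Qed.

Lemma dy_avoid l t : 0 <= t -> ~ dy l (fun k => ~~ near_block l t k) t.
Proof. by move=> t0 /dyP[k [_ /negP h hk]]; apply: h; exact: near_blockP. Qed.

End dyadic_geometry.

Section hausdorff_space.
Variable R : realType.
Implicit Types (S : closed01 R).

(** The bound [e <= 2] rules out the conventional distance 2 between the empty set and a nonempty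
    one. *)
Lemma hausdorff_radii_lt S S' e : mdist S S' < e -> e <= 2 -> hausdorff_radii S S' e.
Proof.
move=> h e2; apply: hausdorff_dist_lt => //; apply: contrapT => ne.
by move: h; rewrite /mdist /= /hausdorff_dist asboolF// ltNge e2.
Qed.

Lemma mdist_radii S S' e : hausdorff_radii S S' e -> mdist S S' <= e.
Proof.
move=> h; rewrite /mdist /= /hausdorff_dist asboolT; last by exists e.
exact: (ge_inf (hausdorff_radii_lb _ _)).
Qed.

Lemma hits_open (V : set R) : open V -> open [set S : closed01 R | (S : set R) `&` V !=set0].
Proof.
move=> oV; rewrite openE => S [x [Sx Vx]].
have /nbhs_ballP[e /= e0 eV] : nbhs x V by exact: open_nbhs_nbhs.
apply/nbhs_ballP; exists (Num.min e 2) => /=; first by rewrite lt_min e0 ltr0n.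
rewrite ballEmdist => S' /= /hausdorff_radii_lt[]; first by rewrite ge_min lexx orbT.
move=> _ /(_ x Sx)[y Sy yx] _; exists y; split => //; apply: eV.
by apply: ball_sym; apply: le_ball yx; rewrite ge_min lexx.
Qed.

Lemma hits_measurable (V : set R) : open V ->
  measurable ([set S : closed01 R | (S : set R) `&` V !=set0] : set (borel (closed01 R))).
Proof. by move=> oV; apply: sub_sigma_algebra; exact: hits_open. Qed.

Lemma sub_closed_measurable (F : set R) : closed F ->
  measurable ([set S : closed01 R | (S : set R) `<=` F] : set (borel (closed01 R))).
Proof.
move=> cF; rewrite -[X in measurable X]setCK; apply: measurableC.
rewrite (_ : ~` _ = [set S : closed01 R | (S : set R) `&` (~` F) !=set0]).
  by apply: hits_measurable; rewrite openC.
apply/seteqP; split=> S /=.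
  by move=> h; apply/set0P/negP => /eqP e; apply: h; rewrite -subsets_disjoint in e.
by move=> [x [Sx nFx]] /(_ _ Sx).
Qed.

Lemma inside_measurable l B : measurable (inside l B : set (borel (closed01 R))).
Proof. by apply: sub_closed_measurable; exact: dy_closed. Qed.

Lemma mem_measurable (t : R) : measurable ([set S : closed01 R | (S : set R) t] : set (borel (closed01 R))).
Proof.
rewrite (_ : [set S | _] = \bigcap_m [set S : closed01 R | (S : set R) `&` ball t m.+1%:R^-1 !=set0]).
  by apply: bigcapT_measurable => m; apply: hits_measurable; exact: ball_open.
apply/seteqP; split=> [S St m _|S h].
  by exists t; split => //; exact: ballxx.
apply: (@closed01_closed _ S) => B /nbhs_ballP[e /= e0 eB].
have [m me] := invS_lt e0; have [x [Sx tx]] := h m I.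
by exists x; split => //; apply: eB; apply: le_ball tx; exact: ltW.
Qed.

End hausdorff_space.

(** * The limit random set *)

Lemma ae_fine_eq (R : realType) d (T : measurableType d) (Q : probability T R) (A B : set T) :
  measurable A -> measurable B -> {ae Q, forall x, A x <-> B x} -> fine (Q A) = fine (Q B).
Proof.
move=> mA mB h; rewrite -!int_indic//; apply: int_ae; try exact: bmeas_indic.
apply: aeS h => x AB; rewrite !indicE; congr (nat_of_bool _)%:R.
by apply/idP/idP; rewrite !inE => /AB.
Qed.

Lemma ae_fine_le (R : realType) d (T : measurableType d) (P : probability T R) (A B : set T) :
  measurable A -> measurable B -> {ae P, forall x, A x -> B x} -> fine (P A) <= fine (P B).
Proof.
move=> mA mB h; rewrite -!int_indic//; apply: int_le_ae; try exact: bmeas_indic.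
apply: aeS h => x AB; rewrite !indicE ler_nat.
by case: (boolP (x \in A)) => // xA; rewrite (mem_set (AB (set_mem xA))).
Qed.

Section closed01_functions.
Variable R : realType.
Local Notation hd := (@mdist R (closed01 R)).

Lemma hd_dmetric : [/\ forall x, hd x x = 0, forall x y, 0 <= hd x y,
  forall x y, hd x y = hd y x & forall x y z, hd x z <= hd x y + hd y z].
Proof.
split=> [x|x y|x y|x y z]; [exact: mdistxx|exact: mdist_ge0|exact: metric_sym|exact: metric_triangle].
Qed.

Lemma continuous_bmeas (phi : closed01 R -> R) : continuous phi ->
  (exists M, forall x, `|phi x| <= M) -> bmeas (phi : borel (closed01 R) -> R).
Proof.
move=> cphi bphi; split => //; apply: (measurability _ (RGenOInfty.measurableE R)) => //.
move=> _ [_ [a ->] <-]; rewrite setTI; apply: sub_sigma_algebra.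
by apply: open_comp => [x _|]; [exact: cphi|exact: interval_open].
Qed.

Lemma lip_continuous L (phi : closed01 R -> R) : 0 <= L -> lip hd L phi -> continuous phi.
Proof.
move=> L0 pl S A /nbhs_ballP[e /= e0 eA].
have L1 : 0 < L + 1 by rewrite ltr_wpDl.
apply/nbhs_ballP; exists (e / (L + 1)) => /=; first by rewrite divr_gt0.
rewrite ballEmdist => S' /= h; apply: eA; rewrite /ball /= (le_lt_trans (pl _ _))//.
rewrite (@le_lt_trans _ _ ((L + 1) * hd S S'))//.
  by rewrite ler_wpM2r ?mdist_ge0// lerDl.
by rewrite mulrC -ltr_pdivlMr.
Qed.

Lemma cdy_approx l B (S : closed01 R) : (S : set R) `<=` dy l B ->
  (forall j, (j < 2 ^ l)%N -> B j -> exists2 x, (S : set R) x & j%:R / 2 ^+ l <= x <= j.+1%:R / 2 ^+ l) ->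
  hd S (cdy R l B) <= 2 / 2 ^+ l.
Proof.
move=> SB h; have p2 := pow2_gt0 R l; apply: mdist_radii; split.
- by rewrite divr_gt0.
- by move=> x Sx; exists x; [exact: SB|apply: ballxx; rewrite divr_gt0].
- move=> y /dyP[j [jl Bj /andP[y1 y2]]]; have [x Sx /andP[x1 x2]] := h j jl Bj.
  exists x => //; rewrite /ball /= ltr_norml.
  have i0 : 0 < (2 ^+ l)^-1 :> R by rewrite invr_gt0.
  by move: x1 x2 y1 y2; rewrite -natr1 mulrDl mul1r => *; apply/andP; split; lra.
Qed.

(** The 4 leaves room for two approximations of [2 / 2 ^ l] each. *)
Lemma approx_small (e : R) : 0 < e -> exists l : nat, 4 / 2 ^+ l < e.
Proof.
move=> e0; have [k ke] := invS_lt (divr_gt0 e0 (ltr0n R 4)).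
exists k; have p2 := pow2_gt0 R k; rewrite mulrC -ltr_pdivlMr//.
by apply: le_lt_trans ke; rewrite lef_pV2 ?posrE// -natrX ler_nat ltn_expl.
Qed.

End closed01_functions.

Section random_set.
Variable R : realType.
Local Notation hd := (@mdist R (closed01 R)).
Variables (nun : nat -> probability (borel (closed01 R)) R) (e : nat -> (nat -> bool) -> R).
Hypothesis e_cvg : forall l B, fine (nun n (inside l B)) @[n --> \oo] --> e l B.
Hypothesis nun_dyadic : \forall n \near \oo,
  {ae nun n, forall S : closed01 R, exists A, S = dy n A :> set R}.
Hypothesis e_avoid : forall t : R, 0 <= t <= 1 ->
  e l (fun k => ~~ near_block l t k) @[l --> \oo] --> (1 : R).

Arguments e_cvg : clear implicits.
Arguments e_avoid : clear implicits.

Let code (l j : nat) := pickle (l, j).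

(** Letter number [code l j] says that the set lies in the union of the blocks of level [l] other
    than [j]. *)
Let Cs i : set (borel (closed01 R)) :=
  let lj := odflt (0, 0)%N (unpickle i : option (nat * nat)) in inside lj.1 (fun k => k != lj.2).

Let Cs_code l j : Cs (code l j) = inside l (fun k => k != j).
Proof. by rewrite /Cs /code pickleK. Qed.

Let mCs i : measurable (Cs i).
Proof. exact: inside_measurable. Qed.

Let inside_dy n A l B (S : closed01 R) : S = dy n A :> set R -> (l <= n)%N ->
  inside l B S <-> forall k, (k < 2 ^ n)%N -> A k -> B (k %/ 2 ^ (n - l))%N.
Proof. by move=> SA ln; rewrite /inside /= SA; exact: dy_sub. Qed.

Let divn_level n m l k : (l <= m)%N -> (m <= n)%N ->
  (k %/ 2 ^ (n - l) = k %/ 2 ^ (n - m) %/ 2 ^ (m - l))%N.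
Proof. by move=> lm mn; rewrite -divnMA -expnD; congr (_ %/ 2 ^ _)%N; lia. Qed.

Let Cs_cvg (s : seq nat) : cvgn (fun n => fine (nun n (\bigcap_(i in [set` s]) Cs i))).
Proof.
pose lv i := (odflt (0, 0)%N (unpickle i : option (nat * nat))).1.
pose jv i := (odflt (0, 0)%N (unpickle i : option (nat * nat))).2.
(* At the finest level [L] involved, and for [n >= L], the intersection is almost surely the single
   event [inside L B], whose probabilities converge. *)
pose L := (\max_(i <- s) lv i)%N.
have sL i : i \in s -> (lv i <= L)%N by move=> si; exact: (@leq_bigmax_seq _ s xpredT lv).
pose B k := all (fun i => k %/ 2 ^ (L - lv i) != jv i)%N s.
suff h : fine (nun n (\bigcap_(i in [set` s]) Cs i)) @[n --> \oo] --> e L B by exact: cvgP h.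
apply: cvg_trans (e_cvg L B); apply: near_eq_cvg.
near=> n.
have Ln : (L <= n)%N by near: n; exists L.
apply: ae_fine_eq; [exact: inside_measurable|by apply: fin_bigcap_measurable|].
have : {ae nun n, forall S : closed01 R, exists A, S = dy n A :> set R} by near: n.
apply: aeS => S [A SA]; split=> [/(inside_dy _ SA Ln) h i /= si|h].
  apply/(inside_dy _ SA); first exact: leq_trans (sL i si) Ln.
  move=> k kn Ak; rewrite (divn_level _ (sL i si) Ln).
  by have /allP := h k kn Ak; apply.
apply/(inside_dy _ SA Ln) => k kn Ak; apply/allP => i si.
have /(inside_dy _ SA (leq_trans (sL i si) Ln))/(_ k kn Ak) := h i si.
by rewrite (divn_level _ (sL i si) Ln).
Unshelve. all: by end_near. Qed.

Section from_tree.
Variable D : nat -> set (measurableTypeR R).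
Hypothesis mD : forall i, measurable (D i).
Hypothesis law_D : forall k (g : seq bool -> R),
  \int[nun n]_x g (word Cs k x) @[n --> \oo] --> \int[@lebesgue01 R]_u g (word D k u).
Arguments law_D : clear implicits.
Local Notation Q := (@lebesgue01 R).

Let event_meas k (F : seq bool -> Prop) : measurable [set u | F (word D k u)].
Proof.
have [mg _] := word_bmeas mD (fun w => (`[< F w >])%:R : R) k.
rewrite (_ : [set u | _] = ((fun w => (`[< F w >])%:R : R) \o word D k) @^-1` `]0, +oo[%classic).
  by apply: measurable_preim => //; exact: measurable_itv.
apply/seteqP; split=> u /=; rewrite in_itv/= andbT ltr0n.
  by move=> /asboolP ->.
by rewrite lt0b => /asboolP.
Qed.

(** Probabilities of events of finitely many letters converge, so an event that is almost sure for
    all large [n] is almost sure in the limit. *)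
Let transfer k (f : seq bool -> bool) :
  (\forall n \near \oo, {ae nun n, forall S, f (word Cs k S)}) ->
  {ae Q, forall u, f (word D k u)}.
Proof.
move=> h; pose A := [set u | f (word D k u)].
have mA : measurable A by exact: (event_meas k (fun w => f w)).
have i1 : \int[Q]_u (f (word D k u))%:R = 1 :> R.
  have l1 := law_D k (fun w => (f w)%:R).
  suff l2 : \int[nun n]_S (f (word Cs k S))%:R @[n --> \oo] --> (1 : R).
    by rewrite -(cvg_lim _ l1)// (cvg_lim _ l2).
  have c1 : (fun=> 1 : R) n @[n --> \oo] --> (1 : R) by exact: cvg_cst.
  apply: cvg_trans c1; apply: near_eq_cvg; near=> n.
  rewrite -[LHS](int_cst (nun n)).
  have : {ae nun n, forall S, f (word Cs k S)} by near: n.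
  move=> hn; apply: int_ae; [exact: bmeas_cst|exact: (word_bmeas mCs (fun w => (f w)%:R) k)|].
  by apply: aeS hn => S ->.
have QA : Q A = 1%E.
  rewrite -[LHS]fineK ?fin_num_measure// -int_indic//; congr (_%:E).
  by rewrite -[RHS]i1; apply: eq_Rintegral => u _; rewrite indicE mem_setE.
exists (~` A); split; [exact: measurableC| |by []].
by rewrite [LHS](probability_setC Q mA) [X in (1 - X)%E]QA subee.
Unshelve. all: by end_near. Qed.

Let hitD u l j := ~~ `[< D (code l j) u >].
Let hitC (S : closed01 R) l j := ~~ `[< Cs (code l j) S >].
Let mask (w : seq bool) l j := ~~ nth false w (code l j).

Let maskD k u l j : (code l j < k)%N -> mask (word D k u) l j = hitD u l j.
Proof. by move=> h; rewrite /mask /hitD /word nth_mkseq. Qed.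

Let maskC k S l j : (code l j < k)%N -> mask (word Cs k S) l j = hitC S l j.
Proof. by move=> h; rewrite /mask /hitC /word nth_mkseq. Qed.

Let len l := (\max_(j < 2 ^ l) code l j).+1.

Let len_lt l j : (j < 2 ^ l)%N -> (code l j < len l)%N.
Proof. by move=> jl; rewrite ltnS; exact: (@leq_bigmax _ (fun j : 'I_(2 ^ l) => code l j) (Ordinal jl)). Qed.

Let hitCP n A (S : closed01 R) l j : S = dy n A :> set R -> (l <= n)%N ->
  hitC S l j <-> exists k, [/\ (k < 2 ^ n)%N, A k & (k %/ 2 ^ (n - l) = j)%N].
Proof.
move=> SA ln; rewrite /hitC; split=> [/asboolPn h|[k [kn Ak kj]]].
  apply: contrapT => nh; apply: h; rewrite Cs_code; apply/(inside_dy _ SA ln) => k kn Ak.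
  by apply/eqP => kj; apply: nh; exists k.
by apply/asboolPn; rewrite Cs_code => /(inside_dy _ SA ln)/(_ k kn Ak); rewrite kj eqxx.
Qed.

Let good u := forall l j, (j < 2 ^ l)%N -> hitD u l j = hitD u l.+1 j.*2 || hitD u l.+1 j.*2.+1.

Let good_ae : {ae Q, forall u, good u}.
Proof.
apply: ae_foralln => l; apply: ae_foralln => j.
pose k := (maxn (code l j) (maxn (code l.+1 j.*2) (code l.+1 j.*2.+1))).+1.
pose f w := mask w l j == mask w l.+1 j.*2 || mask w l.+1 j.*2.+1.
have h : {ae Q, forall u, f (word D k u)}.
  apply: transfer; near=> n.
  have ln : (l < n)%N by near: n; exists l.+1.
  have : {ae nun n, forall S : closed01 R, exists A, S = dy n A :> set R} by near: n.
  apply: aeS => S [A SA]; rewrite /f !maskC ?ltnS ?leq_max ?leqnn ?orbT//.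
  have h1 := hitCP (l := l) j SA (ltnW ln); have h2 j' := hitCP (l := l.+1) j' SA ln.
  apply/eqP; apply/idP/idP.
    move=> /h1[i [il Ai]]; rewrite (divn_level _ (leqnSn l) ln) subSnn expn1 divn2 => e2.
    apply/orP; case: (boolP (odd (i %/ 2 ^ (n - l.+1)))) => o; [right|left]; apply/h2; exists i; split => //.
      by rewrite -e2 -[LHS]odd_double_half o.
    by rewrite -e2 -[LHS]odd_double_half (negbTE o).
  by move=> /orP[] /h2[i [il Ai i2]]; apply/h1; exists i; split => //;
    rewrite (divn_level _ (leqnSn l) ln) subSnn expn1 divn2 i2 ?doubleK//= uphalf_double.
apply: aeS h => u + jl; rewrite /f !maskD ?ltnS ?leq_max ?leqnn ?orbT//.
by move=> /eqP.
Unshelve. all: by end_near. Qed.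

Let lim_set u : set R := \bigcap_l dy l (hitD u l).

Let lim_closed u : closed (lim_set u).
Proof. by apply: closed_bigI => l _; exact: dy_closed. Qed.

Let lim_sub u : lim_set u `<=` `[0, 1].
Proof. by move=> x /(_ 0%N I); exact: dy_sub01. Qed.

Let dy_dec u l : good u -> dy l.+1 (hitD u l.+1) `<=` (dy l (hitD u l) : set R).
Proof.
move=> gu; apply/(dy_sub R _ _ (leqnSn l)) => k kl hk; rewrite subSnn expn1 divn2.
have k2 : (k./2 < 2 ^ l)%N by rewrite -divn2 ltn_divLR// -expnSr.
rewrite gu//; move: hk; rewrite -{1}[k]odd_double_half; case: odd => /= ->; by rewrite ?orbT.
Qed.

Let lim_hits u l j : good u -> (j < 2 ^ l)%N -> hitD u l j ->
  exists2 x, lim_set u x & j%:R / 2 ^+ l <= x <= j.+1%:R / 2 ^+ l.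
Proof.
move=> gu jl hj.
(* [f m] is a hit block of level [l + m] inside the previous one, the left half being preferred;
   [good] provides it, and the blocks shrink to the supremum of their left ends. *)
pose f := fix f m := if m is m'.+1 then
  (if hitD u (l + m').+1 (f m').*2 then (f m').*2 else (f m').*2.+1) else j.
have fS m : f m.+1 = (if hitD u (l + m).+1 (f m).*2 then (f m).*2 else (f m).*2.+1) by [].
have inv m : (f m < 2 ^ (l + m))%N /\ hitD u (l + m) (f m).
  elim: m => [|m [h1 h2]]; first by rewrite addn0.
  rewrite addnS fS; split.
    by rewrite expnS mul2n; case: ifP => _; rewrite ?ltn_double // ltn_Sdouble.
  by case: ifPn => // h; move: h2; rewrite gu// (negbTE h).
have p2 m := pow2_gt0 R m.
pose xl m : R := (f m)%:R / 2 ^+ (l + m); pose yl m : R := (f m).+1%:R / 2 ^+ (l + m).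
have e2 m a : a%:R / 2 ^+ (l + m) = a.*2%:R / 2 ^+ (l + m).+1 :> R.
  by rewrite exprS -mul2n natrM invfM mulrACA divff ?mul1r.
have xlS m : xl m <= xl m.+1.
  rewrite /xl addnS e2 ler_pM2r ?invr_gt0// ler_nat fS; by case: ifP.
have ylS m : yl m.+1 <= yl m.
  rewrite /yl addnS e2 ler_pM2r ?invr_gt0// ler_nat fS doubleS; by case: ifP.
have xlm : {homo xl : m n / (m <= n)%N >-> m <= n} by apply: homo_leq => //; exact: le_trans.
have ylm : {homo yl : m n / (m <= n)%N >-> n <= m}.
  by apply: (homo_leq (r := fun a b => b <= a)) => // a b c ba ac; exact: le_trans ac ba.
have xy m n : xl m <= yl n.
  rewrite (le_trans (xlm _ _ (leq_maxl m n)))// (le_trans _ (ylm _ _ (leq_maxr m n)))//.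
  by rewrite ler_pM2r ?invr_gt0// ler_nat.
pose x := sup (range xl).
have x1 m : xl m <= x.
  by apply: ub_le_sup; [exists (yl 0%N) => _ [n _ <-]|exists m].
have x2 m : x <= yl m.
  by apply: ge_sup => [|_ [n _ <-]//]; exists (xl 0%N), 0%N.
have xin m : dy (l + m) (hitD u (l + m)) x.
  by apply/dyP; exists (f m); have [? ?] := inv m; split => //; rewrite x1 x2.
exists x; last by have := x1 0%N; have := x2 0%N; rewrite /xl /yl addn0 => -> ->.
move=> i _; have [li|il] := leqP l i; first by have := xin (i - l)%N; rewrite subnKC.
have dec m : dy (i + m) (hitD u (i + m)) `<=` (dy i (hitD u i) : set R).
  elim: m => [|m IH]; first by rewrite addn0.
  by rewrite addnS; apply: classical_sets.subset_trans IH; exact: dy_dec.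
by apply: (dec (l - i)%N); have := xin 0%N; rewrite addn0 subnKC// ltnW.
Qed.

(** A measurable null set containing every [u] that is not [good]; on it [rset] takes the default
    value [point], the empty set. *)
Let bad := projT1 (cid good_ae).
Let mbad : measurable bad. Proof. by rewrite /bad; case: cid => N []. Qed.
Let bad0 : Q bad = 0%E. Proof. by rewrite /bad; case: cid => N []. Qed.
Let good_out u : ~ bad u -> good u.
Proof.
move=> nb; apply: contrapT => ng; apply: nb; move: ng.
by rewrite /bad; case: cid => N [_ _ /=]; exact.
Qed.

Let rset u : closed01 R := if `[< bad u >] then point else Closed01 (@lim_closed u) (@lim_sub u).

Let out_ae : {ae Q, forall u, ~ bad u}.
Proof. by exists bad; split => // u /contrapT. Qed.

Let rsetE u : ~ bad u -> rset u = lim_set u :> set R.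
Proof. by move=> nb; rewrite /rset asboolF. Qed.

Let E l w := cdy R l (mask w l).

Let rset_approx u l : ~ bad u -> hd (rset u) (E l (word D (len l) u)) <= 2 / 2 ^+ l.
Proof.
move=> nb; rewrite /E (cdy_ext R (B' := hitD u l)); last by move=> k kl; rewrite maskD// len_lt.
apply: cdy_approx; rewrite rsetE//; first by move=> x; exact.
by move=> j jl hj; apply: lim_hits => //; exact: good_out.
Qed.

Let nun_approx l : \forall n \near \oo,
  {ae nun n, forall S : closed01 R, hd S (E l (word Cs (len l) S)) <= 2 / 2 ^+ l}.
Proof.
near=> n.
have ln : (l <= n)%N by near: n; exists l.
have : {ae nun n, forall S : closed01 R, exists A, S = dy n A :> set R} by near: n.
apply: aeS => S [A SA].
rewrite /E (cdy_ext R (B' := hitC S l)); last by move=> k kl; rewrite maskC// len_lt.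
apply: cdy_approx.
  rewrite SA; apply/dy_sub => // k kn Ak; apply/(hitCP _ SA ln); by exists k.
move=> j jl /(hitCP _ SA ln)[k [kn Ak kj]].
pose B i := i == k.
have : dy n B `<=` (dy l (fun i => i == j) : set R).
  by apply/dy_sub => // i _ /eqP ->; rewrite kj.
have p2 := pow2_gt0 R n.
pose x : R := k%:R / 2 ^+ n.
have hx : k%:R / 2 ^+ n <= x <= k.+1%:R / 2 ^+ n by rewrite /x lexx/= ler_pM2r ?invr_gt0// ler_nat.
move=> /(_ x); case; first by exists k => //; split => //; rewrite /B eqxx.
move=> i /= [_ /eqP ->]; rewrite in_itv/= => hj; exists x => //.
by rewrite SA; apply/dyP; exists k.
Unshelve. all: by end_near. Qed.

Let rset_measurable : measurable_fun setT (rset : measurableTypeR R -> borel (closed01 R)).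
Proof.
apply: measurability => // _ [V oV <-]; rewrite setTI.
(* Off [bad], [rset u] lies in the open set [V] exactly when, for some [l], the ball of radius
   [2 / 2 ^ l] about its approximation of level [l] does; this is a condition on finitely many
   letters. *)
rewrite (_ : rset @^-1` V = (~` bad `&` \bigcup_l [set u | (fun w => forall T, hd (E l w) T <= 2 / 2 ^+ l -> V T) (word D (len l) u)])
   `|` (bad `&` [set u | V point])).
  apply: measurableU; apply: measurableI => //.
  - exact: measurableC.
  - apply: bigcupT_measurable => l.
    exact: (event_meas (len l) (fun w => forall T, hd (E l w) T <= 2 / 2 ^+ l -> V T)).
  - have [h|h] := pselect (V point).
      by rewrite (_ : [set _ | _] = setT)//; apply/seteqP; split.
    by rewrite (_ : [set _ | _] = set0)//; apply/seteqP; split.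
apply/seteqP; split=> u /=; last first.
  move=> [[nb [l _ /= h]]|[bu Vp]]; last by rewrite /rset asboolT.
  by apply: h; rewrite metric_sym; exact: rset_approx.
have [bu|nb] := pselect (bad u); first by rewrite {1}/rset asboolT//; right.
move=> Vu; left; split => //.
have /nbhs_ballP[eps /= eps0 hV] : nbhs (rset u) V by exact: open_nbhs_nbhs.
have [l le] := approx_small eps0; exists l => //= T hT; apply: hV; rewrite ballEmdist /=.
apply: le_lt_trans le; rewrite (le_trans (metric_triangle _ (E l (word D (len l) u)) _))//.
have := rset_approx l nb; move: hT; have i0 : 0 < (2 ^+ l)^-1 :> R by rewrite invr_gt0 pow2_gt0.
lra.
Qed.

(** Both integrals are compared with that of [phi] at the approximation of level [l], a function of
    finitely many letters, for which [law_D] gives convergence. *)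
Let rset_lip L (phi : closed01 R -> R) : 0 <= L -> (exists M, forall x, `|phi x| <= M) ->
  lip hd L phi ->
  \int[nun n]_S phi S @[n --> \oo] --> \int[Q]_u phi (rset u).
Proof.
move=> L0 pM pl; have bphi := continuous_bmeas (lip_continuous L0 pl) pM.
have bphir : bmeas (phi \o rset : measurableTypeR R -> R) := bmeas_comp bphi rset_measurable.
apply/cvgrPdist_le => eps eps0.
have L1 : 0 < L + 1 by rewrite ltr_wpDl.
have [l le] := approx_small (divr_gt0 eps0 L1).
have bC : bmeas (fun S : borel (closed01 R) => phi (E l (word Cs (len l) S))).
  exact: (word_bmeas mCs (fun w => phi (E l w)) (len l)).
have bD : bmeas (fun u : measurableTypeR R => phi (E l (word D (len l) u))).
  exact: (word_bmeas mD (fun w => phi (E l w)) (len l)).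
pose del := L * (2 / 2 ^+ l).
have del2 : 2 * del + 4 / 2 ^+ l <= eps.
  have i0 : 0 < (2 ^+ l)^-1 :> R by rewrite invr_gt0 pow2_gt0.
  have : (L + 1) * (4 / 2 ^+ l) < eps by rewrite mulrC -ltr_pdivlMr.
  by rewrite /del; nra.
have close d (T : measurableType d) (P : probability T R) (f g : T -> R) : bmeas f -> bmeas g ->
    {ae P, forall w, `|f w - g w| <= del} -> `|\int[P]_w f w - \int[P]_w g w| <= del.
  move=> bf bg h; rewrite -intB//.
  have bfg := bmeasB bf bg; have bc := bmeas_cst T del.
  rewrite ler_norml; apply/andP; split.
    rewrite -[leLHS](int_cst P); apply: int_le_ae => //; first exact: bmeas_cst.
    by apply: aeS h => w; rewrite ler_norml => /andP[].
  rewrite -[leRHS](int_cst P); apply: int_le_ae => //.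
  by apply: aeS h => w; rewrite ler_norml => /andP[].
have h1 : `|\int[Q]_u phi (rset u) - \int[Q]_u phi (E l (word D (len l) u))| <= del.
  apply: close => //; apply: aeS out_ae => u nb; rewrite (le_trans (pl _ _))// ler_wpM2l//.
  exact: rset_approx.
near=> n.
have h2 : `|\int[Q]_u phi (E l (word D (len l) u)) - \int[nun n]_S phi (E l (word Cs (len l) S))| <= 4 / 2 ^+ l.
  near: n; apply: ((cvgrPdist_le _ _).1 (law_D (len l) (fun w => phi (E l w)))).
  by rewrite divr_gt0// pow2_gt0.
have h3 : `|\int[nun n]_S phi S - \int[nun n]_S phi (E l (word Cs (len l) S))| <= del.
  apply: close => //.
  have : {ae nun n, forall S : closed01 R, hd S (E l (word Cs (len l) S)) <= 2 / 2 ^+ l}.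
    by near: n; exact: nun_approx.
  by apply: aeS => S hS; rewrite (le_trans (pl _ _))// ler_wpM2l.
move: h1 h2 h3 del2.
move: (\int[Q]_u phi (rset u)) (\int[Q]_u phi (E l (word D (len l) u)))
  (\int[nun n]_S phi (E l (word Cs (len l) S))) (\int[nun n]_S phi S) => a b c' d'.
have := ler_distD b a d'; have := ler_distD c' b d'; rewrite (distrC c' d').
lra.
Unshelve. all: by end_near. Qed.

Let covered l B (w : seq bool) := all (fun j => mask w l j ==> B j) (iota 0 (2 ^ l)).

Let coveredD l B u : covered l B (word D (len l) u) <->
  forall j, (j < 2 ^ l)%N -> hitD u l j -> B j.
Proof.
split=> [/allP h j jl hj|h].
  by have := h j; rewrite mem_iota jl maskD ?len_lt// hj; apply.
by apply/allP => j; rewrite mem_iota => /andP[_ jl]; rewrite maskD ?len_lt//; apply/implyP/h.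
Qed.

Let coveredC l B S : covered l B (word Cs (len l) S) <->
  forall j, (j < 2 ^ l)%N -> hitC S l j -> B j.
Proof.
split=> [/allP h j jl hj|h].
  by have := h j; rewrite mem_iota jl maskC ?len_lt// hj; apply.
by apply/allP => j; rewrite mem_iota => /andP[_ jl]; rewrite maskC ?len_lt//; apply/implyP/h.
Qed.

(** For a dyadic set of level at least [l], lying inside [dy l B] is a matter of the hit blocks of
    level [l], hence of a finite word. *)
Let energyE l B : e l B = fine (Q [set u | covered l B (word D (len l) u)]).
Proof.
have mF := event_meas (len l) (fun w => covered l B w).
rewrite -int_indic//.
have l1 := law_D (len l) (fun w => (covered l B w)%:R).
rewrite (_ : \int[Q]_u _ = \int[Q]_u (covered l B (word D (len l) u))%:R); last first.
  by apply: eq_Rintegral => u _; rewrite indicE mem_setE.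
suff l2 : \int[nun n]_S (covered l B (word Cs (len l) S))%:R @[n --> \oo] --> e l B.
  by rewrite -(cvg_lim _ l1)// (cvg_lim _ l2).
apply: cvg_trans (e_cvg l B); apply: near_eq_cvg; near=> n.
have ln : (l <= n)%N by near: n; exists l.
have dyn : {ae nun n, forall S : closed01 R, exists A, S = dy n A :> set R} by near: n.
rewrite -int_indic; last exact: inside_measurable.
apply: int_ae; [by apply: bmeas_indic; exact: inside_measurable|exact: (word_bmeas mCs (fun w => (covered l B w)%:R))|].
apply: aeS dyn => S [A SA]; rewrite indicE; congr (nat_of_bool _)%:R.
apply/idP/idP => [/set_mem hi|hc].
  have h := (inside_dy _ SA ln).1 hi; apply/coveredC => j jl /(hitCP _ SA ln)[k [kn Ak <-]].
  exact: h.
have h := (coveredC _ _ _).1 hc; apply: mem_set; apply: (inside_dy _ SA ln).2 => k kn Ak; apply: h.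
  by rewrite ltn_divLR ?expn_gt0// -expnD subnKC.
by apply/(hitCP _ SA ln); exists k.
Unshelve. all: by end_near. Qed.

(** If all hit blocks belong to [B], the set lies in [dy l B], whence one inequality. The converse
    can fail only when the set touches a hit block at an end point alone; the first inequality
    already shows that grid points are almost surely avoided, which gives equality. *)
Lemma limit_law : exists nu : probability (borel (closed01 R)) R, [/\ weak_cvg nun nu,
  forall l B, nu (inside l B) = (e l B)%:E &
  forall t : R, 0 <= t <= 1 -> nu [set S : closed01 R | (S : set R) t] = 0%E].
Proof.
have [nu hnu] := hasLaw_ex Q rset_measurable.
have nuf (A : set (borel (closed01 R))) : measurable A -> nu A = (fine (nu A))%:E.
  by move=> mA; rewrite fineK// fin_num_measure.
have low l B : e l B <= fine (nu (inside l B)).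
  have mi := @inside_measurable R l B.
  rewrite energyE -(hnu.2 _ mi); apply: ae_fine_le.
  - exact: (event_meas (len l) (fun w => covered l B w)).
  - exact: measurable_preim hnu.1 mi.
  - apply: aeS out_ae => u nb /coveredD h x; rewrite rsetE// => /(_ l I)/dyP[k [kl hk kx]].
    by apply/dyP; exists k; split => //; exact: h.
have avoid t : 0 <= t <= 1 -> nu [set S : closed01 R | (S : set R) t] = 0%E.
  move=> t01; have mt := @mem_measurable R t; rewrite nuf//; congr (_%:E).
  apply/eqP; rewrite eq_le fine_ge0// andbT.
  have h l : fine (nu [set S : closed01 R | (S : set R) t]) <= 1 - e l (fun k => ~~ near_block l t k).
    pose I := inside l (fun k => ~~ near_block l t k) : set (borel (closed01 R)).
    have mi : measurable I by exact: inside_measurable.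
    apply: le_trans (ae_fine_le mt (measurableC mi) _) _.
      apply: aeW => S /= St SI; have := SI t St; apply: dy_avoid.
      by case/andP: t01.
    by rewrite probability_setC// fineB ?fin_num_measure//= lerB.
  have : 1 - e l (fun k => ~~ near_block l t k) @[l --> \oo] --> (1 - 1 : R).
    by apply: cvgB; [exact: cvg_cst|exact: e_avoid].
  rewrite subrr => lim; apply: (cvgr_to_ge lim).
  by near=> l; exact: h.
exists nu; split => //; last first.
  move=> l B; have mi := @inside_measurable R l B.
  rewrite nuf//; congr (_%:E); apply/eqP; rewrite eq_le low andbT energyE -(hnu.2 _ mi).
  have grid : {ae Q, forall u, forall k, (k <= 2 ^ l)%N -> ~ (rset u : set R) (k%:R / 2 ^+ l)}.
    apply: ae_foralln => k; have [kl|kl] := leqP k (2 ^ l); last first.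
      by apply: aeW => u.
    have k01 : 0 <= (k%:R / 2 ^+ l : R) <= 1.
      have p2 := pow2_gt0 R l.
      by rewrite divr_ge0 ?(ltW p2)//= ler_pdivrMr// mul1r -natrX ler_nat.
    have : {ae nu, forall S : closed01 R, ~ (S : set R) (k%:R / 2 ^+ l)}.
      exists [set S : closed01 R | (S : set R) (k%:R / 2 ^+ l)]; split.
      - exact: mem_measurable.
      - exact: avoid.
      - by move=> S /contrapT.
    by move=> h; apply: aeS (hasLaw_ae hnu h) => u nu' _.
  apply: ae_fine_le.
  - exact: measurable_preim hnu.1 mi.
  - exact: (event_meas (len l) (fun w => covered l B w)).
  - apply: aeS2 out_ae grid => u nb gr hi; apply/coveredD => j jl hj.
    have [x Sx /andP[x1 x2]] := lim_hits (good_out nb) jl hj.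
    have Rx : (rset u : set R) x by rewrite rsetE.
    apply: (dy_int (l := l) (x := x)); last exact: hi.
      rewrite lt_neqAle x1 andbT; apply/eqP => xe; apply: (gr j (ltnW jl)); by rewrite xe.
    rewrite lt_neqAle x2 andbT; apply/eqP => xe; apply: (gr j.+1 jl); by rewrite -xe.
move=> phi cphi [M pM]; have bphi := continuous_bmeas cphi (ex_intro _ M pM).
rewrite (hasLaw_int hnu bphi).
have [d0 dge0 dsym dtri] := hd_dmetric R.
apply: (@portmanteau R _ hd d0 dge0 dsym dtri setT _ _ nun (fun _ S => S) _ _ Q rset _ phi M) => //.
- move=> L f L0 bf fl; have bF := continuous_bmeas (lip_continuous L0 fl) bf; split => //.
    exact: (bmeas_comp bF rset_measurable).
  exact: rset_lip fl.
- exact: (bmeas_comp bphi rset_measurable).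
- by move=> n; apply: aeW.
- apply: aeW => u; split => // eps eps0.
  have := cphi (rset u) => /cvgrPdist_le/(_ _ eps0)/nbhs_ballP[eta /= eta0 h].
  exists eta => // y _ hy; rewrite distrC; apply: h.
  by rewrite ballEmdist.
Unshelve. all: by end_near. Qed.

End from_tree.

Lemma random_set_exists : exists nu : probability (borel (closed01 R)) R, [/\ weak_cvg nun nu,
  forall l B, nu (inside l B) = (e l B)%:E &
  forall t : R, 0 <= t <= 1 -> nu [set S : closed01 R | (S : set R) t] = 0%E].
Proof.
have [D [mD law_D]] := tree_exists mCs Cs_cvg.
exact: limit_law mD law_D.
Qed.

End random_set.

(** * Properties of the limit set *)

Section interval_unions.
Variable R : realType.
Implicit Types (E : set R) (s : seq R).

Definition itv_ends (i : interval R) : seq R :=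
  let ends b := if b is BSide _ t then [:: t] else [::] in
  let: Interval a b := i in ends a ++ ends b.

Lemma itv_ends_between (i : interval R) x y : x \in i -> y \notin i ->
  exists2 t, t \in itv_ends i & y <= t <= x \/ x <= t <= y.
Proof.
case: i => a b; rewrite !itv_boundlr => /andP[ax xb]; rewrite negb_and => /orP[|].
  case: a ax => [c t|[]] // ct yt; exists t; first by rewrite /= mem_head.
  left; move: ct yt; case: c; rewrite !bnd_simp -?ltNge -?leNgt => h1 h2; by rewrite ?h1 ?h2 ?(ltW h1) ?(ltW h2).
case: b xb => [c t|[]] // ct yt; exists t; first by rewrite /= mem_cat mem_head orbT.
right; move: ct yt; case: c; rewrite !bnd_simp -?ltNge -?leNgt => h1 h2; by rewrite ?h1 ?h2 ?(ltW h1) ?(ltW h2).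
Qed.

(** All that is used of a finite union of intervals: finitely many points separate it from its
    complement. Open, closed and infinite ends then need no distinction. *)
Definition separates s E := forall x y, E x -> ~ E y ->
  exists2 t, t \in s & y <= t <= x \/ x <= t <= y.

Lemma union_separated E : finite_union_of_intervals E -> exists s, separates s E.
Proof.
move=> [r ->]; exists (flatten [seq itv_ends i | i <- r]) => x y [i ir xi] nE.
have /(itv_ends_between xi)[t ti h] : y \notin i.
  by apply/negP => yi; apply: nE; exists i.
exists t => //; apply/flattenP; exists (itv_ends i) => //; exact: map_f.
Qed.

Lemma seq_dist s (x : R) : x \notin s -> exists2 e, 0 < e & forall t, t \in s -> e <= `|t - x|.
Proof.
elim: s => [_|t s IH]; first by exists 1.
rewrite inE negb_or => /andP[xt /IH[e e0 he]]; exists (Num.min e `|t - x|).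
  by rewrite lt_min e0 normr_gt0 subr_eq0 eq_sym.
by move=> t'; rewrite inE ge_min => /orP[/eqP ->|/he ->//]; rewrite lexx orbT.
Qed.

Lemma separated_interior s E x : separates s E -> E x -> x \notin s ->
  exists2 e, 0 < e & ball x e `<=` E.
Proof.
move=> sE Ex /seq_dist[e e0 he]; exists e => // y; rewrite /ball /= => xy.
apply: contrapT => nEy; have [t ts h] := sE x y Ex nEy.
have := he t ts; rewrite leNgt => /negP; apply; apply: le_lt_trans xy.
case: h => /andP[h1 h2].
  by rewrite distrC !ger0_norm ?subr_ge0 ?(le_trans h1)// lerD2l lerN2.
by rewrite [leRHS]distrC !ger0_norm ?subr_ge0 ?(le_trans h1)// lerD2r.
Qed.

(** Points of [E] outside [s] are interior; the finitely many others are added with shrinking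
    balls. *)
Lemma separated_Gdelta s E : separates s E -> exists U : nat -> set R,
  (forall m, open (U m)) /\ E = \bigcap_m U m.
Proof.
move=> sE; pose V := [set x | E x /\ x \notin s].
pose s' := [seq t <- s | `[< E t >]].
pose U (m : nat) := V `|` \bigcup_(t in [set` s']) ball t m.+1%:R^-1.
exists U; split=> [m|].
  apply: openU; last by apply: bigcup_open => t _; exact: ball_open.
  rewrite openE => x [Ex xs]; have [e e0 he] := separated_interior sE Ex xs.
  have [e' e'0 he'] := seq_dist xs.
  apply/nbhs_ballP; exists (Num.min e e') => /=; first by rewrite lt_min e0.
  move=> y xy; split; first by apply: he; apply: le_ball xy; rewrite ge_min lexx.
  apply/negP => ys; have := he' y ys; rewrite leNgt => /negP; apply.
  by move: xy; rewrite /ball /= lt_min distrC => /andP[].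
apply/seteqP; split=> [x Ex m _|x hx].
  have [xs|xs] := boolP (x \in s); last by left.
  right; exists x; last by apply: ballxx.
  by rewrite /= mem_filter xs andbT; apply/asboolP.
apply: contrapT => nEx.
have : x \notin s' by rewrite mem_filter negb_and; apply/orP; left; apply/asboolPn.
move=> /seq_dist[e e0 he]; have [m me] := invS_lt e0.
have [[Ex _]//|[t ts]] := hx m I; rewrite /ball /= => tx.
by have := he t ts; rewrite leNgt (lt_trans tx).
Qed.

(** By compactness a closed set inside [U] has balls of one common radius inside [U] about all its
    points. *)
Lemma sub_open_open (U : set R) : open U -> open [set S : closed01 R | (S : set R) `<=` U].
Proof.
move=> oU; rewrite openE => S /= SU.
have cS : compact (S : set R).
  exact: subclosed_compact (closed01_closed (c := S)) (@segment_compact R 0 1) (@closed01_sub R S).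
have [|m _ hm] := (compact_near_coveringP _).1 cS nat \oo (fun m x => ball x m.+1%:R^-1 `<=` U) _.
  move=> x /SU Ux; have /nbhs_ballP[e /= e0 he] : nbhs x U by exact: open_nbhs_nbhs.
  have e20 : 0 < e / 2 by rewrite divr_gt0.
  have [m me] := invS_lt e20.
  exists (ball x (e / 2), [set k | (m <= k)%N]).
    by split; [exact: nbhsx_ballx|exists m].
  move=> [x' k] /= [xx' mk] y x'y; apply: he; rewrite [e]splitr.
  apply: ball_triangle xx' _; apply: le_ball x'y.
  by rewrite (le_trans _ (ltW me))// lef_pV2 ?posrE// ler_nat ltnS.
have {}hm x : (S : set R) x -> ball x m.+1%:R^-1 `<=` U by exact: (hm m (leqnn m)).
apply/nbhs_ballP; exists m.+1%:R^-1 => /=; first by rewrite invr_gt0.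
rewrite ballEmdist => S' /= /hausdorff_radii_lt[].
  by rewrite (@le_trans _ _ 1)// ?ler1n// invf_le1// ler1n.
by move=> _ _ h x /h[y Sy yx]; exact: hm yx.
Qed.

Lemma sub_union_measurable s E : separates s E ->
  measurable ([set S : closed01 R | (S : set R) `<=` E] : set (borel (closed01 R))).
Proof.
move=> /separated_Gdelta[U [oU ->]].
rewrite (_ : [set S | _] = \bigcap_m [set S : closed01 R | (S : set R) `<=` U m]).
  by apply: bigcapT_measurable => m; apply: sub_sigma_algebra; exact: sub_open_open.
apply/seteqP; split=> S /=; first by move=> h m _ x /h; exact.
by move=> h x Sx m _; exact: (h m I).
Qed.

End interval_unions.

Section limit_set_properties.
Variable R : realType.
Variables (nu : probability (borel (closed01 R)) R) (e : nat -> (nat -> bool) -> R).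
Hypothesis nu_inside : forall l B, nu (inside l B) = (e l B)%:E.
Hypothesis nu_mem : forall t : R, 0 <= t <= 1 -> nu [set S : closed01 R | (S : set R) t] = 0%E.
Hypothesis e_avoid : forall t : R, 0 <= t <= 1 ->
  e l (fun k => ~~ near_block l t k) @[l --> \oo] --> (1 : R).
Arguments e_avoid : clear implicits.

Let incidence : set (measurableTypeR R * borel (closed01 R)) := [set z | ((z.2 : closed01 R) : set R) z.1].

(** A point [t] belongs to the closed set [S] exactly when for every [m] some grid ball of radius
    [1/(m+1)] contains [t] and meets [S]; these are countable operations on rectangles. *)
Let incidence_measurable : measurable incidence.
Proof.
pose b (m k : nat) : set R := ball (k%:R / m.+1%:R : R) (m.+1%:R^-1 : R).
rewrite (_ : incidence = \bigcap_m \bigcup_k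
    ((b m k : set (measurableTypeR R)) `*` [set S : closed01 R | (S : set R) `&` b m k !=set0])).
  apply: bigcapT_measurable => m; apply: bigcupT_measurable => k; apply: measurableX.
    by apply: open_measurable; exact: ball_open.
  by apply: hits_measurable; exact: ball_open.
apply/seteqP; split=> [[t S] /= St m _|[t S] h].
  have m0 : 0 < m.+1%:R :> R by [].
  have := closed01_sub St; rewrite /= in_itv/= => /andP[t0 t1].
  have y0 : 0 <= t * m.+1%:R by rewrite mulr_ge0.
  have /andP[h1 h2] := trunc_itv y0.
  have bt : b m (Num.trunc (t * m.+1%:R)) t.
    rewrite /b /ball /= distrC ger0_norm; last by rewrite subr_ge0 ler_pdivrMr.
    by rewrite ltrBlDl -[X in _ + X]mul1r -mulrDl natr1 ltr_pdivlMr.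
  by exists (Num.trunc (t * m.+1%:R)) => //; split => //=; exists t.
rewrite /incidence /=; apply: (closed01_closed (c := S)) => A /nbhs_ballP[eps /= eps0 hA].
have e20 : 0 < eps / 2 by rewrite divr_gt0.
have [m me] := invS_lt e20; have [k _ [/= bt [y [Sy by_]]]] := h m I.
exists y; split => //; apply: hA; rewrite [eps]splitr.
apply: ball_triangle (le_ball (ltW me) (ball_sym bt)) (le_ball (ltW me) by_).
Qed.

Lemma limit_set_null : {ae nu, forall S : closed01 R, lebesgue_measure (S : set R) = 0%E}.
Proof.
have h0 := indic_fubini_tonelli (@lebesgue_measure R) nu incidence_measurable.
have hF := indic_fubini_tonelli_FE nu incidence_measurable.
have hG := indic_fubini_tonelli_GE (@lebesgue_measure R) incidence_measurable.
have h : (\int[@lebesgue_measure R]_t (nu \o xsection incidence) t =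
    \int[nu]_S ((@lebesgue_measure R) \o ysection incidence) S)%E.
  exact: etrans (etrans (congr1 _ (esym hF)) h0) (congr1 _ hG).
have x0 t : nu (xsection incidence t) = 0%E.
  have [t01|t01] := boolP (0 <= t <= 1).
    rewrite -(nu_mem t01); congr (nu _); apply/seteqP; split=> S; by rewrite /xsection /= inE.
  rewrite (_ : xsection _ _ = set0) ?measure0//; apply/seteqP; split=> // S.
  rewrite /xsection /= inE => /closed01_sub; rewrite /= in_itv/= => h'.
  by rewrite h' in t01.
have mG : measurable_fun setT ((@lebesgue_measure R) \o ysection incidence).
  rewrite -hG; exact: (indic_measurable_fun_fubini_tonelli_G (@lebesgue_measure R) incidence_measurable).
have i0 : (\int[nu]_S `|((@lebesgue_measure R) \o ysection incidence) S| = 0)%E.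
  rewrite -[RHS](_ : (\int[@lebesgue_measure R]_t (nu \o xsection incidence) t = 0)%E).
    by rewrite h; apply: eq_integral => S _; rewrite gee0_abs.
  by rewrite -[RHS](integral0 (@lebesgue_measure R) setT); apply: eq_integral => t _; exact: x0.
have := (ae_eq_integral_abs nu measurableT mG).1 i0.
apply: aeS => S /= /(_ I); rewrite (_ : ysection incidence S = S)//.
by apply/seteqP; split=> t; rewrite /ysection /= inE.
Qed.

Lemma avoid_grid l : {ae nu, forall S : closed01 R, forall k, ~ (S : set R) (k%:R / 2 ^+ l)}.
Proof.
apply: ae_foralln => k; exists [set S : closed01 R | (S : set R) (k%:R / 2 ^+ l)]; split.
- exact: mem_measurable.
- have [k01|k01] := boolP (0 <= (k%:R / 2 ^+ l : R) <= 1); first exact: nu_mem.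
  rewrite (_ : [set _ | _] = set0) ?measure0//; apply/seteqP; split=> // S /= /closed01_sub.
  by rewrite /= in_itv/= => h; rewrite h in k01.
- by move=> S /contrapT.
Qed.

Let away (r : seq R) l : set (borel (closed01 R)) :=
  \bigcap_(t in [set` r]) inside l (fun k => ~~ near_block l t k).

Let away_measurable r l : measurable (away r l).
Proof. by apply: fin_bigcap_measurable => // t _; exact: inside_measurable. Qed.

(** Keeping away from one point costs [1 - e l _], which tends to 0; the finitely many points of [r]
    share the budget [eta]. *)
Let away_cost (r : seq R) eta : (forall t, t \in r -> 0 <= t <= 1) -> 0 < eta ->
  \forall l \near \oo, forall A, measurable A -> fine (nu A) <= fine (nu (A `&` away r l)) + eta.
Proof.
elim: r eta => [|t r IH] eta r01 eta0.
  near=> l => A mA; rewrite (_ : away [::] l = setT) ?setIT ?lerDl ?ltW//.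
  by apply/seteqP; split.
have e20 : 0 < eta / 2 by rewrite divr_gt0.
have t01 : 0 <= t <= 1 by apply: r01; exact: mem_head.
near=> l => A mA.
have IH' : forall A, measurable A -> fine (nu A) <= fine (nu (A `&` away r l)) + eta / 2.
  near: l; apply: IH => // t' t'r; apply: r01; by rewrite inE t'r orbT.
have h : `|1 - e l (fun k => ~~ near_block l t k)| <= eta / 2.
  by near: l; apply: ((cvgrPdist_le _ _).1 (e_avoid t t01)).
pose J := inside l (fun k => ~~ near_block l t k) : set (borel (closed01 R)).
have mJ : measurable J by exact: inside_measurable.
have -> : away (t :: r) l = J `&` away r l.
  apply/seteqP; split=> [S hS|S [h1 h2] t' /=].
    by split=> [|t' t'r]; apply: hS; rewrite /= ?mem_head// inE (t'r : t' \in r) orbT.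
  by rewrite inE => /orP[/eqP ->//|]; exact: h2.
have mAr := measurableI _ _ mA (away_measurable r l).
have : fine (nu (A `&` away r l)) <= fine (nu (A `&` (J `&` away r l))) + eta / 2.
  have J1 : fine (nu (~` J)) <= eta / 2.
    rewrite probability_setC// fineB ?fin_num_measure//= nu_inside/=.
    by apply: le_trans h; exact: ler_norm.
  apply: le_trans (_ : _ <= fine (nu (A `&` (J `&` away r l))) + fine (nu (~` J))) _; last by rewrite lerD2l.
  have mAJ : measurable (A `&` (J `&` away r l)) by apply: measurableI => //; exact: measurableI.
  have mJc := measurableC mJ.
  rewrite -!int_indic// -intD; try exact: bmeas_indic.
  apply: int_le; [exact: bmeas_indic|by apply: bmeasD; exact: bmeas_indic|].
  move=> S; rewrite !indicE !in_setI in_setC -natrD ler_nat.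
  by case: (S \in A); case: (S \in J); case: (S \in away r l).
have := IH' A mA; lra.
Unshelve. all: by end_near. Qed.

Section energy_of_union.
Variables (E : set R) (s : seq R).
Hypothesis E01 : E `<=` `[0, 1].
Hypothesis sE : separates s E.

Let block l k : set R := [set x | k%:R / 2 ^+ l <= x <= k.+1%:R / 2 ^+ l].
Definition inner l k := `[< block l k `<=` E >].
Definition outer l k := `[< block l k `&` E !=set0 >].

Lemma inner_sub l : dy l (inner l) `<=` E.
Proof. by move=> x /dyP[k [_ /asboolP h kx]]; exact: h. Qed.

Lemma outer_sup l : E `<=` dy l (outer l).
Proof.
move=> x Ex; have := E01 Ex; rewrite /= in_itv/= => /(trunc_block l)[k [kl kx]].
by apply/dyP; exists k; split => //; apply/asboolP; exists x.
Qed.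

(** A block that meets [E] without being contained in it contains a separating point of [s]. Hence a
    set in the outer union that avoids the grid points and stays away from the blocks near such
    points is already in the inner union. *)
Lemma outer_inner eta : 0 < eta -> \forall l \near \oo, e l (outer l) <= e l (inner l) + eta.
Proof.
move=> eta0; pose r := [seq t <- s | 0 <= t <= 1].
have r01 t : t \in r -> 0 <= t <= 1 by rewrite mem_filter => /andP[].
near=> l.
have : forall A, measurable A -> fine (nu A) <= fine (nu (A `&` away r l)) + eta.
  by near: l; exact: away_cost.
have mo := @inside_measurable R l (outer l); have mi := @inside_measurable R l (inner l).
move=> /(_ _ mo); rewrite nu_inside/= => h; apply: le_trans h _.
rewrite lerD2r -[leRHS]/(fine (e l (inner l))%:E) -nu_inside.
apply: ae_fine_le => //; first exact: measurableI.
apply: aeS (avoid_grid l) => S gr [So Sa] x Sx.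
have := closed01_sub Sx; rewrite /= in_itv/= => x01.
have [k [kl /andP[k1 k2]]] := trunc_block l x01.
have {}k1 : k%:R / 2 ^+ l < x.
  by rewrite lt_neqAle k1 andbT; apply/eqP => xe; apply: (gr k); rewrite xe.
have {}k2 : x < k.+1%:R / 2 ^+ l.
  by rewrite lt_neqAle k2 andbT; apply/eqP => xe; apply: (gr k.+1); rewrite -xe.
apply/dyP; exists k; rewrite !ltW//; split => //; apply/asboolP => y ky.
apply: contrapT => nEy.
have /asboolP[z [kz Ez]] : outer l k by apply: (dy_int k1 k2); exact: So.
have [t ts tb] := sE Ez nEy.
have kt : k%:R / 2 ^+ l <= t <= k.+1%:R / 2 ^+ l.
  by move: ky kz tb => /andP[? ?] /andP[? ?] [] /andP[? ?]; apply/andP; split; lra.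
have t01 : 0 <= t <= 1.
  have p2 := pow2_gt0 R l; move: kt => /andP[h1 h2]; apply/andP; split.
    by rewrite (le_trans _ h1)// divr_ge0// ltW.
  by rewrite (le_trans h2)// ler_pdivrMr// mul1r -natrX ler_nat.
have tr : t \in r by rewrite mem_filter t01.
have : ~~ near_block l t k.
  apply: (dy_int k1 k2 (B := fun k => ~~ near_block l t k)); exact: (Sa t tr).
by move=> /negP; apply; apply: near_blockP => //; case/andP: t01.
Unshelve. all: by end_near. Qed.

Lemma limit_set_energy (x : \bar R) :
  (forall l B, dy l B `<=` E -> ((e l B)%:E <= x)%E) ->
  (forall l B, E `<=` dy l B -> (x <= (e l B)%:E)%E) ->
  nu [set S : closed01 R | (S : set R) `<=` E] = x.
Proof.
move=> lo up.
have mE := sub_union_measurable sE.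
have nlo l : e l (inner l) <= fine (nu [set S : closed01 R | (S : set R) `<=` E]).
  rewrite -[leLHS]/(fine (e l (inner l))%:E) -nu_inside; apply: ae_fine_le => //.
    exact: inside_measurable.
  by apply: aeW => S h y /h; exact: inner_sub.
have nup l : fine (nu [set S : closed01 R | (S : set R) `<=` E]) <= e l (outer l).
  rewrite -[leRHS]/(fine (e l (outer l))%:E) -nu_inside; apply: ae_fine_le => //.
    exact: inside_measurable.
  by apply: aeW => S h y /h; exact: outer_sup.
have lo' l := lo l _ (@inner_sub l); have up' l := up l _ (@outer_sup l).
case: x {lo up} lo' up' => [x| |] lo' up'; last 2 first.
- by have := up' 0%N; rewrite leye_eq.
- by have := lo' 0%N; rewrite leeNy_eq.
rewrite -[LHS]fineK ?fin_num_measure//; congr (_%:E).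
apply/eqP; rewrite eq_le; apply/andP; split; apply/ler_addgt0Pr => eta eta0.
  have [l _ hl] := outer_inner eta0.
  rewrite (le_trans (nup l))// (le_trans (hl l (leqnn l)))// lerD2r -lee_fin; exact: lo'.
have [l _ hl] := outer_inner eta0.
rewrite -lee_fin (le_trans (up' l))// lee_fin (le_trans (hl l (leqnn l)))// lerD2r; exact: nlo.
Qed.

End energy_of_union.
End limit_set_properties.

(** There are finitely many dyadic unions of level [n], so they form a measurable set; masks on
    ordinals become masks on [nat]. *)
Lemma spectral_dyadic (R : realType) n (nu : probability (borel (closed01 R)) R) :
  nu [set S : closed01 R | exists A : {set 'I_(2 ^ n)}, S = dyadic_union R A :> set R] = 1%E ->
  {ae nu, forall S : closed01 R, exists A, S = dy n A :> set R}.
Proof.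
move=> h; set W := [set S | _] in h.
have WE : W = \bigcup_(A in [set: {set 'I_(2 ^ n)}]) [set S : closed01 R | S = dyadic_union R A :> set R].
  by apply/seteqP; split=> S; [move=> [A SA]; exists A|move=> [A _ SA]; exists A].
have sub (A : {set 'I_(2 ^ n)}) : exists B, dyadic_union R A = dy n B.
  exists (fun k => k \in [seq val i | i <- enum A]).
  apply/seteqP; split=> x.
    move=> /dyadic_unionP[k [kA kx]]; apply/dyP; exists k; split => //.
    by apply: map_f; rewrite mem_enum.
  move=> /dyP[k [_ /mapP[i iA ->] kx]]; apply/dyadic_unionP; exists i; split => //.
  by rewrite mem_enum in iA.
have mW : measurable (W : set (borel (closed01 R))).
  rewrite WE; apply: countable_bigcupT_measurable; first exact: countableP.
  move=> A; have [B AB] := sub A.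
  rewrite (_ : [set S | _] = [set cdy R n B]).
    rewrite -[X in measurable X]setCK; apply: measurableC; apply: sub_sigma_algebra.
    rewrite /= openC; apply: accessible_closed_set1; apply: hausdorff_accessible.
    exact: (@metric_hausdorff R).
  apply/seteqP; split=> S /=; first by move=> SA; apply: closed01_inj; rewrite SA AB.
  by move=> ->; rewrite AB.
exists (~` W); split; first exact: measurableC.
  by have := probability_setC nu mW; rewrite [X in (1 - X)%E]h subee.
by move=> S /= nS [A SA]; have [B AB] := sub A; apply: nS; exists B; rewrite SA AB.
Qed.

Theorem theorem4p2 (R : realType) (G : undergroupType R)
  (mu : R -> probability (borel G) R) (Hmu : conv_semigroup mu)
  (mun : nat -> probability (borel G) R)
  (HmunM : forall n, (0 < n)%N -> sigma_compact_supported (mun n))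
  (Hmun : forall n, (0 < n)%N -> conv_defined (mun n) (mun n))
  (Hcvg : forall k l : nat,
    KR (conv_pow (mun n) (k * 2 ^ (n - l))) (mu (k%:R / 2 ^+ l))
      @[n --> \oo] --> (0 : R))
  (psi : G -> R)
  (psi_bounded : exists M : R, forall f, `|psi f| <= M)
  (psi_measurable : measurable_fun setT (psi : borel G -> R))
  (psi_continuous : {ae mu 1, forall f : G, {for f, continuous psi}})
  (psi_norm : \int[mu 1]_f `|psi f| ^+ 2 = 1)
  (c : nat -> R)
  (Hc : forall n, c n = \int[conv_pow (mun n) (2 ^ n)]_f `|psi f| ^+ 2)
  (d : nat -> measure_display) (Omega : forall n, measurableType (d n))
  (P : forall n, probability (Omega n) R)
  (P_complete : forall n, (0 < n)%N -> measure_is_complete (P n))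
  (X : forall n, int -> {RV (P n) >-> borel G})
  (HX : forall n, (0 < n)%N -> discrete_process (mun n) (X n))
  (nun : nat -> probability (borel (closed01 R)) R)
  (Hnun : forall n, (0 < n)%N -> 0 < c n ->
    is_spectral_measure n (X n) (fun f => (Num.sqrt (c n))^-1 * psi f)
      (nun n)) :
  exists nu : probability (borel (closed01 R)) R,
  [/\ weak_cvg nun nu,
      {ae nu, forall S : closed01 R, lebesgue_measure (S : set R) = 0%E},
      forall t : R, 0 <= t <= 1 -> nu [set S : closed01 R | (S : set R) t] = 0%E
    & forall (d' : measure_display) (Omega' : measurableType d')
        (P' : probability Omega' R) (Y : R -> R -> {RV P' >-> borel G}),
      measure_is_complete P' -> indep_process mu Y ->
      forall E : set R, E `<=` `[0, 1] -> finite_union_of_intervals E ->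
        nu [set S : closed01 R | (S : set R) `<=` E] =
        cond_energy P' (process_field Y E) (fun w => psi (Y 0 1 w))].
Proof.
have [M pM] := psi_bounded.
have bpsi : bmeas (psi : borel G -> R) by split => //; exists M.
pose e := energy nun.
have e_cvg l B : fine (nun n (inside l B)) @[n --> \oo] --> e l B.
  exact: (energyP Hmu HmunM Hmun Hcvg bpsi psi_continuous psi_norm Hc P_complete HX Hnun).
have e_avoid (t : R) : 0 <= t <= 1 -> e l (fun k => ~~ near_block l t k) @[l --> \oo] --> (1 : R).
  exact: (energy_avoid Hmu HmunM Hmun Hcvg bpsi psi_continuous psi_norm Hc P_complete HX Hnun).
have nun_dyadic : \forall n \near \oo,
    {ae nun n, forall S : closed01 R, exists A, S = dy n A :> set R}.
  (* [c n] tends to 1, so it is eventually positive and [Hnun] applies. *)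
  have c1 := c_cvg1 Hmu HmunM Hmun Hcvg bpsi psi_continuous psi_norm Hc.
  near=> n; apply: spectral_dyadic.
  have cn : 0 < c n.
    near: n; apply: filterS ((cvgrPdist_lt _ _).1 c1 _ ltr01) => n /=.
    by rewrite ltr_norml => /andP[_]; lra.
  by have [] := Hnun n _ cn; first by near: n; exists 1%N.
have [nu [wnu nu_inside nu_mem]] := random_set_exists e_cvg nun_dyadic e_avoid.
exists nu; split => //; first exact: (limit_set_null nu_mem).
move=> d' O' P' Y Pc HY E E01 /union_separated[s sE].
have bY : bmeas (psi \o Y 0 1 : O' -> R) by apply: (bmeas_comp bpsi); exact: measurable_funP.
have sub F : subsig P' (process_field Y F).
  by apply: sigma_field_subsig => // uv; exact: measurable_funP.
have mono F F' : F `<=` F' -> process_field Y F `<=` process_field Y F'.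
  move=> FF; apply: sigma_field_mono => uv [h1 h2]; split => //.
  exact: classical_sets.subset_trans h2 FF.
have eE l B : cond_energy P' (process_field Y (dy l B)) (psi \o Y 0 1) = (e l B)%:E.
  exact: (energy_process Hmu HmunM Hmun Hcvg bpsi psi_continuous psi_norm Hc P_complete HX Hnun).
(* Monotonicity of the energy in the sigma-field gives the bounds from the dyadic unions inside and
   around [E]. *)
apply: (limit_set_energy nu_inside nu_mem e_avoid E01 sE) => l B h;
  rewrite -eE; apply: cond_energy_mono => //; exact: mono.
Unshelve. all: by end_near. Qed.
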